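(* Let $G$ be a metric on channels (not assumed to come from an inner product) satisfying, for all local channel data $\{\Phi,\Delta\}$: (M1) $G_\Phi(\Delta)\ge G_{\Phi\circ\Psi}(\Delta\circ\Psi)$ for every channel $\Psi$ whose output space is the input space of $\Phi$; (M2) $G_\Phi(\Delta)\ge G_{\Psi\circ\Phi}(\Psi\circ\Delta)$ for every channel $\Psi$ whose input space is the output space of $\Phi$; (E) $G_{\Phi\otimes\mathbf I}(\Delta\otimes\mathbf I)=G_\Phi(\Delta)$, where $\mathbf I$ is the identity channel on any space; (A) $\lim_{n\to\infty}\frac1nG_{\Phi^{\otimes n}}(\Delta^{(n)})=G_\Phi(\Delta)$; (C) if $\{\Phi^n,\Delta^n\}$ is a sequence of local channel data with $\|\Phi^n-\Phi^{\otimes n}\|_{\mathrm{cb}}\to0$ and $\frac1{\sqrt n}\|\Delta^n-\Delta^{(n)}\|_{\mathrm{cb}}\to0$, then $\liminf_{n\to\infty}\frac1n\left(G_{\Phi^n}(\Delta^n)-G_{\Phi^{\otimes n}}(\Delta^{(n)})\right)\ge0$; (N0) $G_{\mathrm N(0,1)}(\delta\mathrm N(0,1))=1$. Let $\Omega_{\mathrm{in}}\subset\mathbb R^d$ be compact, let $\Omega_{\mathrm{out}}$ be a finite set, and let $\{\Phi,\Delta\}$ be local channel data from $\Omega_{\mathrm{in}}$ to $\Omega_{\mathrm{out}}$ such that $$\max\left\{\|\Phi(\cdot|x)-\Phi(\cdot|x')\|_1,\ \|\Delta(\cdot|x)-\Delta(\cdot|x')\|_1\right\}\le f(\|x-x'\|)\qquad\text{for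 all }x,x'\in\Omega_{\mathrm{in}}$$ for some function $f$ with $\lim_{t\to0}f(t)=0$, where $\|x\|$ is the Euclidean norm. Suppose in addition that $G$ satisfies, at $\{\Phi,\Delta\}$, (C2) if $\{\Phi_t,\Delta_t\}$ is a family of local channel data from $\Omega_{\mathrm{in}}$ to $\Omega_{\mathrm{out}}$ with $\lim_{t\to0}\|\Phi_t-\Phi\|_{\mathrm{cb}}=\lim_{t\to0}\|\Delta_t-\Delta\|_{\mathrm{cb}}=0$, then $\lim_{t\to0}G_{\Phi_t}(\Delta_t)=G_\Phi(\Delta)$. Then $$G_\Phi(\Delta)=G^{\min}_\Phi(\Delta):=\sup_{x\in\Omega_{\mathrm{in}}}J_{\Phi(\cdot|x)}(\Delta(\cdot|x)).$$
   Context: Spaces are finite sets, $\mathbb R^d$, (measurable) subsets of these, and finite products. A channel $\Phi$ from $\Omega_{\mathrm{in}}$ to $\Omega_{\mathrm{out}}$ is a Markov kernel $\Phi(\cdot|x)$, viewed also as a linear map from (signed) measures on $\Omega_{\mathrm{in}}$ to (signed) measures on $\Omega_{\mathrm{out}}$; composition and tensor product are those of kernels. A tangent vector $\Delta$ at $\Phi$ is a map of the form $c(\Psi_1-\Psi_2)$, $c\in\mathbb R$, with $\Psi_1,\Psi_2$ channels between the same spaces; $\Delta(\cdot|x):=c(\Psi_1(\cdot|x)-\Psi_2(\cdot|x))$. For a probability measure $p$ and a signed measure $\delta$ of total mass $0$ absolutely continuous with respect to $p$, the Fisher information is $J_p(\delta):=\int(\mathrm d\delta/\mathrm dp)^2\,\mathrm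 dp$. Local channel data $\{\Phi,\Delta\}$ is a channel together with a tangent vector at it such that $\Delta(\cdot|x)$ is absolutely continuous with respect to $\Phi(\cdot|x)$ for all $x$ and $\sup_xJ_{\Phi(\cdot|x)}(\Delta(\cdot|x))<\infty$. A metric $G$ on channels assigns to every local channel data (between any spaces) a real number $G_\Phi(\Delta)\ge0$ such that, for fixed $\Phi$, $\Delta\mapsto\sqrt{G_\Phi(\Delta)}$ is a norm on the linear space of admissible $\Delta$. A probability distribution $p$ is identified with the channel sending every input to $p$ (for instance the channel from a one-point space), and similarly for $\delta$, so $G_p(\delta)$ makes sense. $\mathrm N(0,1)$ is the standard Gaussian distribution on $\mathbb R$, with density $\varphi(x)=\frac{1}{\sqrt{2\pi}}e^{-x^2/2}$, and $\delta\mathrm N(0,1)$ is the signed measure with density $x\varphi(x)$. $\Delta^{(n)}:=\Delta\otimes\Phi^{\otimes n-1}+\Phi\otimes\Delta\otimes\Phi^{\otimes n-2}+\cdots+\Phi^{\otimes n-1}\otimes\Delta$. For a linear map $\Lambda$ between spaces of signed measures, $\|\Lambda\|_{\mathrm{cb}}:=\sup_p\|(\Lambda\otimes\mathbf I)(p)\|_1$, the supremum being over probability distributions $p$ on the product of the input space with an auxiliary space, and $\|\cdot\|_1$ denoting total variation norm. In (C), $\Phi^n,\Delta^n$ have the same input and output spaces as $\Phi^{\otimes n}$. *)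

(* Defs.v *)
From HB Require Import structures.
From mathcomp Require Import all_boot all_order all_algebra.
From mathcomp Require Import all_classical all_reals all_analysis.
From mathcomp Require Import measurable_realfun.
From mathcomp Require Import ring.

Set Implicit Arguments.
Unset Strict Implicit.
Unset Printing Implicit Defensive.

Import Order.TTheory GRing.Theory Num.Def Num.Theory.
Import numFieldNormedType.Exports.

Local Open Scope classical_set_scope.
Local Open Scope ring_scope.
Local Open Scope ereal_scope.
Local Open Scope charge_scope.

Definition finite_discrete d (T : measurableType d) : Prop :=
  finite_set [set: T] /\ forall A : set T, measurable A.

Definition euclidean (R : realType) (n : nat) : measurableType _ :=
  g_sigma_algebraType (@open 'rV[R]_n).

Definition enorm (R : realType) (n : nat) (v : 'rV[R]_n) : R :=
  Num.sqrt (\sum_i v ord0 i ^+ 2)%R.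

Section measurable_subset.
Context d (T : measurableType d) (A : set T).

Definition subset_type of A !=set0 : Type := set_type A.

Variable A0 : A !=set0.

Definition subset_point : subset_type A0 :=
  SigSub (mem_set (svalP (cid A0))).

HB.instance Definition _ := gen_eqMixin (subset_type A0).
HB.instance Definition _ := gen_choiceMixin (subset_type A0).
HB.instance Definition _ := isPointed.Build (subset_type A0) subset_point.

Definition subset_val (x : subset_type A0) : T := set_val x.

(* The preimage sigma-algebra under the inclusion is the trace on A. *)
Definition measurable_subset : measurableType _ :=
  g_sigma_algebra_preimageType subset_val.

End measurable_subset.

Section spaces.
Variable R : realType.

(* A [measurableType] is pointed, so every space is nonempty.  R is admitted
   beside R^1 for convenience; a subset of a finite set is a finite set, so
   subsets are only taken in R^n. *)
Inductive is_space : forall d, measurableType d -> Prop :=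
| is_space_finite d (T : measurableType d) :
    finite_discrete T -> is_space T
| is_space_real : is_space (measurableTypeR R : measurableType _)
| is_space_euclidean n : is_space (euclidean R n)
| is_space_subset n (A : set (euclidean R n)) (A0 : A !=set0) :
    measurable A -> is_space (measurable_subset A0)
| is_space_prod d1 d2 (T1 : measurableType d1) (T2 : measurableType d2) :
    is_space T1 -> is_space T2 -> is_space (T1 * T2)%type.

Record kspace := KSpace {
  kspace_display : measure_display;
  kspace_sort :> measurableType kspace_display;
  kspaceP : is_space kspace_sort }.

Lemma finite_discrete_unit : finite_discrete unit.
Proof. by split => //; exact: finite_finset. Qed.

Definition point_space : kspace := KSpace (is_space_finite finite_discrete_unit).

Definition real_space : kspace := KSpace is_space_real.

Definition prod_space (X Y : kspace) : kspace :=
  KSpace (is_space_prod (kspaceP X) (kspaceP Y)).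

Lemma compact_measurable n (A : set 'rV[R]_n) :
  compact A -> measurable (A : set (euclidean R n)).
Proof.
move=> cA; rewrite -(setCK A); apply: measurableC; apply: sub_sigma_algebra.
by apply: closed_openC; apply: compact_closed => //; exact: norm_hausdorff.
Qed.

Definition compact_space n (A : set 'rV[R]_n) (cA : compact A)
    (A0 : A !=set0) : kspace :=
  KSpace (is_space_subset (A := A : set (euclidean R n)) A0
           (compact_measurable cA)).

Definition compact_val n (A : set 'rV[R]_n) (cA : compact A) (A0 : A !=set0)
    (x : compact_space cA A0) : 'rV[R]_n :=
  @subset_val _ (euclidean R n) A A0 x.

End spaces.

Section prob_kernel_measure.
Context d d' (X : measurableType d) (Y : measurableType d') (R : realType).
Variable k : R.-pker X ~> Y.

(* k(.|x), carrying the probability structure that [k x] lacks. *)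
Definition output (x : X) : set Y -> \bar R := k x.

HB.instance Definition _ (x : X) := Measure.on (output x).
HB.instance Definition _ (x : X) :=
  Measure_isProbability.Build _ _ _ (output x) (prob_kernel x).

End prob_kernel_measure.

Section kpull.
Context d d' d'' (W : measurableType d) (X : measurableType d')
  (Y : measurableType d'') (R : realType).
Variables (g : W -> X).

Definition kpull_fun of measurable_fun [set: W] g :=
  fun (k : R.-pker X ~> Y) (w : W) => k (g w) : {measure set Y -> \bar R}.

Variables (mg : measurable_fun [set: W] g) (k : R.-pker X ~> Y).

Let kpull_measurable U :
  measurable U -> measurable_fun [set: W] (kpull_fun mg k ^~ U).
Proof.
by move=> mU; exact: (measurableT_comp (measurable_kernel k _ mU) mg).
Qed.

HB.instance Definition _ :=
  isKernel.Build _ _ _ _ R (kpull_fun mg k) kpull_measurable.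

Let kpull_prob w : kpull_fun mg k w [set: Y] = 1.
Proof. exact: prob_kernel. Qed.

HB.instance Definition _ :=
  Kernel_isProbability.Build _ _ _ _ R (kpull_fun mg k) kpull_prob.

Definition kpull : R.-pker W ~> Y := kpull_fun mg k.

End kpull.

Section tensor_kernel.
Context d1 d2 d3 d4 (X : measurableType d1) (X' : measurableType d2)
  (Y : measurableType d3) (Y' : measurableType d4) (R : realType).
Variables (k : R.-pker X ~> Y) (k' : R.-pker X' ~> Y').

Definition tensor_fun (x : X * X') : {measure set (Y * Y') -> \bar R} :=
  output k x.1 \x output k' x.2.

Let tensor_fun_measurable U :
  measurable U -> measurable_fun [set: X * X'] (tensor_fun ^~ U).
Proof.
move=> mU.
pose V := [set q : (X * X' * Y) * Y' | U (q.1.2, q.2)].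
have mV : measurable V.
  have mf : measurable_fun [set: (X * X' * Y) * Y'] (fun q => (q.1.2, q.2)).
    apply: measurable_fun_pair => //=.
    exact: (measurableT_comp measurable_snd measurable_fst).
  by rewrite -[V]setTI; exact: mf.
have m1 : measurable_fun [set: X * X' * Y] (fun q => q.1.2).
  exact: (measurableT_comp measurable_snd measurable_fst).
have mk := @measurable_fun_xsection_finite_kernel _ _ _ _ _ (kpull m1 k') _
  (mem_set mV).
apply: (measurable_fun_integral_finite_kernel
  (fun q : X * X' * Y => output k' q.1.2 (xsection U q.2))
  (kpull (@measurable_fst _ _ X X') k)) => //=.
Qed.

HB.instance Definition _ :=
  isKernel.Build _ _ _ _ R tensor_fun tensor_fun_measurable.

Let tensor_fun_prob x : tensor_fun x [set: Y * Y'] = 1.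
Proof.
rewrite /tensor_fun -setXTT /=.
have := @product_measure1E _ _ _ _ _ (output k x.1) (output k' x.2) _ _
  measurableT measurableT.
by rewrite /= => ->; rewrite /output !prob_kernel mule1.
Qed.

HB.instance Definition _ :=
  Kernel_isProbability.Build _ _ _ _ R tensor_fun tensor_fun_prob.

End tensor_kernel.

Definition channel (R : realType) (X Y : kspace R) : Type := R.-pker X ~> Y.

Section channels.
Variable R : realType.
Implicit Types X Y Z : kspace R.

(* Measures are functions on all subsets, so equality of channels is agreement
   on the measurable ones. *)
Definition eq_channel X Y (Phi Psi : channel X Y) : Prop :=
  forall x A, measurable A -> Phi x A = Psi x A.

Definition id_channel X : channel X X :=
  kdirac (@measurable_id _ X [set: X]).

Section const_channel.
Context X Y (p : probability Y R).
Definition const_fun (_ : X) : {measure set Y -> \bar R} := p.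
Let const_fun_measurable U :
  measurable U -> measurable_fun [set: X] (const_fun ^~ U).
Proof. by move=> mU; exact: measurable_cst. Qed.
HB.instance Definition _ :=
  isKernel.Build _ _ X Y R const_fun const_fun_measurable.
Let const_fun_prob x : const_fun x [set: Y] = 1.
Proof. exact: probability_setT. Qed.
HB.instance Definition _ :=
  Kernel_isProbability.Build _ _ X Y R const_fun const_fun_prob.
Definition const_channel : channel X Y := const_fun.
End const_channel.

Section comp_channel.
Context X Y Z (Phi : channel Y Z) (Psi : channel X Y).
Definition comp_fun : X -> {measure set Z -> \bar R} :=
  mkcomp_noparam Psi Phi.
HB.instance Definition _ := SubProbabilityKernel.on comp_fun.
Let comp_fun_prob x : comp_fun x [set: Z] = 1.
Proof.
rewrite /comp_fun /= /kcomp_noparam.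
under eq_integral do rewrite prob_kernel.
by rewrite integral_cst// mul1e prob_kernel.
Qed.
HB.instance Definition _ :=
  isProbabilityKernel.Build _ _ X Z R comp_fun comp_fun_prob.
Definition comp_channel : channel X Z := comp_fun.

Lemma comp_channelE x A : comp_channel x A = \int[Psi x]_y Phi y A.
Proof. by []. Qed.
End comp_channel.

Definition tensor_channel X X' Y Y' (Phi : channel X Y) (Psi : channel X' Y') :
    channel (prod_space X X') (prod_space Y Y') :=
  tensor_fun Phi Psi.

Section mix_channel.
Context X Y (p : {i01 R}) (Phi Psi : channel X Y).
Definition mix_fun (x : X) : {measure set Y -> \bar R} :=
  measure_add (mscale (p%:num)%:nng%R (Phi x))
    (mscale (1 - p%:num)%:nng%R (Psi x)).
Let mix_funE x A : mix_fun x A =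
  (p%:num)%:E * Phi x A + (1 - p%:num)%:E * Psi x A.
Proof. exact: measure_addE. Qed.
Let mix_fun_measurable U :
  measurable U -> measurable_fun [set: X] (mix_fun ^~ U).
Proof.
move=> mU; under eq_fun do rewrite mix_funE.
by apply: emeasurable_funD; apply: measurable_funeM; exact: measurable_kernel.
Qed.
HB.instance Definition _ :=
  isKernel.Build _ _ X Y R mix_fun mix_fun_measurable.
Let mix_fun_prob x : mix_fun x [set: Y] = 1.
Proof. by rewrite mix_funE !prob_kernel !mule1 -EFinD addrC subrK. Qed.
HB.instance Definition _ :=
  Kernel_isProbability.Build _ _ X Y R mix_fun mix_fun_prob.
Definition mix_channel : channel X Y := mix_fun.

Lemma mix_channelE x A : mix_channel x A =
  (p%:num)%:E * Phi x A + (1 - p%:num)%:E * Psi x A.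
Proof. exact: mix_funE. Qed.
End mix_channel.

End channels.

Section charges.
Context d (T : measurableType d) (R : realType).

Definition cdiff (nu1 nu2 : {charge set T -> \bar R}) :
    {charge set T -> \bar R} :=
  cadd nu1 (copp nu2).

Definition charge_of_prob (p : probability T R) : {charge set T -> \bar R} :=
  charge_of_finite_measure p.

Definition fisher (p : probability T R) (nu : {charge set T -> \bar R}) :
    \bar R :=
  \int[p]_x ('d nu '/d p) x ^+ 2.

Definition hahn_pos (nu : {charge set T -> \bar R}) : set T :=
  sval (cid (Hahn_decomposition nu)).

Definition hahn_neg (nu : {charge set T -> \bar R}) : set T :=
  sval (cid (svalP (cid (Hahn_decomposition nu)))).

Definition hahnP (nu : {charge set T -> \bar R}) :
    hahn_decomposition nu (hahn_pos nu) (hahn_neg nu) :=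
  svalP (cid (svalP (cid (Hahn_decomposition nu)))).

(* The total mass of |nu|; not halved. *)
Definition tv_norm (nu : {charge set T -> \bar R}) : \bar R :=
  charge_variation (hahnP nu) [set: T].

End charges.

(* The map c (Psi_1 - Psi_2).  Distinct triples may denote the same map; [eq_tangent]
   is equality of the denoted maps. *)
Record tangent (R : realType) (X Y : kspace R) := Tangent {
  tcoef : R;
  tpos : channel X Y;
  tneg : channel X Y }.

Definition tangent_at (R : realType) (X Y : kspace R) (D : tangent X Y)
    (x : X) : {charge set Y -> \bar R} :=
  cscale (tcoef D) (cdiff (charge_of_prob (output (tpos D) x))
                          (charge_of_prob (output (tneg D) x))).
Coercion tangent_at : tangent >-> Funclass.

Section tangents.
Variable R : realType.
Implicit Types X Y Z : kspace R.

Lemma tangentE X Y (D : tangent X Y) x A :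
  D x A = (tcoef D)%:E * (tpos D x A - tneg D x A).
Proof. by []. Qed.

Definition eq_tangent X Y (D E : tangent X Y) : Prop :=
  forall x A, measurable A -> D x A = E x A.

(* Suffixes: t for a tangent vector, c for a channel, in the order of the
   factors. *)
Definition comp_tc X Y Z (D : tangent Y Z) (Psi : channel X Y) : tangent X Z :=
  Tangent (tcoef D) (comp_channel (tpos D) Psi) (comp_channel (tneg D) Psi).

Definition comp_ct X Y Z (Psi : channel Y Z) (D : tangent X Y) : tangent X Z :=
  Tangent (tcoef D) (comp_channel Psi (tpos D)) (comp_channel Psi (tneg D)).

Definition tensor_tc X X' Y Y' (D : tangent X Y) (Psi : channel X' Y') :
    tangent (prod_space X X') (prod_space Y Y') :=
  Tangent (tcoef D) (tensor_channel (tpos D) Psi) (tensor_channel (tneg D) Psi).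

Definition tensor_ct X X' Y Y' (Psi : channel X Y) (D : tangent X' Y') :
    tangent (prod_space X X') (prod_space Y Y') :=
  Tangent (tcoef D) (tensor_channel Psi (tpos D)) (tensor_channel Psi (tneg D)).

Definition diff_channel X Y (Phi Psi : channel X Y) : tangent X Y :=
  Tangent 1 Phi Psi.

Definition scale_tangent X Y (a : R) (D : tangent X Y) : tangent X Y :=
  Tangent (a * tcoef D) (tpos D) (tneg D).

Lemma weight_ge0 (a b : R) : (0 <= `|a| / (`|a| + `|b|))%R.
Proof. by rewrite divr_ge0// addr_ge0. Qed.

Lemma weight_le1 (a b : R) : (`|a| / (`|a| + `|b|) <= 1)%R.
Proof.
have [->|s0] := eqVneq (`|a| + `|b|)%R 0%R; first by rewrite invr0 mulr0.
by rewrite ler_pdivrMr ?mul1r ?lerDl// lt_neqAle eq_sym s0 addr_ge0.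
Qed.

Definition weight (a b : R) : {i01 R} := Itv01 (weight_ge0 a b) (weight_le1 a b).

(* A sum of two maps of the form c (Psi_1 - Psi_2) is again of this form: write
   both with a nonnegative coefficient and mix; see [add_tangentE]. *)
Definition add_tangent X Y (D E : tangent X Y) : tangent X Y :=
  let p := weight (tcoef D) (tcoef E) in
  let pos F := if (0 <= tcoef F)%R then tpos F else tneg F in
  let neg F := if (0 <= tcoef F)%R then tneg F else tpos F in
  Tangent (`|tcoef D| + `|tcoef E|)
    (mix_channel p (pos D) (pos E)) (mix_channel p (neg D) (neg E)).

Lemma scale_tangentE X Y a (D : tangent X Y) x A : measurable A ->
  scale_tangent a D x A = a%:E * D x A.
Proof. by move=> mA; rewrite !tangentE /= EFinM muleA. Qed.

Lemma channel_fin X Y (Phi : channel X Y) x A : measurable A ->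
  Phi x A \is a fin_num.
Proof. exact: (fin_num_measure (output Phi x)). Qed.

Lemma weightl (a b : R) :
  ((`|a| + `|b|) * (weight a b)%:num = `|a|)%R.
Proof.
rewrite /=; have [s0|s0] := eqVneq (`|a| + `|b|)%R 0%R; last by rewrite mulrC divfK.
by rewrite s0 mul0r; apply/esym/eqP; move/eqP: s0; rewrite paddr_eq0// => /andP[].
Qed.

Lemma weightr (a b : R) :
  ((`|a| + `|b|) * (1 - (weight a b)%:num) = `|b|)%R.
Proof. by rewrite mulrBr weightl mulr1 addrAC subrr add0r. Qed.

Lemma sign_swap (a u v : R) :
  (`|a| * ((if 0 <= a then u else v) - (if 0 <= a then v else u)) =
   a * (u - v))%R.
Proof.
by case: (leP 0%R a) => [/ger0_norm ->//|/ltr0_norm ->]; rewrite mulNr -mulrN opprB.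
Qed.

Lemma add_tangentE X Y (D E : tangent X Y) x A : measurable A ->
  add_tangent D E x A = D x A + E x A.
Proof.
move=> mA; case: D => c a b; case: E => c' a' b'.
rewrite 3!tangentE; cbn [add_tangent tcoef tpos tneg].
rewrite !mix_channelE.
have fE (Phi : channel X Y) : Phi x A = (fine (Phi x A))%:E.
  by rewrite fineK ?channel_fin.
have ifE (B : bool) (Phi Psi : channel X Y) : (if B then Phi else Psi) x A =
    (if B then fine (Phi x A) else fine (Psi x A))%:E.
  by case: B; exact: fE.
rewrite !ifE (fE a) (fE b) (fE a') (fE b').
move: (fine (a x A)) (fine (b x A)) (fine (a' x A)) (fine (b' x A)) => u v u' v'.
move: (weightl c c') (weightr c c') (sign_swap c u v) (sign_swap c' u' v').
move: (weight c c')%:num => p.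
set P := if _ then u else v; set N := if _ then v else u.
set P' := if _ then u' else v'; set N' := if _ then v' else u'.
move=> wl wr sl sr.
rewrite -!EFinM -!EFinD; congr EFin.
rewrite -sl -sr; move: (`|c|)%R (`|c'|)%R wl wr => s s' wl wr.
transitivity ((s + s') * p * (P - N) + (s + s') * (1 - p) * (P' - N'))%R.
  by ring.
by rewrite wl wr.
Qed.

Definition sub_tangent X Y (D E : tangent X Y) : tangent X Y :=
  add_tangent D (scale_tangent (-1) E).

(* A distribution on the product of the input space and an auxiliary space Z is
   a channel from the one-point space. *)
Definition cb_norm X Y (L : tangent X Y) : \bar R :=
  ereal_sup [set r | exists (Z : kspace R)
      (p : channel (point_space R) (prod_space X Z)),
    r = tv_norm (comp_tc (tensor_tc L (id_channel Z)) p tt)].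

(* Index n stands for the (n+1)-st power. *)

Fixpoint space_pow X (n : nat) : kspace R :=
  if n is m.+1 then prod_space (space_pow X m) X else X.

Fixpoint channel_pow X Y (Phi : channel X Y) (n : nat) :
    channel (space_pow X n) (space_pow Y n) :=
  if n is m.+1 then tensor_channel (channel_pow Phi m) Phi else Phi.

(* Delta^(n+1) = Delta^(n) (x) Phi + Phi^(x)n (x) Delta *)
Fixpoint tangent_pow X Y (Phi : channel X Y) (D : tangent X Y) (n : nat) :
    tangent (space_pow X n) (space_pow Y n) :=
  if n is m.+1 then
    add_tangent (tensor_tc (tangent_pow Phi D m) Phi)
                (tensor_ct (channel_pow Phi m) D)
  else D.

Definition Gmin X Y (Phi : channel X Y) (D : tangent X Y) : \bar R :=
  ereal_sup [set fisher (output Phi x) (D x) | x in [set: X]].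

Definition local_data X Y (Phi : channel X Y) (D : tangent X Y) : Prop :=
  (forall x, D x `<< output Phi x) /\ Gmin Phi D < +oo.

(* The values of G outside of [local_data] are irrelevant. *)
Definition channel_functional : Type :=
  forall X Y, channel X Y -> tangent X Y -> R.

Local Open Scope ring_scope.

(* [metric_ext]: G depends only on the maps denoted by Phi and D.  The other
   fields say that the square root of G is a norm in D. *)
Record is_metric (G : channel_functional) : Prop := {
  metric_ext X Y (Phi Phi' : channel X Y) (D D' : tangent X Y) :
    local_data Phi D -> eq_channel Phi Phi' -> eq_tangent D D' ->
    @G X Y Phi D = @G X Y Phi' D';
  metric_ge0 X Y (Phi : channel X Y) (D : tangent X Y) :
    local_data Phi D -> 0 <= @G X Y Phi D;
  metric_eq0 X Y (Phi : channel X Y) (D : tangent X Y) :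
    local_data Phi D -> Num.sqrt (@G X Y Phi D) = 0 ->
    forall x A, measurable A -> D x A = 0%E;
  metric_scale X Y (Phi : channel X Y) (a : R) (D : tangent X Y) :
    local_data Phi D ->
    Num.sqrt (@G X Y Phi (scale_tangent a D)) = `|a| * Num.sqrt (@G X Y Phi D);
  metric_triangle X Y (Phi : channel X Y) (D E : tangent X Y) :
    local_data Phi D -> local_data Phi E ->
    Num.sqrt (@G X Y Phi (add_tangent D E))
      <= Num.sqrt (@G X Y Phi D) + Num.sqrt (@G X Y Phi E) }.

End tangents.

Arguments channel_functional : clear implicits.

Section axioms.
Variable R : realType.
Variable G : channel_functional R.

Local Open Scope ring_scope.

Definition axiom_M1 : Prop :=
  forall (X Y Z : kspace R) (Phi : channel X Y) (D : tangent X Y)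
      (Psi : channel Z X),
    local_data Phi D ->
    G (comp_channel Phi Psi) (comp_tc D Psi) <= G Phi D.

Definition axiom_M2 : Prop :=
  forall (X Y Z : kspace R) (Phi : channel X Y) (D : tangent X Y)
      (Psi : channel Y Z),
    local_data Phi D ->
    G (comp_channel Psi Phi) (comp_ct Psi D) <= G Phi D.

Definition axiom_E : Prop :=
  forall (X Y Z : kspace R) (Phi : channel X Y) (D : tangent X Y),
    local_data Phi D ->
    G (tensor_channel Phi (id_channel Z)) (tensor_tc D (id_channel Z)) =
    G Phi D.

Definition axiom_A : Prop :=
  forall (X Y : kspace R) (Phi : channel X Y) (D : tangent X Y),
    local_data Phi D ->
    (n.+1%:R^-1 * G (channel_pow Phi n) (tangent_pow Phi D n))
      @[n --> \oo] --> G Phi D.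

Definition axiom_C : Prop :=
  forall (X Y : kspace R) (Phi : channel X Y) (D : tangent X Y)
      (Phi_ : forall n, channel (space_pow X n) (space_pow Y n))
      (D_ : forall n, tangent (space_pow X n) (space_pow Y n)),
    local_data Phi D ->
    (forall n, local_data (Phi_ n) (D_ n)) ->
    cb_norm (diff_channel (Phi_ n) (channel_pow Phi n))
      @[n --> \oo] --> 0%E ->
    (((Num.sqrt n.+1%:R)^-1)%:E *
       cb_norm (sub_tangent (D_ n) (tangent_pow Phi D n)))%E
      @[n --> \oo] --> 0%E ->
    (0 <= limn_einf (fun n => (n.+1%:R^-1 *
       (G (Phi_ n) (D_ n) -
        G (channel_pow Phi n) (tangent_pow Phi D n)))%:E))%E.

(* N(0,1), as a channel from the one-point space. *)
Definition gaussian : channel (point_space R) (real_space R) :=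
  @const_channel R (point_space R) (real_space R) (normal_prob 0 1).

(* The signed measure with density x phi(x), as a tangent vector at N(0,1). *)
Definition is_gaussian_shift (D : tangent (point_space R) (real_space R)) :
    Prop :=
  forall A : set (real_space R), measurable A ->
    D tt A =
    (\int[lebesgue_measure]_(x in A) (x * normal_pdf 0 1 x)%:E)%E.

Definition axiom_N0 : Prop :=
  forall D, is_gaussian_shift D -> G gaussian D = 1.

Definition axiom_C2 (X Y : kspace R) (Phi : channel X Y) (D : tangent X Y) :
    Prop :=
  forall (Phi_ : R -> channel X Y) (D_ : R -> tangent X Y),
    (forall t, local_data (Phi_ t) (D_ t)) ->
    cb_norm (diff_channel (Phi_ t) Phi) @[t --> 0^'] --> 0%E ->
    cb_norm (sub_tangent (D_ t) D) @[t --> 0^'] --> 0%E ->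
    G (Phi_ t) (D_ t) @[t --> 0^'] --> G Phi D.

End axioms.

(* Main.v *)
(* Both inequalities compare {Phi, Delta} with a Gaussian shift through (C).

   Let l = dDelta/dPhi be bounded, N = n + 1, and let L be the sum of the N
   scores, divided by sqrt N.  A Lindeberg replacement shows that L plus a small
   independent Gaussian is close in total variation to an exact Gaussian, with a
   rate in N.  Given such a noisy value, sampling from the posterior
   distribution of the output of Phi^N is a channel, and it approximately
   reproduces Phi^N together with Delta^(N), because Delta^(N) is sqrt N L Phi^N.
   - Upper bound: feed this channel with a Gaussian of shift speed sqrt (N J),
     independent of the input x, where J is the supremum of the Fisher
     informations; the missing variance J - E L^2 is supplied as additional
     noise.  By (M1), (M2), (E) and (N0) the result has metric at most N J.
   - Lower bound: for one input, conversely simulate N(0,1)^N from Phi^N.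
   The upper bound for an unbounded score follows by (C2) from inputs of finite
   range; for a finite output space such inputs make the score bounded. *)

From HB Require Import structures.
Require Import Defs.
From mathcomp Require Import all_boot all_order all_algebra.
From mathcomp Require Import all_classical all_reals all_analysis.
From mathcomp Require Import measurable_realfun.
From mathcomp Require Import ring lra.

Set Implicit Arguments.
Unset Strict Implicit.
Unset Printing Implicit Defensive.

Import Order.TTheory GRing.Theory Num.Def Num.Theory.
Import numFieldNormedType.Exports.

Local Open Scope classical_set_scope.
Local Open Scope ring_scope.

(** * Integration of bounded functions and densities *)

(** (C) asks for closeness in total variation, uniformly over all input strings, whereas the
    normalised score may have a lattice law; hence the added noise. Its width [e] matters twice: it
    is an error of order [e] in the tangent vector, and each of the [N] replacement steps costs an
    error of order [(B / (sqrt N e)) ^+ 3], where [B] bounds the score. The cost is cubic because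
    mean and variance are matched. As the tangent vector weights the law by the unbounded observed
    value, that value is cut at a level [M], with a tail of order [1 / M]. The total
    [e + M N^(-1/2) e^(-3) + 1 / M] is made small by taking powers of the sixteenth root of [N].
    Signed measures are mostly handled through bounded test functions: a tangent vector is a
    multiple of a difference of channels, its cb-norm is controlled by test functions with values in
    [[0, 1]], and Fisher information has a dual form that passes through composition. On a compact
    input set the score may be unbounded, since an output probability may tend to 0 along a sequence
    of inputs; rounding the input to finitely many points removes this. *)

Section bounded_functions.
Context d (T : measurableType d) (R : realType).
Implicit Types (P : probability T R) (f g : T -> R).

(** The test functions: integrable against every probability measure, and stable under products and
    under integration against a channel. *)
Definition bounded_measurable f :=
  measurable_fun [set: T] f /\ exists M, forall x, `|f x| <= M.

Lemma bounded_integrable P f : bounded_measurable f ->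
  P.-integrable [set: T] (EFin \o f).
Proof.
move=> [mf [M fM]]; apply: measurable_bounded_integrable => //.
  by apply: (@le_lt_trans _ _ 1%E); [exact: probability_le1|exact: ltry].
exists M; split; first exact: num_real.
by move=> N MN x _; exact: le_trans (fM x) (ltW MN).
Qed.

Lemma bounded_measurable_cst c : bounded_measurable (fun=> c).
Proof. by split => //; exists `|c|. Qed.

Lemma bounded_measurableD f g : bounded_measurable f -> bounded_measurable g ->
  bounded_measurable (fun x => f x + g x).
Proof.
move=> [mf [M fM]] [mg [N gN]]; split; first exact: measurable_funD.
by exists (M + N) => x; apply: le_trans (ler_normD _ _) _; exact: lerD.
Qed.

Lemma bounded_measurableM f g : bounded_measurable f -> bounded_measurable g ->
  bounded_measurable (fun x => f x * g x).
Proof.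
move=> [mf [M fM]] [mg [N gN]]; split; first exact: measurable_funM.
by exists (M * N) => x; rewrite normrM; exact: ler_pM.
Qed.

Lemma bounded_measurable_indic A : measurable A -> bounded_measurable (\1_A).
Proof.
move=> mA; split; first exact: measurable_indic.
by exists 1 => x; rewrite indicE ger0_norm ?ler0n// lern1; case: (x \in A).
Qed.

Lemma bounded_measurable01 f : measurable_fun [set: T] f ->
  (forall x, 0 <= f x <= 1) -> bounded_measurable f.
Proof.
move=> mf f01; split => //; exists 1 => x.
by have /andP[f0 f1] := f01 x; rewrite ger0_norm.
Qed.

Lemma Rintegral_fineK P f : P.-integrable [set: T] (EFin \o f) ->
  (\int[P]_x f x)%:E = (\int[P]_x (f x)%:E)%E.
Proof. by move=> fi; rewrite /Rintegral fineK//; exact: integrable_fin_num. Qed.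

Lemma ge0_Rintegral_fineK (mu : {measure set T -> \bar R}) f c :
  (\int[mu]_x (f x)%:E)%E = c%:E -> \int[mu]_x f x = c.
Proof. by rewrite /Rintegral => ->. Qed.

Lemma Rintegral_cst1 P c : \int[P]_x c = c.
Proof.
rewrite Rintegral_cst// -[RHS]mulr1; congr (_ * _).
by rewrite -[RHS]/(fine 1%E); congr fine; exact: probability_setT.
Qed.

Lemma integrable_scale (mu : {measure set T -> \bar R}) k f :
  mu.-integrable [set: T] (EFin \o f) ->
  mu.-integrable [set: T] (EFin \o (fun x => k * f x)).
Proof. exact: integrableZl. Qed.

Lemma integrable_add (mu : {measure set T -> \bar R}) f g :
  mu.-integrable [set: T] (EFin \o f) -> mu.-integrable [set: T] (EFin \o g) ->
  mu.-integrable [set: T] (EFin \o (fun x => f x + g x)).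
Proof. exact: integrableD. Qed.

Lemma integrable_sub (mu : {measure set T -> \bar R}) f g :
  mu.-integrable [set: T] (EFin \o f) -> mu.-integrable [set: T] (EFin \o g) ->
  mu.-integrable [set: T] (EFin \o (fun x => f x - g x)).
Proof. exact: integrableB. Qed.

Lemma integrable_ge0_fin (mu : {measure set T -> \bar R}) f c :
  measurable_fun [set: T] f -> (forall x, 0 <= f x) ->
  (\int[mu]_x (f x)%:E <= c%:E)%E -> mu.-integrable [set: T] (EFin \o f).
Proof.
move=> mf f0 h; apply/integrableP; split; first exact/measurable_EFinP.
under eq_integral do rewrite /= ger0_norm//.
by apply: le_lt_trans h _; rewrite ltry.
Qed.

Lemma integrableM_bounded (mu : {measure set T -> \bar R}) f g :
  mu.-integrable [set: T] (EFin \o f) -> bounded_measurable g ->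
  mu.-integrable [set: T] (EFin \o (fun x => f x * g x)).
Proof.
move=> fi [mg [M gM]].
have mf : measurable_fun [set: T] f by apply/measurable_EFinP; case/integrableP: fi.
have := integrableZl measurableT M fi.
apply: le_integrable => //; first by apply/measurable_EFinP; exact: measurable_funM.
move=> x _ /=; rewrite lee_fin !normrM mulrC ler_wpM2r//.
by apply: le_trans (gM x) _; exact: ler_norm.
Qed.

Lemma integrable_sqr P f : measurable_fun [set: T] f ->
  P.-integrable [set: T] (EFin \o (fun x => f x ^+ 2)) ->
  P.-integrable [set: T] (EFin \o f).
Proof.
move=> mf f2.
have : P.-integrable [set: T] (EFin \o (fun x => f x ^+ 2 + 1)).
  apply: (eq_integrable measurableT
    (fun x => ((f x ^+ 2)%R%:E + 1%R%:E)%E)) => //.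
  apply: integrableD => //; apply: (bounded_integrable P).
  exact: bounded_measurable_cst.
apply: le_integrable => //; first exact/measurable_EFinP.
move=> x _ /=; rewrite lee_fin.
rewrite [X in _ <= X]ger0_norm ?addr_ge0 ?sqr_ge0//.
have : 0 <= (`|f x| - 1) ^+ 2 by exact: sqr_ge0.
rewrite -[f x ^+ 2]real_normK ?num_real//; move: `|f x| => a.
have : 0 <= a ^+ 2 by exact: sqr_ge0.
by lra.
Qed.

Lemma integrable_sqrM P f g : measurable_fun [set: T] f -> measurable_fun [set: T] g ->
  P.-integrable [set: T] (EFin \o (fun x => f x ^+ 2)) ->
  P.-integrable [set: T] (EFin \o (fun x => g x ^+ 2)) ->
  P.-integrable [set: T] (EFin \o (fun x => f x * g x)).
Proof.
move=> mf mg f2 g2.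
have := integrableD measurableT f2 g2.
apply: le_integrable => //; first by apply/measurable_EFinP; exact: measurable_funM.
move=> x _ /=; rewrite lee_fin normrM [X in _ <= X]ger0_norm ?addr_ge0 ?sqr_ge0//.
rewrite -[f x ^+ 2]real_normK ?num_real// -[g x ^+ 2]real_normK ?num_real//.
have : 0 <= (`|f x| - `|g x|) ^+ 2 by exact: sqr_ge0.
have : 0 <= (`|f x|) ^+ 2 by exact: sqr_ge0.
have : 0 <= (`|g x|) ^+ 2 by exact: sqr_ge0.
move: `|f x| `|g x| => a b; rewrite !expr2; lra.
Qed.

(** The integral of [(s f + t g) ^+ 2] is a nonnegative quadratic form in [(s, t)]; it is evaluated
    at [(c, - b)]. *)
Lemma Rintegral_cauchy_schwarz P f g :
  measurable_fun [set: T] f -> measurable_fun [set: T] g ->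
  P.-integrable [set: T] (EFin \o (fun x => f x ^+ 2)) ->
  P.-integrable [set: T] (EFin \o (fun x => g x ^+ 2)) ->
  (\int[P]_x (f x * g x)) ^+ 2 <= (\int[P]_x f x ^+ 2) * \int[P]_x g x ^+ 2.
Proof.
move=> mf mg f2 g2; have fg := integrable_sqrM mf mg f2 g2.
set a := \int[P]_x f x ^+ 2; set b := \int[P]_x (f x * g x).
set c := \int[P]_x g x ^+ 2.
have a0 : 0 <= a by apply: Rintegral_ge0 => x _; exact: sqr_ge0.
have c0 : 0 <= c by apply: Rintegral_ge0 => x _; exact: sqr_ge0.
have H s t : 0 <= s ^+ 2 * a + 2 * (s * t) * b + t ^+ 2 * c.
  have i1 := integrable_scale (s ^+ 2) f2.
  have i2 := integrable_scale (2 * (s * t)) fg.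
  have i3 := integrable_scale (t ^+ 2) g2.
  have <- : \int[P]_x ((s * f x + t * g x) ^+ 2) =
      s ^+ 2 * a + 2 * (s * t) * b + t ^+ 2 * c.
    rewrite -!RintegralZl// -RintegralD// -RintegralD//; last exact: integrable_add.
    by apply: eq_Rintegral => x _; ring.
  by apply: Rintegral_ge0 => x _; exact: sqr_ge0.
have [c00|cn0] := eqVneq c 0.
  rewrite c00 mulr0.
  have [b0|bn0] := eqVneq b 0; first by rewrite b0 expr0n.
  (* If [c = 0] and [b] were nonzero, the form would take the value -1 here. *)
  have := H 1 (- (a + 1) / (2 * b)); rewrite c00 mulr0 addr0 expr1n !mul1r.
  have -> : 2 * (- (a + 1) / (2 * b)) * b = - (a + 1) by field.
  by lra.
have cp : 0 < c by rewrite lt_neqAle eq_sym cn0.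
have := H c (- b).
have -> : c ^+ 2 * a + 2 * (c * - b) * b + (- b) ^+ 2 * c = c * (a * c - b ^+ 2) by ring.
by rewrite pmulr_rge0// subr_ge0.
Qed.

Lemma sqr_Rintegral_le P f : measurable_fun [set: T] f ->
  P.-integrable [set: T] (EFin \o (fun x => f x ^+ 2)) ->
  (\int[P]_x f x) ^+ 2 <= \int[P]_x f x ^+ 2.
Proof.
move=> mf f2.
have i1 : P.-integrable [set: T] (EFin \o (fun=> 1 ^+ 2)).
  by apply: bounded_integrable; exact: bounded_measurable_cst.
have m1 : measurable_fun [set: T] (fun=> 1 : R) by exact: measurable_cst.
have := Rintegral_cauchy_schwarz mf m1 f2 i1.
rewrite Rintegral_cst1 expr1n mulr1.
by under [X in X ^+ 2 <= _]eq_Rintegral do rewrite mulr1.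
Qed.

Lemma Rintegral_bound P f M : measurable_fun [set: T] f ->
  (forall x, `|f x| <= M) -> `|\int[P]_x f x| <= M.
Proof.
move=> mf fM; have bf : bounded_measurable f by split => //; exists M.
apply: le_trans (le_normr_Rintegral measurableT (bounded_integrable P bf)) _.
rewrite -[leRHS](Rintegral_cst1 P); apply: le_Rintegral => //.
- by apply: integrable_norm; exact: bounded_integrable.
- by apply: bounded_integrable; exact: bounded_measurable_cst.
Qed.

Lemma Rintegral_ge0_01 P f : measurable_fun [set: T] f ->
  (forall x, 0 <= f x <= 1) -> 0 <= \int[P]_x f x <= 1.
Proof.
move=> mf f01; rewrite Rintegral_ge0/=; last by move=> x _; case/andP: (f01 x).
apply: le_trans (ler_norm _) _; apply: Rintegral_bound => // x.
by have /andP[f0 f1] := f01 x; rewrite ger0_norm.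
Qed.

End bounded_functions.

(** * Measures and channels given by a density *)

Section density.
Context d (T : measurableType d) (R : realType).
Variables (mu : {measure set T -> \bar R}) (r : T -> \bar R).
Local Open Scope ereal_scope.

(** The proofs are arguments so that the measure structure can be attached to the set function. *)
Definition density_measure of measurable_fun [set: T] r & (forall x, 0 <= r x) :=
  fun A => \int[mu]_(y in A) r y.

Hypotheses (mr : measurable_fun [set: T] r) (r0 : forall x, 0 <= r x).

Local Notation nu := (density_measure mr r0).

Let density0 : nu set0 = 0. Proof. exact: integral_set0. Qed.

Let density_ge0 A : 0 <= nu A. Proof. exact: integral_ge0. Qed.

Let density_sigma_additive : semi_sigma_additive nu.
Proof. exact: semi_sigma_additive_nng_induced. Qed.

HB.instance Definition _ := isMeasure.Build _ _ _ nu
  density0 density_ge0 density_sigma_additive.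

Let density_indic A : measurable A ->
  \int[nu]_x (\1_A x)%:E = \int[mu]_x ((\1_A x)%:E * r x).
Proof.
move=> mA; rewrite integral_indic// setIT /density_measure.
rewrite [LHS]integral_mkcond epatch_indic.
by apply: eq_integral => x _; rewrite muleC.
Qed.

Import HBNNSimple.

Let density_nnsfun (f : {nnsfun T >-> R}) :
  \int[nu]_x (f x)%:E = \int[mu]_x ((f x)%:E * r x).
Proof.
under [in LHS]eq_integral do rewrite fimfunE -fsumEFin//.
rewrite ge0_integral_fsum//; last 2 first.
  - by move=> a; exact/measurable_EFinP/measurableT_comp.
  - by move=> a x _; rewrite EFinM nnfun_muleindic_ge0.
have -> : \int[mu]_x ((f x)%:E * r x) =
    \int[mu]_x (\sum_(a \in range f) (a%:E * ((\1_(f @^-1` [set a]) x)%:E * r x))).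
  apply: eq_integral => x _; rewrite fimfunE -fsumEFin// ge0_mule_fsuml//; last first.
    by move=> a; rewrite EFinM nnfun_muleindic_ge0.
  by apply: eq_fsbigr => a _; rewrite EFinM muleA.
rewrite ge0_integral_fsum//; last 2 first.
  - move=> a; apply: measurable_funeM; apply: emeasurable_funM => //.
    exact/measurable_EFinP.
  - by move=> a x _; rewrite muleA mule_ge0// nnfun_muleindic_ge0.
apply: eq_fsbigr => a /[!inE] -[x _ <-].
rewrite (integralZl_indic _ (fun r => f @^-1` [set r]))//; last first.
  by move=> r1; rewrite preimage_nnfun0.
rewrite density_indic// [RHS]ge0_integralZl//.
- by apply: emeasurable_funM => //; exact/measurable_EFinP.
- by move=> y _; rewrite mule_ge0// lee_fin.
- by rewrite lee_fin.
Qed.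

Lemma integral_density f : (forall x, 0 <= f x) -> measurable_fun [set: T] f ->
  \int[nu]_x f x = \int[mu]_x (f x * r x).
Proof.
move=> f0 mf; pose f_ := nnsfun_approx measurableT mf.
have mf_ n : measurable_fun [set: T] (fun x => (f_ n x)%:E) by exact/measurable_EFinP.
have nd_ x : {homo (fun n => (f_ n x)%:E) : a b / (a <= b)%N >-> a <= b}.
  by move=> a b ab; rewrite lee_fin; exact/lefP/nd_nnsfun_approx.
have cvgf x : (f_ n x)%:E @[n --> \oo] --> f x by exact: cvg_nnsfun_approx.
transitivity (\int[nu]_x (lim ((f_ n x)%:E @[n --> \oo]))).
  by apply/eq_integral => x _; apply/esym/cvg_lim.
rewrite monotone_convergence//; last by move=> n x _; rewrite lee_fin.
under eq_fun do rewrite density_nnsfun.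
rewrite -monotone_convergence//.
- apply: eq_integral => x _; apply/cvg_lim => //.
  have [rfin|] := boolP (r x \is a fin_num); first exact: cvgeZr.
  (* At [r x = +oo] the product passes to the limit unless [f x = 0], and in that case all
     approximants vanish. *)
  rewrite ge0_fin_numE// -leNgt leye_eq => /eqP rx.
  have [fx0|fx0] := eqVneq (f x) 0; last first.
    apply: cvgeM => //; last exact: cvg_cst.
    by rewrite rx /mule_def; case: (f x) (f0 x) fx0.
  have f_0 n : (f_ n x)%:E = 0.
    apply/eqP; rewrite eq_le; apply/andP; split; last by rewrite lee_fin.
    rewrite -fx0.
    rewrite -(cvg_lim _ (cvgf x))//; apply: lime_ge.
      by apply/cvg_ex; exists (f x); exact: cvgf.
    by near=> m; apply: nd_; near: m; exact: nbhs_infty_ge.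
  under eq_fun do rewrite f_0 mul0e.
  by rewrite fx0 mul0e; exact: cvg_cst.
- by move=> n; exact: emeasurable_funM.
- by move=> n x _; rewrite mule_ge0// lee_fin.
- by move=> x _ a b ab; rewrite lee_wpmul2r// nd_.
Unshelve. all: by end_near. Qed.

End density.

Section density_channel.
Context (R : realType) (X Y : kspace R) (k : channel X Y) (r : X * Y -> \bar R).
Hypotheses (mr : measurable_fun [set: X * Y] r) (r0 : forall z, (0 <= r z)%E).
Hypothesis r1 : forall x, (\int[k x]_y r (x, y) = 1)%E.

Let mrx x : measurable_fun [set: Y] (fun y => r (x, y)).
Proof. exact: measurableT_comp mr (pair1_measurable x). Qed.

Definition density_fun (x : X) : {measure set Y -> \bar R} :=
  density_measure (k x) (mrx x) (fun y => r0 (x, y)).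

Let density_fun_measurable U :
  measurable U -> measurable_fun [set: X] (density_fun ^~ U).
Proof.
move=> mU; rewrite /density_fun /= /density_measure.
under eq_fun do rewrite integral_mkcond epatch_indic.
apply: (measurable_fun_integral_finite_kernel
  (fun z => r z * (\1_U z.2)%:E)%E k) => [z|]; first by rewrite mule_ge0// lee_fin.
apply: emeasurable_funM => //; apply/measurable_EFinP.
have mI : measurable_fun [set: Y] (\1_U : Y -> R) by exact: measurable_indic.
exact: measurableT_comp mI measurable_snd.
Qed.

HB.instance Definition _ := isKernel.Build _ _ X Y R density_fun density_fun_measurable.

Let density_fun_prob x : density_fun x [set: Y] = 1%E.
Proof. exact: r1. Qed.

HB.instance Definition _ := Kernel_isProbability.Build _ _ X Y R density_fun density_fun_prob.

Definition density_channel : channel X Y := density_fun.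

Lemma integral_density_channel x f : (forall y, (0 <= f y)%E) ->
  measurable_fun [set: Y] f ->
  (\int[density_channel x]_y f y = \int[k x]_y (f y * r (x, y)))%E.
Proof. exact: integral_density. Qed.

End density_channel.

(** Integrability is not assumed: the integrals of the positive and negative parts are measurable in
    [x], and [fine] is measurable also where their difference is infinite. *)
Lemma measurable_Rintegral_kernel (R : realType) d d' (X : measurableType d)
    (Y : measurableType d') (k : R.-pker X ~> Y) (f : X * Y -> R) :
  measurable_fun [set: X * Y] f ->
  measurable_fun [set: X] (fun x => \int[k x]_y f (x, y)).
Proof.
move=> mf.
have mE : measurable_fun [set: X * Y] (fun z => (f z)%:E) by exact/measurable_EFinP.
apply: (measurableT_comp (fine_measurable measurableT)).
rewrite [X in measurable_fun _ X](_ : _ = fun x =>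
    (\int[k x]_y (fun z => (f z)%:E)^\+ (x, y)
     - \int[k x]_y (fun z => (f z)%:E)^\- (x, y))%E); last first.
  apply/funext => x; rewrite [LHS]integralE.
  by congr (_ - _)%E; apply: eq_integral => y _; rewrite !(funepos.unlock, funeneg.unlock).
apply: emeasurable_funB.
  apply: (measurable_fun_integral_finite_kernel ((fun z : X * Y => (f z)%:E)^\+)%E k) => //.
  exact: measurable_funepos.
apply: (measurable_fun_integral_finite_kernel ((fun z : X * Y => (f z)%:E)^\-)%E k) => //.
exact: measurable_funeneg.
Qed.

Lemma Rintegral_prod (R : realType) d d' (X : measurableType d)
    (Y : measurableType d') (P : probability X R) (Q : probability Y R) f :
  (P \x Q)%E.-integrable [set: X * Y] (EFin \o f) ->
  (forall x, Q.-integrable [set: Y] (EFin \o (fun y => f (x, y)))) ->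
  \int[(P \x Q)%E]_z f z = \int[P]_x \int[Q]_y f (x, y).
Proof.
move=> fi fQ; rewrite {1 2}/Rintegral -integral12_prod_meas1//; congr fine.
by apply: eq_integral => x _; rewrite /fubini_F; apply/esym/Rintegral_fineK.
Qed.

(** * Integrals against composed, tensored and mixed channels *)

Section channel_integrals.
Variable R : realType.
Implicit Types X Y Z : kspace R.

Lemma Rintegral_addc d (T : measurableType d) (P : probability T R) f c :
  bounded_measurable f -> \int[P]_x (f x + c) = \int[P]_x f x + c.
Proof.
move=> bf; rewrite RintegralD//; last 2 first.
- exact: bounded_integrable.
- exact: (bounded_integrable P (bounded_measurable_cst _ c)).
by rewrite Rintegral_cst1.
Qed.

Lemma Rintegral_channel_cst X Y (k : channel X Y) x (c : R) : \int[k x]_y c = c.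
Proof. exact: (Rintegral_cst1 (output k x)). Qed.

Lemma channel_integrable X Y (k : channel X Y) x f : bounded_measurable f ->
  (k x).-integrable [set: Y] (EFin \o f).
Proof. exact: (bounded_integrable (output k x)). Qed.

Lemma bounded_measurable_kernel X Y (k : channel X Y) (f : X * Y -> R) :
  bounded_measurable f -> bounded_measurable (fun x => \int[k x]_y f (x, y)).
Proof.
move=> [mf [M fM]]; split; first exact: measurable_Rintegral_kernel.
exists M => x; apply: (Rintegral_bound (output k x)) => //.
exact: measurableT_comp mf (pair1_measurable x).
Qed.

Lemma bounded_measurable_kernel1 X Y (k : channel X Y) (f : Y -> R) :
  bounded_measurable f -> bounded_measurable (fun x => \int[k x]_y f y).
Proof.
move=> [mf [M fM]]; apply: (bounded_measurable_kernel k (f := fun z => f z.2)).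
by split; [exact: measurableT_comp mf measurable_snd|exists M => z].
Qed.

Lemma bounded_measurable_pair X Y (f : X * Y -> R) x :
  bounded_measurable f -> bounded_measurable (fun y => f (x, y)).
Proof.
move=> [mf [M fM]]; split; first exact: measurableT_comp mf (pair1_measurable x).
by exists M => y.
Qed.

Lemma integral_comp_channel X Y Z (Phi : channel Y Z) (Psi : channel X Y) x f :
  (forall z, (0 <= f z)%E) -> measurable_fun [set: Z] f ->
  (\int[comp_channel Phi Psi x]_z f z = \int[Psi x]_y \int[Phi y]_z f z)%E.
Proof.
move=> f0 mf.
exact: (integral_kcomp Psi (kpull (@measurable_snd _ _ X Y) Phi) x f0 mf).
Qed.

Lemma Rintegral_comp_channel X Y Z (Phi : channel Y Z) (Psi : channel X Y) x f :
  bounded_measurable f ->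
  \int[comp_channel Phi Psi x]_z f z = \int[Psi x]_y \int[Phi y]_z f z.
Proof.
move=> bf; have [mf [M fM]] := bf.
have bM : bounded_measurable (fun z => f z + M).
  by apply: bounded_measurableD => //; exact: bounded_measurable_cst.
(* Adding a bound [M] of [|f|] makes the integrand nonnegative. *)
apply: (@addIr _ M).
rewrite -(Rintegral_addc (output (comp_channel Phi Psi) x))//.
rewrite -(Rintegral_addc (output Psi x)); last exact: bounded_measurable_kernel1.
have -> : \int[output Psi x]_y (\int[Phi y]_z f z + M) =
    \int[Psi x]_y \int[Phi y]_z (f z + M).
  by apply: eq_Rintegral => y _; rewrite -(Rintegral_addc (output Phi y)).
have fM0 z : 0 <= f z + M by have := fM z; rewrite ler_norml => /andP[]; lra.
rewrite {1 2}/Rintegral integral_comp_channel//; last first.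
  by apply/measurable_EFinP; case: bM.
congr fine; apply: eq_integral => y _.
by rewrite -[LHS](Rintegral_fineK (bounded_integrable (output Phi y) bM)).
Qed.

Lemma integral_tensor_channel X X' Y Y' (Phi : channel X Y) (Psi : channel X' Y')
    x f : (forall z, (0 <= f z)%E) -> measurable_fun [set: Y * Y'] f ->
  (\int[tensor_channel Phi Psi x]_z f z =
   \int[Phi x.1]_y \int[Psi x.2]_y' f (y, y'))%E.
Proof.
move=> f0 mf.
exact: (@fubini_tonelli1 _ _ _ _ _ (output Phi x.1) (output Psi x.2) f mf f0).
Qed.

Lemma Rintegral_tensor_channel X X' Y Y' (Phi : channel X Y) (Psi : channel X' Y')
    x f :
  (tensor_channel Phi Psi x).-integrable [set: Y * Y'] (EFin \o f) ->
  (forall y, (Psi x.2).-integrable [set: Y'] (EFin \o (fun y' => f (y, y')))) ->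
  \int[tensor_channel Phi Psi x]_z f z =
  \int[Phi x.1]_y \int[Psi x.2]_y' f (y, y').
Proof.
move=> fi fQ.
exact: (@Rintegral_prod _ _ _ _ _ (output Phi x.1) (output Psi x.2) f fi fQ).
Qed.

Lemma Rintegral_tensor_bounded X X' Y Y' (Phi : channel X Y) (Psi : channel X' Y')
    x f : bounded_measurable f ->
  \int[tensor_channel Phi Psi x]_z f z =
  \int[Phi x.1]_y \int[Psi x.2]_y' f (y, y').
Proof.
move=> bf; apply: Rintegral_tensor_channel; first exact: channel_integrable.
by move=> y; apply: channel_integrable; exact: bounded_measurable_pair.
Qed.

Lemma Rintegral_mix_channel X Y p (Phi Psi : channel X Y) x f :
  bounded_measurable f ->
  \int[mix_channel p Phi Psi x]_z f z =
  p%:num * \int[Phi x]_y f y + (1 - p%:num) * \int[Psi x]_y f y.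
Proof.
move=> bf; have [mf [M fM]] := bf.
have bM : bounded_measurable (fun z => f z + M).
  by apply: bounded_measurableD => //; exact: bounded_measurable_cst.
apply: (@addIr _ M).
rewrite -(Rintegral_addc (output (mix_channel p Phi Psi) x))//.
have -> : forall a b : R, p%:num * a + (1 - p%:num) * b + M =
  p%:num * (a + M) + (1 - p%:num) * (b + M) by move=> a b; ring.
rewrite -(Rintegral_addc (output Phi x))// -(Rintegral_addc (output Psi x))//.
have fM0 z : 0 <= f z + M by have := fM z; rewrite ler_norml => /andP[]; lra.
have mE : measurable_fun [set: Y] (fun z => (f z + M)%:E).
  by apply/measurable_EFinP; case: bM.
apply: (ge0_Rintegral_fineK (mu := mix_channel p Phi Psi x)).
rewrite [LHS](_ : _ = (\int[mscale (p%:num)%:nng%R (Phi x)]_z (f z + M)%:E +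
    \int[mscale (1 - p%:num)%:nng%R (Psi x)]_z (f z + M)%:E)%E); last first.
  by apply: ge0_integral_measure_add => // z _; rewrite lee_fin.
rewrite !ge0_integral_mscale//; last 2 first.
- by move=> z _; rewrite lee_fin.
- by move=> z _; rewrite lee_fin.
rewrite [RHS]EFinD [X in (_ = X + _)%E]EFinM [X in (_ = _ + X)%E]EFinM (Rintegral_fineK (bounded_integrable (output Phi x) bM)).
by rewrite (Rintegral_fineK (bounded_integrable (output Psi x) bM)).
Qed.

Lemma Rintegral_dirac d (T : measurableType d) (a : T) (f : T -> R) :
  measurable_fun [set: T] f -> \int[\d_a]_y f y = f a.
Proof.
move=> mf; apply: ge0_Rintegral_fineK; rewrite integral_dirac//.
  by rewrite diracT mul1e.
exact/measurable_EFinP.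
Qed.

End channel_integrals.

(** * Tangent vectors, Fisher information and the cb-norm *)

Section tangent_expectation.
Variable R : realType.
Implicit Types X Y Z : kspace R.

(* Integral of a bounded function against the signed measure [D x]. *)
Definition texp X Y (D : tangent X Y) (x : X) (f : Y -> R) : R :=
  tcoef D * (\int[tpos D x]_y f y - \int[tneg D x]_y f y).

Lemma eq_texp X Y (D : tangent X Y) x f g : f =1 g -> texp D x f = texp D x g.
Proof. by move=> fg; congr texp; apply/funext. Qed.

Lemma texp_indic X Y (D : tangent X Y) x A : measurable A ->
  (texp D x (\1_A))%:E = D x A.
Proof.
move=> mA; rewrite tangentE /texp EFinM EFinB; congr (_ * (_ - _))%E.
- rewrite (Rintegral_fineK (bounded_integrable (output _ x) (bounded_measurable_indic R mA))).
  by rewrite integral_indic// setIT.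
- rewrite (Rintegral_fineK (bounded_integrable (output _ x) (bounded_measurable_indic R mA))).
  by rewrite integral_indic// setIT.
Qed.

Lemma texp_cst X Y (D : tangent X Y) x c : texp D x (fun=> c) = 0.
Proof. by rewrite /texp !Rintegral_channel_cst subrr mulr0. Qed.

Lemma texpD X Y (D : tangent X Y) x f g :
  bounded_measurable f -> bounded_measurable g ->
  texp D x (fun y => f y + g y) = texp D x f + texp D x g.
Proof.
by move=> bf bg; rewrite /texp !RintegralD//; try exact: channel_integrable; ring.
Qed.

Lemma bounded_measurableZ d (T : measurableType d) k (f : T -> R) :
  bounded_measurable f -> bounded_measurable (fun x => k * f x).
Proof. by apply: bounded_measurableM; exact: bounded_measurable_cst. Qed.

Lemma bounded_measurableB d (T : measurableType d) (f g : T -> R) :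
  bounded_measurable f -> bounded_measurable g ->
  bounded_measurable (fun x => f x - g x).
Proof.
move=> bf /(bounded_measurableZ (-1)) bg.
have := bounded_measurableD bf bg.
by under [X in bounded_measurable X -> _]eq_fun do rewrite mulN1r.
Qed.

Lemma bounded_measurable_texp1 X Y (D : tangent X Y) (f : Y -> R) :
  bounded_measurable f -> bounded_measurable (fun x => texp D x f).
Proof.
by move=> bf; apply/bounded_measurableZ/bounded_measurableB; exact: bounded_measurable_kernel1.
Qed.

Lemma texp_comp_tc X Y Z (D : tangent Y Z) (Psi : channel X Y) x f :
  bounded_measurable f ->
  texp (comp_tc D Psi) x f = \int[Psi x]_y texp D y f.
Proof.
move=> bf; rewrite /texp /= !Rintegral_comp_channel//.
rewrite -RintegralB//; try exact/channel_integrable/bounded_measurable_kernel1.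
rewrite RintegralZl//; apply: channel_integrable; apply: bounded_measurableB;
  exact: bounded_measurable_kernel1.
Qed.

Lemma texp_comp_ct X Y Z (Psi : channel Y Z) (D : tangent X Y) x f :
  bounded_measurable f ->
  texp (comp_ct Psi D) x f = texp D x (fun y => \int[Psi y]_z f z).
Proof. by move=> bf; rewrite /texp /= !Rintegral_comp_channel. Qed.

Lemma texp_tensor_tc X X' Y Y' (D : tangent X Y) (Psi : channel X' Y') x f :
  bounded_measurable f ->
  texp (tensor_tc D Psi) x f = texp D x.1 (fun y => \int[Psi x.2]_y' f (y, y')).
Proof. by move=> bf; rewrite /texp /= !Rintegral_tensor_bounded. Qed.

(** Integrating out the second argument against a fixed law is integration against a constant
    channel. *)
Lemma bounded_measurable_kernel_fst X' Y Y' (Psi : channel X' Y') (f : Y * Y' -> R) x :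
  bounded_measurable f -> bounded_measurable (fun y => \int[Psi x]_y' f (y, y')).
Proof. exact: (bounded_measurable_kernel (const_channel Y (output Psi x))). Qed.

Lemma bounded_measurable_texp_fst X' Y Y' (D : tangent X' Y') (f : Y * Y' -> R) x :
  bounded_measurable f -> bounded_measurable (fun y => texp D x (fun y' => f (y, y'))).
Proof.
by move=> bf; apply/bounded_measurableZ/bounded_measurableB; exact: bounded_measurable_kernel_fst.
Qed.

Lemma texp_tensor_ct X X' Y Y' (Psi : channel X Y) (D : tangent X' Y') x f :
  bounded_measurable f ->
  texp (tensor_ct Psi D) x f = \int[Psi x.1]_y texp D x.2 (fun y' => f (y, y')).
Proof.
move=> bf; rewrite /texp /= !Rintegral_tensor_bounded//.
rewrite -RintegralB//; try exact/channel_integrable/bounded_measurable_kernel_fst.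
rewrite RintegralZl//; apply: channel_integrable; apply: bounded_measurableB;
  exact: bounded_measurable_kernel_fst.
Qed.

Lemma texp_diff_channel X Y (Phi Psi : channel X Y) x f :
  texp (diff_channel Phi Psi) x f = \int[Phi x]_y f y - \int[Psi x]_y f y.
Proof. by rewrite /texp mul1r. Qed.

Lemma texp_scale X Y a (D : tangent X Y) x f :
  texp (scale_tangent a D) x f = a * texp D x f.
Proof. by rewrite /texp /= mulrA. Qed.

Lemma texp_add X Y (D E : tangent X Y) x f : bounded_measurable f ->
  texp (add_tangent D E) x f = texp D x f + texp E x f.
Proof.
move=> bf; rewrite /texp; cbn [add_tangent tcoef tpos tneg].
rewrite !Rintegral_mix_channel//.
have ifE (B : bool) (Phi Psi : channel X Y) :
    \int[(if B then Phi else Psi) x]_y f y =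
    if B then \int[Phi x]_y f y else \int[Psi x]_y f y by case: B.
rewrite !ifE.
move: (\int[tpos D x]_y f y) (\int[tneg D x]_y f y) => u v.
move: (\int[tpos E x]_y f y) (\int[tneg E x]_y f y) => u' v'.
move: (tcoef D) (tcoef E) => c c'.
have := sign_swap c u v; have := sign_swap c' u' v'.
have := weightl c c'; have := weightr c c'.
move: (weight c c')%:num => p.
set P := if _ then u else v; set N := if _ then v else u.
set P' := if _ then u' else v'; set N' := if _ then v' else u'.
move=> wr wl <- <-; move: `|c| `|c'| wl wr => s s' wl wr.
transitivity ((s + s') * p * (P - N) + (s + s') * (1 - p) * (P' - N')); first by ring.
by rewrite wl wr.
Qed.

Lemma texp_sub X Y (D E : tangent X Y) x f : bounded_measurable f ->
  texp (sub_tangent D E) x f = texp D x f - texp E x f.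
Proof. by move=> bf; rewrite texp_add// texp_scale mulN1r. Qed.

End tangent_expectation.

(** * From values on sets to integrals of test functions *)

Section charge_representation.
Variable R : realType.
Implicit Types X Y Z : kspace R.

Lemma density_fin (T : Type) (h : T -> R) (x : T) :
  ((h x)%:E = (Num.max (h x) 0)%R%:E - (Num.max (- h x) 0)%R%:E)%E.
Proof.
rewrite -EFinB; congr EFin; case: (leP 0 (h x)) => h0.
  by rewrite max_r ?subr0// oppr_le0.
by rewrite max_l ?sub0r ?opprK// ltW// oppr_gt0.
Qed.

(** Moving the negative terms to the other side turns the signed identity on sets into the equality
    of two positive measures, [m1] and [m2]. Their integrals of [f] agree, and the terms are then
    moved back. *)
Lemma texp_ge0_charge X Y (D : tangent X Y) x (P : probability Y R) (h f : Y -> R) :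
  measurable_fun [set: Y] h -> P.-integrable [set: Y] (EFin \o h) ->
  (forall A, measurable A -> D x A = \int[P]_(y in A) (h y)%:E)%E ->
  bounded_measurable f -> (forall y, 0 <= f y) ->
  texp D x f = \int[P]_y (h y * f y).
Proof.
move=> mh hi DA bf f0; have [mf _] := bf.
have mE : measurable_fun [set: Y] (fun y => (f y)%:E) by exact/measurable_EFinP.
have mp : measurable_fun [set: Y] (fun y => Num.max (h y) 0).
  by apply: measurable_maxr => //; exact: measurable_cst.
have mn : measurable_fun [set: Y] (fun y => Num.max (- h y) 0).
  by apply: measurable_maxr; [exact: measurable_funN|exact: measurable_cst].
have ip : P.-integrable [set: Y] (EFin \o (fun y => Num.max (h y) 0)).
  apply: le_integrable hi => //; first exact/measurable_EFinP.
  move=> y _ /=; rewrite lee_fin [leLHS]ger0_norm ?le_max ?lexx ?orbT//.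
  by rewrite ge_max normr_ge0 ler_norm.
have in_ : P.-integrable [set: Y] (EFin \o (fun y => Num.max (- h y) 0)).
  apply: le_integrable hi => //; first exact/measurable_EFinP.
  move=> y _ /=; rewrite lee_fin [leLHS]ger0_norm ?le_max ?lexx ?orbT//.
  by rewrite ge_max normr_ge0 -normrN ler_norm.
have mpE : measurable_fun [set: Y] (fun y => (Num.max (h y) 0)%:E).
  exact/measurable_EFinP.
have mnE : measurable_fun [set: Y] (fun y => (Num.max (- h y) 0)%:E).
  exact/measurable_EFinP.
have p0 y : (0 <= (Num.max (h y) 0)%R%:E)%E by rewrite lee_fin le_max lexx orbT.
have n0 y : (0 <= (Num.max (- h y) 0)%R%:E)%E by rewrite lee_fin le_max lexx orbT.
pose dp := density_measure P mpE p0; pose dn := density_measure P mnE n0.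
have cp0 : 0 <= Num.max (tcoef D) 0 by rewrite le_max lexx orbT.
have cn0 : 0 <= Num.max (- tcoef D) 0 by rewrite le_max lexx orbT.
pose cp := NngNum cp0; pose cn := NngNum cn0.
pose m1 := measure_add (measure_add (mscale cp (tpos D x)) (mscale cn (tneg D x))) dn.
pose m2 := measure_add (measure_add (mscale cn (tpos D x)) (mscale cp (tneg D x))) dp.
have m12 A : measurable A -> m1 A = m2 A.
  move=> mA.
  have -> : m1 A = (cp%:num%:E * tpos D x A + cn%:num%:E * tneg D x A + dn A)%E.
    by rewrite /m1 measure_addE; congr (_ + _)%E; exact: measure_addE.
  have -> : m2 A = (cn%:num%:E * tpos D x A + cp%:num%:E * tneg D x A + dp A)%E.
    by rewrite /m2 measure_addE; congr (_ + _)%E; exact: measure_addE.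
  rewrite /=.
  have := DA A mA; rewrite tangentE.
  have fE (k : channel X Y) : k x A = (fine (k x A))%:E by rewrite fineK ?channel_fin.
  rewrite (fE (tpos D)) (fE (tneg D)).
  have hA : (\int[P]_(y in A) (h y)%:E = dp A - dn A)%E.
    rewrite -integralB//; last 2 first.
      by apply: (integrableS _ _ (@subsetT _ A)) ip.
      by apply: (integrableS _ _ (@subsetT _ A)) in_.
    by apply: eq_integral => y _; exact: density_fin.
  rewrite hA.
  have dpf : dp A \is a fin_num.
    by apply: integrable_fin_num => //; apply: (integrableS _ _ (@subsetT _ A)) ip.
  have dnf : dn A \is a fin_num.
    by apply: integrable_fin_num => //; apply: (integrableS _ _ (@subsetT _ A)) in_.
  rewrite -(fineK dpf) -(fineK dnf).
  move: (fine (tpos D x A)) (fine (tneg D x A)) (fine (dp A)) (fine (dn A)).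
  move=> u v a b.
  rewrite -!EFinM -!EFinD -?EFinM => -[] e; congr EFin.
  have ab : a = b + tcoef D * (u - v) by lra.
  rewrite ab; case: (leP 0 (tcoef D)) => c0.
    by rewrite max_r ?oppr_le0//; ring.
  by rewrite max_l ?oppr_ge0 ?ltW//; ring.
have : (\int[m1]_y (f y)%:E = \int[m2]_y (f y)%:E)%E.
  by apply: eq_measure_integral => A mA _; exact: m12.
have fE y : [set: Y] y -> (0 <= (f y)%:E)%E by rewrite lee_fin.
rewrite !(ge0_integral_measure_add, ge0_integral_mscale, integral_density)//.
have bp : bounded_measurable f by [].
have posE : (\int[tpos D x]_y f y)%:E = (\int[tpos D x]_y (f y)%:E)%E.
  exact: (Rintegral_fineK (bounded_integrable (output (tpos D) x) bf)).
have negE : (\int[tneg D x]_y f y)%:E = (\int[tneg D x]_y (f y)%:E)%E.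
  exact: (Rintegral_fineK (bounded_integrable (output (tneg D) x) bf)).
rewrite -posE -negE.
have pE : (\int[P]_y ((f y)%:E * (Num.max (h y) 0)%R%:E))%E =
    (\int[P]_y (Num.max (h y) 0 * f y))%:E.
  rewrite Rintegral_fineK; last exact: integrableM_bounded.
  by apply: eq_integral => y _; rewrite muleC.
have nE : (\int[P]_y ((f y)%:E * (Num.max (- h y) 0)%R%:E))%E =
    (\int[P]_y (Num.max (- h y) 0 * f y))%:E.
  rewrite Rintegral_fineK; last exact: integrableM_bounded.
  by apply: eq_integral => y _; rewrite muleC.
rewrite pE nE.
have -> : \int[P]_y (h y * f y) =
    \int[P]_y (Num.max (h y) 0 * f y) - \int[P]_y (Num.max (- h y) 0 * f y).
  rewrite -RintegralB//; try exact: integrableM_bounded.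
  apply: eq_Rintegral => y _; rewrite -mulrBl; congr (_ * _).
  by have := density_fin h y; rewrite -EFinB => -[].
rewrite /texp /=; move: (\int[tpos D x]_y f y) (\int[tneg D x]_y f y) => u v.
move: (\int[P]_y _) (\int[P]_y _) => a b.
rewrite -!EFinM -!EFinD => -[] e.
move: e; case: (leP 0 (tcoef D)) => c0.
  by rewrite max_r ?oppr_le0//; lra.
by rewrite max_l ?oppr_ge0 ?ltW//; lra.
Qed.

Lemma texp_charge X Y (D : tangent X Y) x (P : probability Y R) (h f : Y -> R) :
  measurable_fun [set: Y] h -> P.-integrable [set: Y] (EFin \o h) ->
  (forall A, measurable A -> D x A = \int[P]_(y in A) (h y)%:E)%E ->
  bounded_measurable f -> texp D x f = \int[P]_y (h y * f y).
Proof.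
move=> mh hi DA bf; have [mf [M fM]] := bf.
have bc := bounded_measurable_cst Y M.
have bM := bounded_measurableD bf bc.
have M0 y : 0 <= f y + M by have := fM y; rewrite ler_norml => /andP[]; lra.
have M0' : 0 <= M by apply: le_trans (normr_ge0 (f point)) (fM point).
have := texp_ge0_charge mh hi DA bM M0.
have := texp_ge0_charge mh hi DA bc (fun=> M0').
rewrite texp_cst texpD// texp_cst addr0 => h0 ->.
under eq_Rintegral do rewrite mulrDr.
by rewrite RintegralD//; [rewrite -h0 addr0|exact: integrableM_bounded..].
Qed.

End charge_representation.

(** * The dual Fisher bound and data processing *)

Section fisher_bound.
Local Open Scope charge_scope.
Variable R : realType.
Implicit Types X Y Z : kspace R.

(* The dual form of [fisher (output Phi x) (D x) <= c]. *)
Definition fisher_bound X Y (Phi : channel X Y) (D : tangent X Y) (c : R) :=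
  forall x f, bounded_measurable f ->
    texp D x f ^+ 2 <= c * \int[Phi x]_y f y ^+ 2.

Lemma bounded_measurable_sqr d (T : measurableType d) (f : T -> R) :
  bounded_measurable f -> bounded_measurable (fun x => f x ^+ 2).
Proof. by move=> bf; under eq_fun do rewrite expr2; exact: bounded_measurableM. Qed.

Lemma Rintegral_indic (Y : kspace R) (P : probability Y R) A : measurable A ->
  (\int[P]_y \1_A y)%:E = P A.
Proof.
move=> mA; rewrite Rintegral_fineK; last exact/bounded_integrable/bounded_measurable_indic.
by rewrite integral_indic// setIT.
Qed.

(** The indicator of a null set [A], as a test function, gives [(D x A) ^+ 2 <= c * 0]. *)
Lemma fisher_bound_dominates X Y (Phi : channel X Y) D c x :
  fisher_bound Phi D c -> D x `<< output Phi x.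
Proof.
move=> DPhi; apply/null_content_dominatesP => A mA PA0.
rewrite -texp_indic//; congr EFin.
have bA := bounded_measurable_indic R mA.
have := DPhi x _ bA.
have -> : \int[Phi x]_y \1_A y ^+ 2 = \int[output Phi x]_y \1_A y.
  by apply: eq_Rintegral => y _; rewrite indicE; case: (y \in A); rewrite ?expr1n ?expr0n.
have -> : \int[output Phi x]_y \1_A y = 0 :> R.
  by apply: EFin_inj; rewrite Rintegral_indic.
by rewrite mulr0 => h; apply/eqP; rewrite -sqrf_eq0 eq_le h sqr_ge0.
Qed.

Lemma Radon_Nikodym_fine X Y (Phi : channel X Y) (D : tangent X Y) x :
  D x `<< output Phi x ->
  let h y := fine (('d (D x) '/d (output Phi x)) y) in
  [/\ measurable_fun [set: Y] h,
     (output Phi x).-integrable [set: Y] (EFin \o h),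
     (forall y, (h y)%:E = ('d (D x) '/d (output Phi x)) y) &
     forall f, bounded_measurable f -> texp D x f = \int[Phi x]_y (h y * f y)].
Proof.
move=> DP h.
have hE y : (h y)%:E = ('d (D x) '/d (output Phi x)) y.
  by rewrite fineK//; exact: Radon_Nikodym_fin_num.
have hi : (output Phi x).-integrable [set: Y] (EFin \o h).
  by apply: eq_integrable (Radon_Nikodym_integrable DP) => // y _ /=; rewrite hE.
have mh : measurable_fun [set: Y] h.
  by apply/measurable_EFinP; case/integrableP: hi.
split => // f bf; apply: (texp_charge mh hi) => // A mA.
rewrite (Radon_Nikodym_integral DP mA); apply: eq_integral => y _.
by rewrite hE.
Qed.

(** The test function is the derivative [h] truncated where [|h| > n]. As [h * f_ n = f_ n ^+ 2],
    the dual bound reads [I ^+ 2 <= c * I] for the integral [I] of [f_ n ^+ 2], so that [I <= c];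
    then [n] tends to infinity by monotone convergence. *)
Lemma fisher_le X Y (Phi : channel X Y) D c x :
  fisher_bound Phi D c -> (fisher (output Phi x) (D x) <= c%:E)%E.
Proof.
move=> DPhi; have DP : D x `<< output Phi x by exact: fisher_bound_dominates DPhi.
have [mh hi hE hf] := Radon_Nikodym_fine DP.
set h := fun y => fine _ in mh hi hE hf.
pose f_ n y := h y * \1_[set y | `|h y| <= n%:R] y.
have mN n : measurable [set y | `|h y| <= n%:R].
  rewrite -[X in measurable X]setTI.
  have := @measurable_fun_ler _ _ R [set: Y] (fun y => `|h y|) (fun=> n%:R)
    (measurableT_comp (@normr_measurable _ _) mh) (measurable_cst _).
  by move/(_ measurableT [set true] Logic.I).
have bf n : bounded_measurable (f_ n).
  split; first by apply: measurable_funM => //; exact: measurable_indic.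
  exists n%:R => y; rewrite /f_ indicE.
  have [|yN] := boolP (y \in _); last by rewrite mulr0 normr0.
  by rewrite inE /= mulr1.
have mono m n y : (m <= n)%N -> f_ m y ^+ 2 <= f_ n y ^+ 2.
  move=> mn; rewrite /f_ !indicE.
  case: (boolP (y \in [set y | `|h y| <= m%:R])) => [|_]; last first.
    by rewrite mulr0 expr0n sqr_ge0.
  rewrite inE /= => ym; rewrite mem_set//=.
  by apply: le_trans ym _; rewrite ler_nat.
have hf_ n y : h y * f_ n y = f_ n y ^+ 2.
  by rewrite /f_ indicE; case: (y \in _); rewrite ?mulr1 ?mulr0 ?expr0n.
have I0 n : 0 <= \int[Phi x]_y f_ n y ^+ 2.
  by apply: Rintegral_ge0 => y _; exact: sqr_ge0.
have c0 : 0 <= c.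
  have := DPhi x _ (bounded_measurable_cst Y 1).
  rewrite texp_cst expr0n /=.
  under eq_Rintegral do rewrite expr1n.
  by rewrite Rintegral_channel_cst mulr1.
have bound n : \int[Phi x]_y f_ n y ^+ 2 <= c.
  have := DPhi x _ (bf n); rewrite hf//.
  under eq_Rintegral do rewrite hf_.
  have := I0 n; rewrite le_eqVlt => /predU1P[<- _ //|I1].
  by rewrite expr2 ler_pM2r.
have -> : fisher (output Phi x) (D x) =
    (\int[output Phi x]_y (limn (fun n => (f_ n y ^+ 2)%:E)))%E.
  rewrite /fisher; apply: eq_integral => y _; rewrite -hE -EFin_expe.
  apply/esym/cvg_lim => //; apply: cvg_near_cst; near=> n.
  congr EFin; rewrite /f_ indicE mem_set ?mulr1//=.
  apply: ltW; near: n; exact: nbhs_infty_gtr.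
rewrite monotone_convergence//.
- apply: lime_le; last first.
    apply: nearW => n.
    rewrite -(@Rintegral_fineK _ _ _ (output Phi x) (fun y => f_ n y ^+ 2)).
      by rewrite lee_fin; exact: bound.
    exact/bounded_integrable/bounded_measurable_sqr.
  apply: ereal_nondecreasing_is_cvgn => m n mn; apply: ge0_le_integral => //.
  + by move=> y _; rewrite lee_fin sqr_ge0.
  + by apply/measurable_EFinP; case: (bounded_measurable_sqr (bf m)).
  + by apply/measurable_EFinP; case: (bounded_measurable_sqr (bf n)).
  + by move=> y _; rewrite lee_fin mono.
- by move=> n; apply/measurable_EFinP; case: (bounded_measurable_sqr (bf n)).
- by move=> n y _; rewrite lee_fin sqr_ge0.
- by move=> y _ m n mn; rewrite lee_fin mono.
Unshelve. all: by end_near. Qed.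

(** The source of local channel data below: the dual bound passes through composition and tensoring
    without any computation of derivatives. *)
Lemma fisher_bound_local_data X Y (Phi : channel X Y) D c :
  fisher_bound Phi D c -> local_data Phi D.
Proof.
move=> DPhi; split=> [x|]; first exact: fisher_bound_dominates DPhi.
apply: (@le_lt_trans _ _ c%:E); last exact: ltry.
by apply: ge_ereal_sup => _ [x _ <-]; exact: fisher_le.
Qed.

(** Jensen's inequality for the average of [texp D y f] over [Psi x]. *)
Lemma fisher_bound_comp_tc X Y Z (Phi : channel Y Z) (D : tangent Y Z)
    (Psi : channel X Y) c :
  fisher_bound Phi D c -> fisher_bound (comp_channel Phi Psi) (comp_tc D Psi) c.
Proof.
move=> DPhi x f bf; rewrite texp_comp_tc// Rintegral_comp_channel; last exact: bounded_measurable_sqr.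
have bD := bounded_measurable_texp1 D bf.
have bI := bounded_measurable_kernel1 Phi (bounded_measurable_sqr bf).
apply: (@le_trans _ _ (\int[output Psi x]_y (texp D y f ^+ 2))).
  apply: (@sqr_Rintegral_le _ _ _ (output Psi x) (fun y => texp D y f)).
    by case: bD.
  exact: (bounded_integrable (output Psi x) (bounded_measurable_sqr bD)).
rewrite -RintegralZl//; last exact: channel_integrable.
apply: le_Rintegral => //.
- exact: (bounded_integrable (output Psi x) (bounded_measurable_sqr bD)).
- exact: (bounded_integrable (output Psi x) (bounded_measurableZ c bI)).
- by move=> y _; exact: DPhi.
Qed.

Lemma fisher_bound_ge0 X Y (Phi : channel X Y) D c : fisher_bound Phi D c -> 0 <= c.
Proof.
move=> DPhi; have := DPhi point _ (bounded_measurable_cst Y 1).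
rewrite texp_cst expr0n /=; under eq_Rintegral do rewrite expr1n.
by rewrite Rintegral_channel_cst mulr1.
Qed.

(** By Jensen's inequality, averaging [f] over [Psi y] does not increase its second moment. *)
Lemma fisher_bound_comp_ct X Y Z (Psi : channel Y Z) (Phi : channel X Y)
    (D : tangent X Y) c :
  fisher_bound Phi D c -> fisher_bound (comp_channel Psi Phi) (comp_ct Psi D) c.
Proof.
move=> DPhi x f bf; have c0 := fisher_bound_ge0 DPhi.
rewrite texp_comp_ct// Rintegral_comp_channel; last exact: bounded_measurable_sqr.
have bI := bounded_measurable_kernel1 Psi bf.
have b2 := bounded_measurable_sqr bf.
apply: le_trans (DPhi x _ bI) _; rewrite ler_wpM2l//.
apply: le_Rintegral => //.
- by apply: channel_integrable; exact: bounded_measurable_sqr.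
- by apply: channel_integrable; exact: bounded_measurable_kernel1.
- move=> y _; apply: (@sqr_Rintegral_le _ _ _ (output Psi y) f); first by case: bf.
  exact: (bounded_integrable (output Psi y) b2).
Qed.

Lemma fisher_bound_tensor_id X Y Z (Phi : channel X Y) (D : tangent X Y) c :
  fisher_bound Phi D c ->
  fisher_bound (tensor_channel Phi (id_channel Z)) (tensor_tc D (id_channel Z)) c.
Proof.
move=> DPhi x f bf; rewrite texp_tensor_tc// Rintegral_tensor_bounded; last exact: bounded_measurable_sqr.
have mid (g : Y * Z -> R) : bounded_measurable g -> forall y,
    \int[id_channel Z x.2]_y' g (y, y') = g (y, x.2) :> R.
  move=> bg y; have [mg _] := bg.
  apply: (@Rintegral_dirac R _ Z x.2 (fun y' => g (y, y'))).
  exact: (measurableT_comp mg (pair1_measurable y)).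
under eq_texp do rewrite mid//.
under eq_Rintegral do rewrite (mid _ (bounded_measurable_sqr bf)).
apply: DPhi; have [mf [M fM]] := bf; split; last by exists M => y.
exact: measurableT_comp mf (pair2_measurable x.2).
Qed.

End fisher_bound.

(** * Total variation and cb-norm through test functions *)

Section total_variation.
Variable R : realType.
Implicit Types X Y Z : kspace R.

Lemma tv_normE d (T : measurableType d) (nu : {charge set T -> \bar R}) :
  (tv_norm nu = nu (hahn_pos nu) - nu (hahn_neg nu))%E.
Proof.
rewrite /tv_norm /charge_variation /= jordan_posE jordan_negE cjordan_posE cjordan_negE.
by rewrite /crestr0 mem_set// /crestr !setTI.
Qed.

Lemma abs_le_tv_norm d (T : measurableType d) (nu : {charge set T -> \bar R}) A :
  measurable A -> (`|nu A| <= tv_norm nu)%E.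
Proof.
move=> mA; apply: le_trans (abse_charge_variation (hahnP nu) mA) _.
by apply: le_measure; rewrite ?inE.
Qed.

Lemma tv_norm_ge0 d (T : measurableType d) (nu : {charge set T -> \bar R}) :
  (0 <= tv_norm nu)%E.
Proof. by rewrite -[leLHS]abse0 -(charge0 nu); exact: abs_le_tv_norm. Qed.

(** The factor 2 comes from testing the two Hahn sets separately. *)
Lemma tv_norm_le X Y (D : tangent X Y) (x : X) (c : R) :
  (forall f : Y -> R, measurable_fun [set: Y] f -> (forall y, 0 <= f y <= 1) ->
    `|texp D x f| <= c) ->
  (tv_norm (D x) <= (2 * c)%:E)%E.
Proof.
move=> H; rewrite tv_normE.
have [[mP _] [mN _] _ _] := hahnP (D x).
have i01 (A : set Y) y : 0 <= (\1_A y : R) <= 1.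
  by rewrite indicE ler0n lern1; case: (_ \in _).
have := H _ (proj1 (bounded_measurable_indic R mP)) (i01 _).
have := H _ (proj1 (bounded_measurable_indic R mN)) (i01 _).
rewrite -(texp_indic D x mP) -(texp_indic D x mN) -EFinB lee_fin !ler_norml.
by move=> /andP[n1 n2] /andP[p1 p2]; lra.
Qed.

(** Relative to a density [h] of [D x], the extreme test functions with values in [[0, 1]] are the
    indicators of [h >= 0] and of its complement. *)
Lemma texp_le_tv X Y (D : tangent X Y) (x : X) (c : R) (f : Y -> R) :
  (forall A, measurable A -> `|D x A| <= c%:E)%E ->
  measurable_fun [set: Y] f -> (forall y, 0 <= f y <= 1) -> `|texp D x f| <= c.
Proof.
move=> Dc mf f01; have bf := bounded_measurable01 mf f01.
(* With these weights [Q] is the mean of [tpos D] and [tneg D], which dominates [D x]. *)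
pose Q := mix_channel (weight 1 1) (tpos D) (tneg D).
have w0 : (weight (1 : R) 1)%:num = 2^-1 by rewrite /= normr1 mul1r.
have DQ : D x `<< output Q x.
  apply/null_content_dominatesP => A mA.
  move=> Q0; have : ((2^-1)%:E * tpos D x A + (1 - 2^-1)%:E * tneg D x A = 0)%E.
    by rewrite -[RHS]Q0 -w0; apply/esym; exact: mix_channelE.
  rewrite tangentE.
  rewrite -(fineK (channel_fin (tpos D) x mA)) -(fineK (channel_fin (tneg D) x mA)).
  have u0 : 0 <= fine (tpos D x A) by rewrite fine_ge0.
  have v0 : 0 <= fine (tneg D x A) by rewrite fine_ge0.
  move: (fine _) (fine _) u0 v0 => u v u0 v0.
  rewrite -!EFinM -EFinD => -[] h.
  have u00 : u = 0 by lra.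
  have v00 : v = 0 by lra.
  by rewrite u00 v00 subrr mulr0.
have [mh hi _ hf] := Radon_Nikodym_fine DQ.
set h := fun y => fine _ in mh hi hf.
have mP : measurable [set y | 0 <= h y].
  rewrite -[X in measurable X]setTI.
  have := @measurable_fun_ler _ _ R [set: Y] (fun=> 0) h (measurable_cst _) mh.
  by move/(_ measurableT [set true] Logic.I).
have bP := bounded_measurable_indic R mP.
have bN := bounded_measurable_indic R (measurableC mP).
have hfi g : bounded_measurable g ->
    (output Q x).-integrable [set: Y] (EFin \o (fun y => h y * g y)).
  by move=> bg; exact: integrableM_bounded.
have up : texp D x f <= texp D x (\1_[set y | 0 <= h y]).
  rewrite !hf//; apply: le_Rintegral => //; [exact: hfi|exact: hfi|move=> y _].
  have /andP[f0 f1] := f01 y; rewrite indicE.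
  have [|] := boolP (y \in [set y | 0 <= h y]).
    by rewrite inE /= => h0; rewrite ler_wpM2l.
  rewrite notin_setE /= => /negP; rewrite -ltNge => h0.
  by rewrite mulr0 mulr_le0_ge0// ltW.
have lo : texp D x (\1_(~` [set y | 0 <= h y])) <= texp D x f.
  rewrite !hf//; apply: le_Rintegral => //; [exact: hfi|exact: hfi|move=> y _].
  have /andP[f0 f1] := f01 y; rewrite indicE in_setC.
  have [|] := boolP (y \in [set y | 0 <= h y]).
    by rewrite inE /= => h0; rewrite mulr0 mulr_ge0.
  rewrite notin_setE /= => /negP; rewrite -ltNge => h0.
  by rewrite ler_wnM2l// ltW.
have := Dc _ mP; have := Dc _ (measurableC mP).
rewrite -!texp_indic//; last exact: measurableC.
rewrite !abse_EFin !lee_fin !ler_norml => /andP[a1 a2] /andP[b1 b2].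
by apply/andP; split; [exact: le_trans a1 lo|exact: le_trans up b2].
Qed.

Lemma cb_norm_ge0 X Y (L : tangent X Y) : (0 <= cb_norm L)%E.
Proof.
apply: (@le_trans _ _ (tv_norm (comp_tc (tensor_tc L (id_channel X))
    (const_channel (point_space R) (output (id_channel (prod_space X X)) point)) tt))).
  exact: tv_norm_ge0.
by apply: ereal_sup_ubound; exists X; exists (const_channel _ (output (id_channel (prod_space X X)) point)).
Qed.

(** The auxiliary system brings no gain: the identity factor freezes [z] in the test function, and
    the joint law [p] only averages over [(x, z)]. *)
Lemma cb_norm_le X Y (L : tangent X Y) (c : R) :
  (forall x (f : Y -> R), measurable_fun [set: Y] f -> (forall y, 0 <= f y <= 1) ->
    `|texp L x f| <= c) ->
  (cb_norm L <= (2 * c)%:E)%E.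
Proof.
move=> H; apply: ge_ereal_sup => _ [Z [p ->]].
apply: tv_norm_le => f mf f01; have bf := bounded_measurable01 mf f01.
rewrite texp_comp_tc//.
have bD := bounded_measurable_texp1 (tensor_tc L (id_channel Z)) bf.
apply: (Rintegral_bound (output p tt)); first by case: bD.
move=> [x z]; rewrite texp_tensor_tc//; apply: H.
  by case: (bounded_measurable_kernel_fst (id_channel Z) z bf).
move=> y; apply: (Rintegral_ge0_01 (output (id_channel Z) z)) => //.
exact: measurableT_comp mf (pair1_measurable y).
Qed.

(** The spaces vary with the index because those of tensor powers do. *)
Lemma cvg_cb_norm (I : Type) (F : set_system I) {FF : Filter F} (X Y : I -> kspace R)
    (L : forall i, tangent (X i) (Y i)) (c : I -> R) :
  c i @[i --> F] --> 0 ->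
  (\forall i \near F, forall x (f : Y i -> R), measurable_fun [set: Y i] f ->
    (forall y, 0 <= f y <= 1) -> `|texp (L i) x f| <= c i) ->
  cb_norm (L i) @[i --> F] --> 0%E.
Proof.
move=> c0 H; apply: (@squeeze_cvge _ _ _ _ (fun=> 0%E) _ (fun i => (2 * c i)%:E)).
- near=> i; rewrite cb_norm_ge0/=; apply: cb_norm_le.
  by near: i.
- exact: cvg_cst.
- apply: cvg_EFin; first by near=> i.
  by rewrite -(mulr0 2); apply: cvgMr => //; exact: cvg_cst.
Unshelve. all: by end_near. Qed.

End total_variation.

(** * Scores of tensor powers *)

Section score.
Local Open Scope charge_scope.
Variable R : realType.
Implicit Types X Y Z : kspace R.

(* [l] is the logarithmic derivative dD(.|x)/dPhi(.|x), jointly measurable. *)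
Record is_score X Y (Phi : channel X Y) (D : tangent X Y) (l : X * Y -> R) : Prop :=
  IsScore {
    score_measurable : measurable_fun [set: X * Y] l;
    score_sqr_integrable x :
      (Phi x).-integrable [set: Y] (EFin \o (fun y => l (x, y) ^+ 2));
    score_texp x f : bounded_measurable f ->
      texp D x f = \int[Phi x]_y (l (x, y) * f y) }.

Section theory.
Variables (X Y : kspace R) (Phi : channel X Y) (D : tangent X Y) (l : X * Y -> R).
Hypothesis Dl : is_score Phi D l.

Lemma score_measurable1 x : measurable_fun [set: Y] (fun y => l (x, y)).
Proof. exact: measurableT_comp (score_measurable Dl) (pair1_measurable x). Qed.

Lemma score_integrable x : (Phi x).-integrable [set: Y] (EFin \o (fun y => l (x, y))).
Proof.
exact: (integrable_sqr (P := output Phi x) (score_measurable1 x) (score_sqr_integrable Dl x)).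
Qed.

Lemma score_mean0 x : \int[Phi x]_y l (x, y) = 0.
Proof.
have := score_texp Dl x (bounded_measurable_cst Y 1); rewrite texp_cst => ->.
by under [in RHS]eq_Rintegral do rewrite mulr1.
Qed.

Lemma score_fisher_bound c : (forall x, \int[Phi x]_y l (x, y) ^+ 2 <= c) ->
  fisher_bound Phi D c.
Proof.
move=> lc x f bf; rewrite (score_texp Dl)//.
have [mf _] := bf.
apply: le_trans (Rintegral_cauchy_schwarz (P := output Phi x) (score_measurable1 x) mf
  (score_sqr_integrable Dl x) (bounded_integrable _ (bounded_measurable_sqr bf))) _.
rewrite ler_wpM2r//; first by apply: Rintegral_ge0 => y _; exact: sqr_ge0.
exact: lc.
Qed.

(** Over every measurable set the score has the same integral as the Radon-Nikodym derivative, so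
    the two agree almost everywhere. *)
Lemma score_fisher x : D x `<< output Phi x ->
  fisher (output Phi x) (D x) = (\int[Phi x]_y l (x, y) ^+ 2)%:E.
Proof.
move=> DP.
rewrite (Rintegral_fineK (P := output Phi x) (score_sqr_integrable Dl x)).
have ae : ae_eq (output Phi x) [set: Y] (Radon_Nikodym (D x) (output Phi x))
    (fun y => (l (x, y))%:E).
  apply: integral_ae_eq => //.
  - exact: Radon_Nikodym_integrable.
  - exact/measurable_EFinP/score_measurable1.
  - move=> A _ mA; rewrite -(Radon_Nikodym_integral DP mA) -texp_indic//.
    have bA := bounded_measurable_indic R mA.
    rewrite (score_texp Dl)// (Rintegral_fineK (P := output Phi x)); last first.
      exact: (integrableM_bounded (mu := Phi x) (score_integrable x) bA).
    rewrite [RHS]integral_mkcond epatch_indic.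
    by apply: eq_integral => y _; rewrite EFinM.
have [mh _ hE _] := Radon_Nikodym_fine DP.
set h := fun y => fine _ in mh hE.
have ml := score_measurable1 x.
transitivity (\int[output Phi x]_y (h y ^+ 2)%:E)%E.
  by apply: eq_integral => y _; rewrite EFin_expe hE.
apply: ae_eq_integral => //.
- by apply/measurable_EFinP; exact: measurable_funX.
- by apply/measurable_EFinP; exact: measurable_funX.
- apply: filterS ae => y /= /(_ Logic.I); rewrite -hE => e _.
  by rewrite EFin_expe hE -hE e.
Qed.

End theory.

Fixpoint score_pow X Y (l : X * Y -> R) n : space_pow X n * space_pow Y n -> R :=
  if n is m.+1 return space_pow X n * space_pow Y n -> R then
    fun z => @score_pow X Y l m (z.1.1, z.2.1) + l (z.1.2, z.2.2)
  else l.
Arguments score_pow {X Y} l n.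

Fixpoint variance_pow X (s : X -> R) n : space_pow X n -> R :=
  if n is m.+1 return space_pow X n -> R then
    fun x => @variance_pow X s m x.1 + s x.2
  else s.
Arguments variance_pow {X} s n.

Lemma measurable_score_pow X Y (l : X * Y -> R) n :
  measurable_fun [set: X * Y] l ->
  measurable_fun [set: space_pow X n * space_pow Y n] (score_pow l n).
Proof.
move=> ml; elim: n => // n IH /=; apply: measurable_funD.
  apply: (measurableT_comp IH); apply: measurable_fun_pair.
    exact: measurableT_comp measurable_fst measurable_fst.
  exact: measurableT_comp measurable_fst measurable_snd.
apply: (measurableT_comp ml); apply: measurable_fun_pair.
  exact: measurableT_comp measurable_snd measurable_fst.
exact: measurableT_comp measurable_snd measurable_snd.
Qed.

(** Product rule: logarithmic derivatives of independent factors add. In the second moment the cross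
    term vanishes because [l'] has mean zero for each fixed [y]. *)
Lemma score_add_tensor X X' Y Y' (Phi : channel X Y) (D : tangent X Y)
    (Phi' : channel X' Y') (D' : tangent X' Y') l l' :
  is_score Phi D l -> is_score Phi' D' l' ->
  let L := fun z : (X * X') * (Y * Y') => l (z.1.1, z.2.1) + l' (z.1.2, z.2.2) in
  is_score (tensor_channel Phi Phi')
    (add_tangent (tensor_tc D Phi') (tensor_ct Phi D')) L /\
  forall x, \int[tensor_channel Phi Phi' x]_y L (x, y) ^+ 2 =
    \int[Phi x.1]_y l (x.1, y) ^+ 2 + \int[Phi' x.2]_y l' (x.2, y) ^+ 2.
Proof.
move=> Dl Dl' L.
have mL : measurable_fun [set: (X * X') * (Y * Y')] L.
  apply: measurable_funD.
    apply: (measurableT_comp (score_measurable Dl)); apply: measurable_fun_pair.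
      exact: measurableT_comp measurable_fst measurable_fst.
    exact: measurableT_comp measurable_fst measurable_snd.
  apply: (measurableT_comp (score_measurable Dl')); apply: measurable_fun_pair.
    exact: measurableT_comp measurable_snd measurable_fst.
  exact: measurableT_comp measurable_snd measurable_snd.
have mLx x : measurable_fun [set: Y * Y'] (fun y => L (x, y)).
  exact: measurableT_comp mL (pair1_measurable x).
pose P x := output Phi x; pose Q x := output Phi' x.
have l1 x : (P x).-integrable [set: Y] (EFin \o (fun y => l (x, y))).
  exact: score_integrable Dl x.
have l2 x : (P x).-integrable [set: Y] (EFin \o (fun y => l (x, y) ^+ 2)).
  exact: score_sqr_integrable Dl x.
have l'1 x : (Q x).-integrable [set: Y'] (EFin \o (fun y => l' (x, y))).
  exact: score_integrable Dl' x.
have l'2 x : (Q x).-integrable [set: Y'] (EFin \o (fun y => l' (x, y) ^+ 2)).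
  exact: score_sqr_integrable Dl' x.
have cstQ c x : (Q x).-integrable [set: Y'] (EFin \o (fun=> c : R)).
  exact: (bounded_integrable (Q x) (bounded_measurable_cst _ c)).
have cstP c x : (P x).-integrable [set: Y] (EFin \o (fun=> c : R)).
  exact: (bounded_integrable (P x) (bounded_measurable_cst _ c)).
have inner x y : (Q x.2).-integrable [set: Y'] (EFin \o (fun y' => L (x, (y, y')) ^+ 2)).
  have i1 := integrable_scale (2 * l (x.1, y)) (l'1 x.2).
  have i2 := integrable_add (cstQ (l (x.1, y) ^+ 2) x.2) (integrable_add i1 (l'2 x.2)).
  apply: eq_integrable i2 => //= y' _; rewrite /L /=; congr EFin; ring.
have innerE x y : \int[Q x.2]_y' L (x, (y, y')) ^+ 2 =
    l (x.1, y) ^+ 2 + \int[Q x.2]_y' l' (x.2, y') ^+ 2.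
  have i1 := integrable_scale (2 * l (x.1, y)) (l'1 x.2).
  transitivity (\int[Q x.2]_y' (l (x.1, y) ^+ 2 +
      (2 * l (x.1, y) * l' (x.2, y') + l' (x.2, y') ^+ 2))).
    by apply: eq_Rintegral => y' _; rewrite /L /=; ring.
  have c1 := l'1 x.2; have c2 := l'2 x.2; have c0 := cstQ (l (x.1, y) ^+ 2) x.2.
  have i2 := integrable_add i1 c2.
  rewrite RintegralD// RintegralD// Rintegral_cst1 RintegralZl//.
  have m0 : \int[Q x.2]_y' l' (x.2, y') = 0 by exact: score_mean0 Dl' x.2.
  by rewrite m0 mulr0 add0r.
have val x : (\int[tensor_channel Phi Phi' x]_y (L (x, y) ^+ 2)%:E =
    (\int[Phi x.1]_y l (x.1, y) ^+ 2 + \int[Phi' x.2]_y l' (x.2, y) ^+ 2)%:E)%E.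
  rewrite integral_tensor_channel; last 2 first.
    by move=> z; rewrite lee_fin sqr_ge0.
    by apply/measurable_EFinP; exact: measurable_funX.
  transitivity (\int[P x.1]_y (l (x.1, y) ^+ 2 + \int[Q x.2]_y' l' (x.2, y') ^+ 2)%:E)%E.
    apply: eq_integral => y _; rewrite -innerE.
    by apply/esym/(Rintegral_fineK (P := Q x.2)); exact: inner.
  have c0 := cstP (\int[Q x.2]_y l' (x.2, y) ^+ 2) x.1.
  rewrite -(Rintegral_fineK (P := P x.1)); last exact: integrable_add (l2 x.1) c0.
  by have d2 := l2 x.1; rewrite RintegralD// Rintegral_cst1.
have L2 x : (tensor_channel Phi Phi' x).-integrable [set: Y * Y']
    (EFin \o (fun y => L (x, y) ^+ 2)).
  apply: (integrable_ge0_fin (c := \int[Phi x.1]_y l (x.1, y) ^+ 2 +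
    \int[Phi' x.2]_y l' (x.2, y) ^+ 2)).
  - exact: measurable_funX.
  - by move=> y; exact: sqr_ge0.
  - by rewrite val.
split; last by move=> x; apply: ge0_Rintegral_fineK; exact: val.
split => // x f bf.
have L1 := integrable_sqr (P := output (tensor_channel Phi Phi') x) (mLx x) (L2 x).
have bg y : bounded_measurable (fun y' => f (y, y')) by exact: bounded_measurable_pair.
have innerL y : (Q x.2).-integrable [set: Y'] (EFin \o (fun y' => L (x, (y, y')))).
  exact: integrable_add (cstQ (l (x.1, y)) x.2) (l'1 x.2).
rewrite texp_add// texp_tensor_tc// texp_tensor_ct//.
rewrite (score_texp Dl); last exact: bounded_measurable_kernel_fst.
rewrite Rintegral_tensor_channel; last 2 first.
- exact: integrableM_bounded.
- by move=> y; apply: (integrableM_bounded (mu := Phi' x.2)) => //; exact: innerL.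
have bk := bounded_measurable_kernel_fst Phi' x.2 bf.
have bD := bounded_measurable_texp_fst D' x.2 bf.
rewrite -(@RintegralD _ _ _ (Phi x.1)) //; last 2 first.
- exact: (integrableM_bounded (mu := Phi x.1) (l1 x.1) bk).
- exact: channel_integrable.
apply: eq_Rintegral => y _; rewrite (score_texp Dl')//.
transitivity (\int[Q x.2]_y' (l (x.1, y) * f (y, y') + l' (x.2, y') * f (y, y'))).
  have j := bounded_integrable (Q x.2) (bg y).
  have j1 := integrable_scale (l (x.1, y)) j.
  have j2 := integrableM_bounded (l'1 x.2) (bg y).
  by rewrite RintegralD// RintegralZl.
by apply: eq_Rintegral => y' _; rewrite /L /= mulrDl.
Qed.

Lemma score_powP X Y (Phi : channel X Y) (D : tangent X Y) l n :
  is_score Phi D l ->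
  is_score (channel_pow Phi n) (tangent_pow Phi D n) (score_pow l n) /\
  forall x, \int[channel_pow Phi n x]_y score_pow l n (x, y) ^+ 2 =
    variance_pow (fun x => \int[Phi x]_y l (x, y) ^+ 2) n x.
Proof.
move=> Dl; elim: n => [//|n [IH1 IH2]] /=.
have [H1 H2] := score_add_tensor IH1 Dl; split => // x.
by rewrite H2 IH2.
Qed.

Lemma variance_pow_bound X (s : X -> R) J n x : (forall x, 0 <= s x <= J) ->
  0 <= variance_pow s n x <= n.+1%:R * J.
Proof.
move=> sJ; elim: n x => [x|n IH x] /=; first by rewrite mul1r.
have := IH x.1; have := sJ x.2.
by rewrite -(natr1 n.+1) mulrDl mul1r => /andP[? ?] /andP[? ?]; apply/andP; split; lra.
Qed.

End score.

Arguments score_pow {R X Y} l n.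
Arguments variance_pow {R X} s n.

(** * Gaussian approximation *)

Section gaussian_density.
Variable R : realType.
Implicit Types m s t u w x y z r : R.
Local Notation mu := (@lebesgue_measure R).

Definition sqrt2pi : R := Num.sqrt (pi *+ 2).

Lemma sqrt2pi_gt0 : 0 < sqrt2pi.
Proof. by rewrite sqrtr_gt0 mulrn_wgt0// pi_gt0. Qed.

Lemma normal_pdfE_gt0 m s z : 0 < s ->
  normal_pdf m s z = (sqrt2pi * s)^-1 * expR (- (z - m) ^+ 2 / (2 * s ^+ 2)).
Proof.
move=> s0; rewrite normal_pdfE ?gt_eqF// /normal_peak /normal_fun; congr (_^-1 * expR (_ / _)).
  rewrite -mulrnAr sqrtrM ?sqr_ge0// sqrtr_sqr gtr0_norm// mulrC.
  by rewrite /sqrt2pi.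
by rewrite mulr_natl.
Qed.

Lemma normal_pdf_gt0 m s z : 0 < s -> 0 < normal_pdf m s z.
Proof.
move=> s0; rewrite normal_pdfE_gt0// mulr_gt0 ?expR_gt0//.
by rewrite invr_gt0 mulr_gt0// sqrt2pi_gt0.
Qed.

Lemma normal_pdf_le m s z : 0 < s -> normal_pdf m s z <= (sqrt2pi * s)^-1.
Proof.
move=> s0; rewrite normal_pdfE_gt0//.
have k0 : 0 < (sqrt2pi * s)^-1 by rewrite invr_gt0 mulr_gt0// sqrt2pi_gt0.
rewrite ger_pMr// -[leRHS]expR0 ler_expR mulNr oppr_le0.
by rewrite divr_ge0 ?sqr_ge0// mulr_ge0// sqr_ge0.
Qed.

(** Completing the square. This and the next two identities turn each product in the chi-square
    distance relative to [normal_pdf t w] into a multiple of a single Gaussian density. *)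
Lemma normal_pdf_prod t x y w z : 0 < w ->
  normal_pdf (t + x) w z * normal_pdf (t + y) w z / normal_pdf t w z =
  expR (x * y / w ^+ 2) * normal_pdf (t + x + y) w z.
Proof.
move=> w0; have k0 := sqrt2pi_gt0; rewrite !normal_pdfE_gt0//.
transitivity ((sqrt2pi * w)^-1 * (expR (- (z - (t + x)) ^+ 2 / (2 * w ^+ 2)) *
  expR (- (z - (t + y)) ^+ 2 / (2 * w ^+ 2)) * expR (- (- (z - t) ^+ 2 / (2 * w ^+ 2))))).
  rewrite [expR (- (- (z - t) ^+ 2 / _))]expRN.
  by field; rewrite !gt_eqF ?expR_gt0.
rewrite [RHS]mulrCA -!expRD; congr (_ * expR _).
by field; rewrite gt_eqF.
Qed.

Lemma normal_pdf_prod_wide t x w r z : 0 < w -> 0 < r ->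
  normal_pdf (t + x) w z * normal_pdf t r z / normal_pdf t w z =
  expR (x ^+ 2 * (r ^+ 2 - w ^+ 2) / (2 * w ^+ 4)) *
  normal_pdf (t + x * r ^+ 2 / w ^+ 2) r z.
Proof.
move=> w0 r0; have k0 := sqrt2pi_gt0; rewrite !normal_pdfE_gt0//.
transitivity ((sqrt2pi * r)^-1 * (expR (- (z - (t + x)) ^+ 2 / (2 * w ^+ 2)) *
  expR (- (z - t) ^+ 2 / (2 * r ^+ 2)) * expR (- (- (z - t) ^+ 2 / (2 * w ^+ 2))))).
  rewrite [expR (- (- (z - t) ^+ 2 / _))]expRN.
  by field; rewrite !gt_eqF ?expR_gt0.
rewrite [RHS]mulrCA -!expRD; congr (_ * expR _).
by field; rewrite !gt_eqF.
Qed.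

(** A positive [q] means [r ^+ 2 < 2 * w ^+ 2], which is the condition for the quotient to be
    integrable. *)
Lemma normal_pdf_sqr_wide t w r q z : 0 < w -> 0 < r -> 0 < q ->
  q ^+ 2 = 2 * w ^+ 2 - r ^+ 2 ->
  normal_pdf t r z ^+ 2 / normal_pdf t w z =
  w ^+ 2 / (r * q) * normal_pdf t (r * w / q) z.
Proof.
move=> w0 r0 q0 qE; have k0 := sqrt2pi_gt0.
have rho0 : 0 < r * w / q by rewrite divr_gt0// mulr_gt0.
rewrite !normal_pdfE_gt0//.
transitivity ((sqrt2pi * r)^-1 ^+ 2 * (sqrt2pi * w) *
  (expR (- (z - t) ^+ 2 / (2 * r ^+ 2)) *
  expR (- (z - t) ^+ 2 / (2 * r ^+ 2)) * expR (- (- (z - t) ^+ 2 / (2 * w ^+ 2))))).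
  rewrite [expR (- (- (z - t) ^+ 2 / _))]expRN.
  by field; rewrite !gt_eqF ?expR_gt0.
rewrite -!expRD [RHS]mulrA; congr (_ * expR _).
  by field; rewrite !gt_eqF.
transitivity (- (z - t) ^+ 2 * (q ^+ 2) / (2 * r ^+ 2 * w ^+ 2)).
  by rewrite qE; field; rewrite !gt_eqF.
by field; rewrite !gt_eqF.
Qed.

(** Bayes' formula for a standard Gaussian [u] observed as [z = t + c * u] plus noise of deviation
    [w]: prior times likelihood is marginal times posterior. *)
Lemma normal_pdf_bayes t c w r u z : 0 < w -> 0 < r -> r ^+ 2 = w ^+ 2 + c ^+ 2 ->
  normal_pdf 0 1 u * normal_pdf (t + c * u) w z =
  normal_pdf t r z * normal_pdf (c * (z - t) / r ^+ 2) (w / r) u.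
Proof.
move=> w0 r0 rE; have k0 := sqrt2pi_gt0.
have wr0 : 0 < w / r by rewrite divr_gt0.
rewrite !normal_pdfE_gt0//.
transitivity ((sqrt2pi * 1)^-1 * (sqrt2pi * w)^-1 *
  expR (- (u - 0) ^+ 2 / (2 * 1 ^+ 2) + - (z - (t + c * u)) ^+ 2 / (2 * w ^+ 2))).
  by rewrite expRD; ring.
transitivity ((sqrt2pi * r)^-1 * (sqrt2pi * (w / r))^-1 *
  expR (- (z - t) ^+ 2 / (2 * r ^+ 2) +
    - (u - c * (z - t) / r ^+ 2) ^+ 2 / (2 * (w / r) ^+ 2))); last first.
  by rewrite expRD; ring.
congr (_ * expR _); first by field; rewrite !gt_eqF.
have -> : - (z - t) ^+ 2 / (2 * r ^+ 2) +
    - (u - c * (z - t) / r ^+ 2) ^+ 2 / (2 * (w / r) ^+ 2) =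
    - ((z - t) ^+ 2 * (w ^+ 2 + c ^+ 2) + u ^+ 2 * r ^+ 4 - 2 * u * c * (z - t) * r ^+ 2)
      / (2 * r ^+ 2 * w ^+ 2) by field; rewrite !gt_eqF.
rewrite -rE.
transitivity (- ((z - t) ^+ 2 + u ^+ 2 * r ^+ 2 - 2 * u * c * (z - t)) / (2 * w ^+ 2)); last first.
  by field; rewrite !gt_eqF.
by rewrite rE; field; rewrite !gt_eqF.
Qed.

(** A linear exponential moves the mean; this yields the first moment below. *)
Lemma normal_pdf_tilt m s h z : 0 < s ->
  normal_pdf m s z * expR (h * (z - m)) =
  expR (h ^+ 2 * s ^+ 2 / 2) * normal_pdf (m + h * s ^+ 2) s z.
Proof.
move=> s0; have k0 := sqrt2pi_gt0; rewrite !normal_pdfE_gt0//.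
rewrite -[LHS]mulrA -expRD [RHS]mulrCA -expRD; congr (_ * expR _).
by field; rewrite !gt_eqF.
Qed.

(** A quadratic exponential rescales the deviation; with [h] of either sign this yields the second
    moment below. *)
Lemma normal_pdf_tilt_sqr m s h q z : 0 < s -> 0 < q -> q ^+ 2 = 1 - 2 * h * s ^+ 2 ->
  normal_pdf m s z * expR (h * (z - m) ^+ 2) = q^-1 * normal_pdf m (s / q) z.
Proof.
move=> s0 q0 qE; have k0 := sqrt2pi_gt0; have sq0 : 0 < s / q by rewrite divr_gt0.
rewrite !normal_pdfE_gt0// -[LHS]mulrA -expRD [RHS]mulrA; congr (_ * expR _).
  by field; rewrite !gt_eqF.
transitivity (- (z - m) ^+ 2 * (1 - 2 * h * s ^+ 2) / (2 * s ^+ 2)).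
  by field; rewrite !gt_eqF.
by rewrite -qE; field; rewrite !gt_eqF.
Qed.

(** The inverse coincides on nonnegative numbers with the real power of exponent -1, also at 0,
    where both are 0. *)
Lemma measurable_invr_ge0 d (T : measurableType d) (f : T -> R) :
  measurable_fun [set: T] f -> (forall a, 0 <= f a) ->
  measurable_fun [set: T] (fun a => (f a)^-1).
Proof.
move=> mf f0; rewrite [X in measurable_fun _ X](_ : _ = fun a => f a `^ (-1)).
  by apply: (measurableT_comp (f := fun b : R => b `^ (-1))) => //; exact: measurable_powR.
by apply/funext => a; rewrite powR_inv1.
Qed.

Lemma measurable_normal_pdf3 d (T : measurableType d) (m s z : T -> R) :
  measurable_fun [set: T] m -> measurable_fun [set: T] s ->
  measurable_fun [set: T] z -> (forall a, 0 < s a) ->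
  measurable_fun [set: T] (fun a => normal_pdf (m a) (s a) (z a)).
Proof.
move=> mm ms mz s0; rewrite [X in measurable_fun _ X](_ : _ = fun a =>
    (sqrt2pi * s a)^-1 * expR (- (z a - m a) ^+ 2 / (2 * s a ^+ 2))); last first.
  by apply/funext => a; rewrite normal_pdfE_gt0.
have k0 := sqrt2pi_gt0.
apply: measurable_funM.
  apply: measurable_invr_ge0; last by move=> a; rewrite ltW// mulr_gt0.
  by apply: measurable_funM.
apply: (measurableT_comp (@measurable_expR R)); apply: measurable_funM.
  by apply: measurable_funN; apply: measurable_funX; exact: measurable_funB.
apply: measurable_invr_ge0; last by move=> a; rewrite ltW// mulr_gt0// exprn_gt0.
by apply: measurable_funM => //; exact: measurable_funX.
Qed.

Lemma measurable_normal_pdfE m s :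
  measurable_fun [set: measurableTypeR R] (fun z => (normal_pdf m s z)%:E).
Proof. by apply/measurable_EFinP; exact: measurable_normal_pdf. Qed.

Lemma integral_scale_normal_pdf c m s : 0 <= c ->
  (\int[mu]_z (c * normal_pdf m s z)%:E = c%:E)%E.
Proof.
move=> c0; under eq_integral do rewrite EFinM.
rewrite ge0_integralZl//=; last 2 first.
- exact: measurable_normal_pdfE.
- by move=> z _; rewrite lee_fin normal_pdf_ge0.
by rewrite integral_normal_pdf mule1.
Qed.

End gaussian_density.

(** * Gaussian moments by exponential tilting *)

Section gaussian_moments.
Variable R : realType.
Local Notation mu := (@lebesgue_measure R).

(** Lets [h] tend to 0, in order to read off a moment from bounds on an exponential moment. *)
Lemma ler_small_param (a b C h0 : R) : 0 < h0 ->
  (forall h, 0 < h -> h <= h0 -> a <= b + C * h) -> a <= b.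
Proof.
move=> h00 H; rewrite leNgt; apply/negP => ba.
pose h := Num.min h0 ((a - b) / (2 * (`|C| + 1))).
have C0 : 0 < 2 * (`|C| + 1) by rewrite mulr_gt0// ltr_wpDl.
have hp : 0 < h by rewrite lt_min h00 divr_gt0// subr_gt0.
have hh0 : h <= h0 by rewrite ge_min lexx.
have hd : h * (2 * (`|C| + 1)) <= a - b.
  by rewrite -ler_pdivlMr// /h ge_min lexx orbT.
have := H h hp hh0.
have : C * h <= `|C| * h by rewrite ler_wpM2r ?ler_norm// ltW.
by move: hd; set n := `|C|; lra.
Qed.

Lemma expR_le_1D2 (x : R) : 0 <= x -> x <= 2^-1 -> expR x <= 1 + 2 * x.
Proof.
move=> x0 x1.
have h : 1 - x <= expR (- x) by exact: expR_ge1Dx.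
have p : 0 < 1 - x by lra.
rewrite -[x]opprK expRN opprK.
apply: (@le_trans _ _ (1 - x)^-1); first by rewrite lef_pV2// posrE expR_gt0.
rewrite -div1r ler_pdivrMr//.
have : 0 <= x * (1 - 2 * x) by rewrite mulr_ge0//; lra.
by lra.
Qed.

(** The integral of the density against [expR (h * (z - m) ^+ 2)] is known exactly from the tilted
    density. With [1 + u <= expR u], a positive parameter bounds [I] from above ([up]) and a
    negative one from below ([lo]), up to an error that vanishes with [h]. *)
Lemma ge0_integral_normal_sqr (m s : R) : 0 < s ->
  (\int[mu]_z (normal_pdf m s z * (z - m) ^+ 2)%:E = (s ^+ 2)%:E)%E.
Proof.
move=> s0; set I := (X in X = _); set v := s ^+ 2.
have v0 : 0 < v by rewrite exprn_gt0.
have mz : measurable_fun [set: measurableTypeR R] (fun z => (z - m) ^+ 2).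
  by apply: measurable_funX; exact: measurable_funB.
have mg := measurable_normal_pdf m s.
have g0 z : 0 <= normal_pdf m s z by exact: normal_pdf_ge0.
have mI : measurable_fun [set: measurableTypeR R]
    (fun z => (normal_pdf m s z * (z - m) ^+ 2)%:E).
  by apply/measurable_EFinP; exact: measurable_funM.
have I0 z : (0 <= (normal_pdf m s z * (z - m) ^+ 2)%:E)%E.
  by rewrite lee_fin mulr_ge0// sqr_ge0.
have mge := measurable_normal_pdfE m s.
have gE z : (0 <= (normal_pdf m s z)%:E)%E by rewrite lee_fin.
have up h : 0 < h -> h * v <= 4^-1 -> (h%:E * I + 1 <= (1 + h * v + 4 * (h * v) ^+ 2)%:E)%E.
  move=> h0 hv.
  have q0 : 0 < Num.sqrt (1 - 2 * h * v) by rewrite sqrtr_gt0; lra.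
  have qE : Num.sqrt (1 - 2 * h * v) ^+ 2 = 1 - 2 * h * s ^+ 2.
    by rewrite sqr_sqrtr; rewrite -/v; lra.
  apply: (@le_trans _ _ (Num.sqrt (1 - 2 * h * v))^-1%:E).
    rewrite -(integral_normal_pdf m s) -ge0_integralZl//; last by rewrite lee_fin ltW.
    rewrite -ge0_integralD//; last 2 first.
      by move=> z _; rewrite mule_ge0// lee_fin ltW.
      exact: measurable_funeM.
    rewrite -(@integral_scale_normal_pdf _ (Num.sqrt (1 - 2 * h * v))^-1 m (s / Num.sqrt (1 - 2 * h * v))); last first.
      by rewrite invr_ge0 ltW.
    apply: ge0_le_integral => //.
    - by move=> z _; rewrite adde_ge0// mule_ge0// lee_fin ltW.
    - by apply: emeasurable_funD => //; exact: measurable_funeM.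
    - apply/measurable_EFinP; apply: measurable_funM => //; exact: measurable_normal_pdf.
    - move=> z _; rewrite -(normal_pdf_tilt_sqr m z s0 q0 qE).
      rewrite -EFinM -EFinD lee_fin.
      have := expR_ge1Dx (h * (z - m) ^+ 2).
      move/(ler_wpM2l (g0 z)); lra.
  rewrite lee_fin -div1r ler_pdivrMr//.
  set x := h * v; have x0 : 0 < x by rewrite mulr_gt0.
  have pos : 0 <= 1 + x + 4 * x ^+ 2 by rewrite addr_ge0 ?mulr_ge0 ?sqr_ge0//; lra.
  rewrite -(ler_pXn2r (n := 2))// ?nnegrE ?mulr_ge0 ?(ltW q0)// expr1n exprMn qE -/v.
  have -> : 2 * h * v = 2 * x by rewrite /x; ring.
  have x4 : x <= 4^-1 by [].
  have : 0 <= x ^+ 2 * (5 - 10 * x - 32 * x ^+ 3).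
    rewrite mulr_ge0 ?sqr_ge0//.
    have : x ^+ 3 <= 4^-1 ^+ 3 by rewrite ler_pXn2r// ?nnegrE; lra.
    by rewrite !exprS expr0; lra.
  by rewrite !exprS expr0; lra.
have lo h : 0 < h -> h * v <= 4^-1 -> (1 <= (1 - h * v + 2 * (h * v) ^+ 2)%:E + h%:E * I)%E.
  move=> h0 hv.
  have q0 : 0 < Num.sqrt (1 + 2 * h * v).
    by rewrite sqrtr_gt0 addr_gt0// mulr_gt0// mulr_gt0.
  have qE : Num.sqrt (1 + 2 * h * v) ^+ 2 = 1 - 2 * - h * s ^+ 2.
    rewrite sqr_sqrtr; first by rewrite -/v; ring.
    by rewrite ltW// addr_gt0// mulr_gt0// mulr_gt0.
  apply: (@le_trans _ _ ((Num.sqrt (1 + 2 * h * v))^-1%:E + h%:E * I)%E).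
    rewrite -(integral_normal_pdf m s) -[in leRHS]ge0_integralZl//; last by rewrite lee_fin ltW.
    rewrite -(@integral_scale_normal_pdf _ (Num.sqrt (1 + 2 * h * v))^-1 m (s / Num.sqrt (1 + 2 * h * v))); last first.
      by rewrite invr_ge0 ltW.
    have mq : measurable_fun [set: measurableTypeR R]
        (fun z => ((Num.sqrt (1 + 2 * h * v))^-1 * normal_pdf m (s / Num.sqrt (1 + 2 * h * v)) z)%:E).
      by apply/measurable_EFinP; apply: measurable_funM => //; exact: measurable_normal_pdf.
    have q1 z : (0 <= ((Num.sqrt (1 + 2 * h * v))^-1 * normal_pdf m (s / Num.sqrt (1 + 2 * h * v)) z)%:E)%E.
      by rewrite lee_fin mulr_ge0 ?normal_pdf_ge0// invr_ge0 ltW.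
    rewrite -ge0_integralD//; last 2 first.
      by move=> z _; rewrite mule_ge0// lee_fin ltW.
      exact: measurable_funeM.
    apply: ge0_le_integral => //.
    - by apply: emeasurable_funD => //; exact: measurable_funeM.
    - move=> z _; rewrite -(normal_pdf_tilt_sqr m z s0 q0 qE).
      rewrite -EFinM -EFinD lee_fin.
      have := expR_ge1Dx (- h * (z - m) ^+ 2).
      move/(ler_wpM2l (g0 z)); lra.
  rewrite leeD2r// lee_fin -div1r ler_pdivrMr//.
  set x := h * v; have x0 : 0 < x by rewrite mulr_gt0.
  have x4 : x <= 4^-1 by [].
  have pos : 0 <= 1 - x + 2 * x ^+ 2 by rewrite addr_ge0 ?mulr_ge0 ?sqr_ge0//; lra.
  rewrite -(ler_pXn2r (n := 2))// ?nnegrE ?mulr_ge0 ?(ltW q0)// expr1n exprMn qE -/v.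
  have -> : 2 * - h * v = - 2 * x by rewrite /x; ring.
  have : 0 <= x ^+ 2 * (1 + 6 * x - 4 * x ^+ 2 + 8 * x ^+ 3).
    rewrite mulr_ge0 ?sqr_ge0// !exprS expr0.
    have : 0 <= x * (x * x) by rewrite !mulr_ge0// ltW.
    have : x * x <= x * 4^-1 by rewrite ler_wpM2l// ltW.
    lra.
  by rewrite !exprS expr0; lra.
have h1 : 0 < (4 * v)^-1 by rewrite invr_gt0 mulr_gt0.
have h1v h : 0 < h -> h <= (4 * v)^-1 -> h * v <= 4^-1.
  by move=> h0 hh; rewrite -ler_pdivlMr// -invfM.
(* [up] bounds a positive multiple of [I] by a real number. *)
have Ifin : I \is a fin_num.
  rewrite ge0_fin_numE; last exact: integral_ge0.
  have := up _ h1 (h1v _ h1 (lexx _)).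
  rewrite ltNge leye_eq; case: eqP => // ->.
  by rewrite gt0_muley ?lte_fin// addye// leye_eq.
rewrite -(fineK Ifin) in up lo *; congr EFin.
apply/eqP; rewrite eq_le; apply/andP; split.
- apply: (ler_small_param (C := 4 * v ^+ 2) h1) => h h0 hh.
  have := up _ h0 (h1v _ h0 hh); rewrite -EFinM -EFinD lee_fin => e.
  rewrite -(ler_pM2l h0); move: e; rewrite !exprS expr0; lra.
- apply: (ler_small_param (C := 2 * v ^+ 2) h1) => h h0 hh.
  have := lo _ h0 (h1v _ h0 hh); rewrite -EFinM -EFinD lee_fin => e.
  rewrite -(ler_pM2l h0); move: e; rewrite !exprS expr0; lra.
Qed.

End gaussian_moments.

(** The difference [h c] of the two sides vanishes at 0. With [c = 1] it increases on [[0, 1/2]],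
    with [c = -1] it decreases on [[-1/2, 0]], by the sign of its derivative. *)
Lemma expR_le_taylor2 (R : realType) (u : R) : `|u| <= 2^-1 ->
  expR u <= 1 + u + u ^+ 2 / 2 + `|u| ^+ 3.
Proof.
have der (c x : R) : is_derive (x : R^o) (1 : R^o)
    (fun x : R^o => 1 + x + x ^+ 2 / 2 + c * x ^+ 3 - expR x : R^o)
    (1 + x + c * (3 * x ^+ 2) - expR x).
  by apply: is_derive_eq; rewrite /GRing.scale /=; field.
pose h (c : R) (x : R^o) : R^o := 1 + x + x ^+ 2 / 2 + c * x ^+ 3 - expR x.
have cont c a b : {within `[a, b], continuous (h c)}.
  apply: continuous_subspaceT => x; apply: differentiable_continuous.
  by apply/derivable1_diffP; have [] := der c x.
have h0 c : h c 0 = 0 by rewrite /h !expr0n /= expR0; ring.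
have hd c x : derivable (h c) x 1 by have [] := der c x.
have hE c x : (h c)^`()%classic x = 1 + x + c * (3 * x ^+ 2) - expR x.
  by rewrite derive1E; have [_] := der c x.
case: (leP 0 u) => u0.
  rewrite ger0_norm// => u1.
  have : h 1 0 <= h 1 u.
    apply: (@ger0_derive1_le_cc _ (h 1) 0 2^-1) => //.
    - move=> x; rewrite in_itv /= => /andP[x0 x1]; rewrite hE mul1r.
      have : 1 - x <= expR (- x) by exact: expR_ge1Dx.
      have p : 0 < 1 - x by lra.
      rewrite expRN => e.
      have : expR x <= (1 - x)^-1 by rewrite -[expR x]invrK lef_pV2// posrE ?invr_gt0 ?expR_gt0.
      have : (1 - x)^-1 <= 1 + x + 3 * x ^+ 2.
        rewrite -div1r ler_pdivrMr//.
        have : 0 <= x ^+ 2 * (2 - 3 * x) by rewrite mulr_ge0 ?sqr_ge0//; lra.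
        by rewrite !exprS expr0; lra.
      lra.
    - by rewrite in_itv /=; lra.
    - by rewrite in_itv /= u0 u1.
  by rewrite h0 /h; lra.
rewrite ltr0_norm// => u1.
have : h (- 1) 0 <= h (- 1) u.
  apply: (@ler0_derive1_le_cc _ (h (- 1)) (- 2^-1) 0) => //.
  - move=> x; rewrite in_itv /= => /andP[x0 x1]; rewrite hE.
    have := expR_ge1Dx x; have : 0 <= x ^+ 2 by exact: sqr_ge0.
    lra.
  - by rewrite in_itv /=; lra.
  - by rewrite in_itv /= (ltW u0) andbT lerNl.
  - exact: ltW.
rewrite h0 /h exprNn; rewrite !exprS expr0; lra.
Qed.

Section gaussian_integrals.
Variable R : realType.
Local Notation mu := (@lebesgue_measure R).

Lemma Rintegral_normal_pdf (m s : R) : \int[mu]_z normal_pdf m s z = 1.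
Proof. by apply: ge0_Rintegral_fineK; exact: integral_normal_pdf. Qed.

Lemma integrable_normal_sqr (m s : R) : 0 < s ->
  mu.-integrable [set: measurableTypeR R]
    (EFin \o (fun z => normal_pdf m s z * (z - m) ^+ 2)).
Proof.
move=> s0; apply: (integrable_ge0_fin (c := s ^+ 2)).
- apply: measurable_funM; first exact: measurable_normal_pdf.
  by apply: measurable_funX; exact: measurable_funB.
- by move=> z; rewrite mulr_ge0 ?normal_pdf_ge0// sqr_ge0.
- by rewrite ge0_integral_normal_sqr.
Qed.

Lemma integrable_normal_centered (m s : R) : 0 < s ->
  mu.-integrable [set: measurableTypeR R]
    (EFin \o (fun z => normal_pdf m s z * (z - m))).
Proof.
move=> s0.
have := integrable_add (integrable_normal_sqr m s0) (integrable_normal_pdf m s).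
apply: le_integrable => //.
  apply/measurable_EFinP; apply: measurable_funM; first exact: measurable_normal_pdf.
  exact: measurable_funB.
move=> z _ /=; rewrite lee_fin normrM (ger0_norm (normal_pdf_ge0 _ _ _)).
rewrite [leRHS]ger0_norm; last first.
  apply: addr_ge0; last exact: normal_pdf_ge0.
  by apply: mulr_ge0; [exact: normal_pdf_ge0|exact: sqr_ge0].
rewrite -[X in _ <= _ + X]mulr1 -mulrDr ler_wpM2l ?normal_pdf_ge0//.
rewrite -[(z - m) ^+ 2]real_normK ?num_real//; move: `|z - m| => a.
have : 0 <= (a - 1) ^+ 2 by exact: sqr_ge0.
have : 0 <= a ^+ 2 by exact: sqr_ge0.
lra.
Qed.

Lemma integrable_normal_id (m s : R) : 0 < s ->
  mu.-integrable [set: measurableTypeR R] (EFin \o (fun z => normal_pdf m s z * z)).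
Proof.
move=> s0.
have := integrable_add (integrable_normal_centered m s0)
  (integrable_scale m (integrable_normal_pdf m s)).
by apply: eq_integrable => // z _ /=; congr EFin; ring.
Qed.

(** Comparison of [1 + h * (z - m)] with its exponential, whose integral is
    [expR (h ^+ 2 * s ^+ 2 / 2)], gives [h * i <= h ^+ 2 * s ^+ 2]; small [h] of both signs force
    [i = 0]. *)
Lemma Rintegral_normal_centered (m s : R) : 0 < s ->
  \int[mu]_z (normal_pdf m s z * (z - m)) = 0.
Proof.
move=> s0; set i := LHS.
have v0 : 0 < s ^+ 2 by rewrite exprn_gt0.
have ig := integrable_normal_pdf m s.
have ic := integrable_normal_centered m s0.
have bnd h : h ^+ 2 * s ^+ 2 <= 1 -> h * i <= h ^+ 2 * s ^+ 2.
  move=> hs.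
  have i1 := integrable_add ig (integrable_scale h ic).
  have i2 := integrable_scale (expR (h ^+ 2 * s ^+ 2 / 2)) (integrable_normal_pdf (m + h * s ^+ 2) s).
  have : \int[mu]_z (normal_pdf m s z + h * (normal_pdf m s z * (z - m))) <=
      \int[mu]_z (expR (h ^+ 2 * s ^+ 2 / 2) * normal_pdf (m + h * s ^+ 2) s z).
    apply: le_Rintegral => // z _; rewrite -normal_pdf_tilt//.
    have := expR_ge1Dx (h * (z - m)).
    by move/(ler_wpM2l (normal_pdf_ge0 m s z)); lra.
  rewrite RintegralD//; last exact: integrable_scale.
  rewrite !RintegralZl//; last exact: integrable_normal_pdf.
  rewrite !Rintegral_normal_pdf mulr1 => e.
  have hs0 : 0 <= h ^+ 2 * s ^+ 2 by rewrite mulr_ge0// sqr_ge0.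
  have := @expR_le_1D2 _ (h ^+ 2 * s ^+ 2 / 2).
  move: (h ^+ 2 * s ^+ 2) hs hs0 e => x x1 x0 e.
  have x0' : 0 <= x / 2 by lra.
  have x1' : x / 2 <= 2^-1 by lra.
  move/(_ x0' x1'); rewrite /i; lra.
have h0 : 0 < s^-1 by rewrite invr_gt0.
have hh h : 0 < h -> h <= s^-1 -> h ^+ 2 * s ^+ 2 <= 1.
  move=> hp h1; have hs1 : h * s <= 1 by rewrite -ler_pdivlMr// mul1r.
  by rewrite -exprMn exprn_ile1// mulr_ge0// ltW.
apply/eqP; rewrite eq_le; apply/andP; split.
- apply: (ler_small_param (C := s ^+ 2) h0) => h hp h1.
  have := bnd h (hh _ hp h1); rewrite add0r expr2 -mulrA ler_pM2l//.
  by rewrite mulrC.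
- rewrite -oppr_le0; apply: (ler_small_param (C := s ^+ 2) h0) => h hp h1.
  have := bnd (- h); rewrite sqrrN => /(_ (hh _ hp h1)).
  rewrite add0r expr2 -mulrA mulNr -mulrN ler_pM2l//.
  by rewrite mulrC.
Qed.

Lemma Rintegral_normal_id (m s : R) : 0 < s ->
  \int[mu]_z (normal_pdf m s z * z) = m.
Proof.
move=> s0.
transitivity (\int[mu]_z (normal_pdf m s z * (z - m) + m * normal_pdf m s z)).
  by apply: eq_Rintegral => z _; ring.
rewrite RintegralD//; [|exact: integrable_normal_centered|].
  rewrite Rintegral_normal_centered// RintegralZl//; last exact: integrable_normal_pdf.
  by rewrite Rintegral_normal_pdf mulr1 add0r.
by apply: integrable_scale; exact: integrable_normal_pdf.
Qed.

(** From [a <= s / 2 + a ^+ 2 / (2 * s)], which balances mass and second moment. *)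
Lemma ge0_integral_normal_dist (m s : R) : 0 < s ->
  (\int[mu]_z (normal_pdf m s z * `|z - m|)%:E <= s%:E)%E.
Proof.
move=> s0.
have mg := measurable_normal_pdf m s.
have mz : measurable_fun [set: measurableTypeR R] (fun z => z - m) by exact: measurable_funB.
apply: (@le_trans _ _ (\int[mu]_z ((s / 2)%:E * (normal_pdf m s z)%:E +
    (2 * s)^-1%:E * (normal_pdf m s z * (z - m) ^+ 2)%:E))%E).
  apply: ge0_le_integral => //.
  - by move=> z _; rewrite lee_fin mulr_ge0 ?normal_pdf_ge0.
  - by apply/measurable_EFinP; apply: measurable_funM => //; exact: measurableT_comp.
  - apply: emeasurable_funD; apply: measurable_funeM; apply/measurable_EFinP => //.
    by apply: measurable_funM => //; exact: measurable_funX.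
  - move=> z _; rewrite -!EFinM -EFinD lee_fin.
    rewrite [X in _ <= X](_ : _ = normal_pdf m s z * (s / 2 + (z - m) ^+ 2 / (2 * s))); last first.
      by field; rewrite gt_eqF.
    rewrite ler_wpM2l ?normal_pdf_ge0//.
    rewrite -[(z - m) ^+ 2]real_normK ?num_real//; move: `|z - m| => a.
    rewrite -subr_ge0.
    have -> : s / 2 + a ^+ 2 / (2 * s) - a = (a - s) ^+ 2 / (2 * s).
      by field; rewrite gt_eqF.
    by rewrite divr_ge0 ?sqr_ge0// mulr_ge0// ltW.
rewrite ge0_integralD//; last 4 first.
- by move=> z _; rewrite mule_ge0// lee_fin ?normal_pdf_ge0// divr_ge0// ltW.
- by apply: measurable_funeM; exact/measurable_EFinP.
- move=> z _; rewrite mule_ge0// lee_fin; first by rewrite invr_ge0 mulr_ge0// ltW.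
  by rewrite mulr_ge0 ?normal_pdf_ge0// sqr_ge0.
- apply: measurable_funeM; apply/measurable_EFinP.
  by apply: measurable_funM => //; exact: measurable_funX.
rewrite !ge0_integralZl//; last 6 first.
- by apply/measurable_EFinP; apply: measurable_funM => //; exact: measurable_funX.
- by move=> z _; rewrite lee_fin mulr_ge0 ?normal_pdf_ge0// sqr_ge0.
- by rewrite lee_fin invr_ge0 mulr_ge0// ltW.
- exact/measurable_EFinP.
- by move=> z _; rewrite lee_fin normal_pdf_ge0.
- by rewrite lee_fin divr_ge0// ltW.
rewrite integral_normal_pdf ge0_integral_normal_sqr// mule1 -EFinM -EFinD lee_fin.
by rewrite le_eqVlt; apply/orP; left; apply/eqP; field; rewrite gt_eqF.
Qed.

(** In Bayes' formula the posterior of [u] integrates to 1 and the marginal of [z] remains. *)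
Lemma integral_normal_conv (t c w r z : R) : 0 < w -> 0 < r ->
  r ^+ 2 = w ^+ 2 + c ^+ 2 ->
  (\int[mu]_u (normal_pdf 0 1 u * normal_pdf (t + c * u) w z)%:E =
   (normal_pdf t r z)%:E)%E.
Proof.
move=> w0 r0 rE; under eq_integral => u _ do rewrite (normal_pdf_bayes t u z w0 r0 rE).
by rewrite integral_scale_normal_pdf ?normal_pdf_ge0.
Qed.

End gaussian_integrals.

(** * Replacement of one bounded summand by a Gaussian *)

Section gaussian_replacement.
Variable R : realType.
Local Notation mu := (@lebesgue_measure R).

(** By Tonelli, a mixture of Gaussian densities has the mass of its weights. This reduces the
    chi-square terms that involve [A] to expectations under the law of the summand. *)
Lemma integral_mixture d (T : measurableType d) (P : probability T R)
    (c : T -> R) (m : T -> R) (s : R) (A : R -> R) :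
  0 < s -> bounded_measurable c -> (forall y, 0 <= c y) ->
  measurable_fun [set: T] m ->
  (forall z, A z = \int[P]_y (c y * normal_pdf (m y) s z)) ->
  (\int[mu]_z (A z)%:E = (\int[P]_y c y)%:E)%E.
Proof.
move=> s0 bc c0 mm AE; have [mc _] := bc.
have mF : measurable_fun [set: T * measurableTypeR R]
    (fun q => (c q.1 * normal_pdf (m q.1) s q.2)%:E).
  apply/measurable_EFinP; apply: measurable_funM.
    exact: measurableT_comp mc measurable_fst.
  apply: measurable_normal_pdf3 => //.
  exact: measurableT_comp mm measurable_fst.
have bg z : bounded_measurable (fun y => c y * normal_pdf (m y) s z).
  apply: bounded_measurableM => //; split.
    by apply: measurable_normal_pdf3.
  exists (sqrt2pi R * s)^-1 => y.
  by rewrite ger0_norm ?normal_pdf_ge0// normal_pdf_le.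
transitivity (\int[mu]_z \int[P]_y (c y * normal_pdf (m y) s z)%:E)%E.
  apply: eq_integral => z _; rewrite AE Rintegral_fineK//.
  exact: bounded_integrable.
rewrite -(@fubini_tonelli _ _ _ _ _ P mu (fun q => (c q.1 * normal_pdf (m q.1) s q.2)%:E))//=.
  rewrite Rintegral_fineK; last exact: bounded_integrable.
  by apply: eq_integral => y _; rewrite integral_scale_normal_pdf.
by move=> q; rewrite lee_fin mulr_ge0// normal_pdf_ge0.
Qed.

Variables (Y : kspace R) (P : probability Y R) (X : Y -> R) (b s2 w t : R).
Hypotheses (mX : measurable_fun [set: Y] X) (b0 : 0 < b) (Xb : forall y, `|X y| <= b).
Hypotheses (bw : 2 * b <= w) (X0 : \int[P]_y X y = 0) (X2 : \int[P]_y X y ^+ 2 = s2).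

Let r := Num.sqrt (w ^+ 2 + s2).
Let A z := \int[P]_y normal_pdf (t + X y) w z.
Let B z := normal_pdf t r z.
Let g0 z := normal_pdf t w z.
Let beta := b / w.

Let w0 : 0 < w. Proof. by apply: lt_le_trans bw; rewrite mulr_gt0. Qed.

Let bX : bounded_measurable X. Proof. by split => //; exists b. Qed.

Let s20 : 0 <= s2. Proof. by rewrite -X2; apply: Rintegral_ge0 => y _; exact: sqr_ge0. Qed.

Let s2b : s2 <= b ^+ 2.
Proof.
rewrite -X2; apply: le_trans (ler_norm _) _; apply: Rintegral_bound.
  exact: measurable_funX.
by move=> y; rewrite normrX lerXn2r// nnegrE ltW.
Qed.

Let r0 : 0 < r. Proof. by rewrite sqrtr_gt0 ltr_pwDl// exprn_gt0. Qed.

Let rE : r ^+ 2 = w ^+ 2 + s2.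
Proof. by rewrite sqr_sqrtr// addr_ge0// sqr_ge0. Qed.

Let beta0 : 0 < beta. Proof. exact: divr_gt0. Qed.

Let beta2 : beta <= 2^-1. Proof. by rewrite ler_pdivrMr// mulrC ler_pdivlMr// mulrC. Qed.

Let g00 z : 0 < g0 z. Proof. exact: normal_pdf_gt0. Qed.

Let mg : measurable_fun [set: real_space R * Y] (fun q => normal_pdf (t + X q.2) w q.1).
Proof.
apply: measurable_normal_pdf3 => //; apply: measurable_funD => //.
exact: measurableT_comp mX measurable_snd.
Qed.

Let mA : measurable_fun [set: measurableTypeR R] A.
Proof. exact: (measurable_Rintegral_kernel (const_channel (real_space R) P) mg). Qed.

Let bg z : bounded_measurable (fun y => normal_pdf (t + X y) w z).
Proof.
split; first by apply: measurable_normal_pdf3 => //; exact: measurable_funD.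
exists (sqrt2pi R * w)^-1 => y.
by rewrite ger0_norm ?normal_pdf_ge0// normal_pdf_le.
Qed.

Let A0 z : 0 <= A z. Proof. by apply: Rintegral_ge0 => y _; exact: normal_pdf_ge0. Qed.

Let mB : measurable_fun [set: measurableTypeR R] B. Proof. exact: measurable_normal_pdf. Qed.

Let mg0 : measurable_fun [set: measurableTypeR R] g0. Proof. exact: measurable_normal_pdf. Qed.

Let mg0V : measurable_fun [set: measurableTypeR R] (fun z => (g0 z)^-1).
Proof. by apply: measurable_invr_ge0 => // z; exact: ltW. Qed.

Let X_le y y' : `|X y * X y' / w ^+ 2| <= beta ^+ 2.
Proof.
rewrite !normrM normfV [X in _ / X]ger0_norm ?sqr_ge0// /beta expr_div_n.
by rewrite ler_wpM2r ?invr_ge0 ?sqr_ge0// expr2 ler_pM.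
Qed.

Let beta24 : beta ^+ 2 <= 4^-1.
Proof.
have -> : 4^-1 = 2^-1 ^+ 2 :> R by field.
by rewrite lerXn2r// nnegrE; [exact: ltW|lra].
Qed.

(** The second-order part common to the three integrals below. It cancels in the square of [A - B],
    where only the remainders [beta ^+ 6] survive. *)
Let kappa := s2 ^+ 2 / (2 * w ^+ 4).

(** The square of [A] is a double integral over two independent copies of [X], so the left side is
    the mean of [expR (X X' / w ^+ 2)]. In its Taylor bound the linear term has mean zero and the
    quadratic one gives [kappa]. *)
Let intAA : (\int[mu]_z (A z ^+ 2 / g0 z)%:E <= (1 + kappa + beta ^+ 6)%:E)%E.
Proof.
pose Q := (P \x P)%E.
pose c (q : Y * Y) := expR (X q.1 * X q.2 / w ^+ 2).
have mX1 : measurable_fun [set: Y * Y] (fun q => X q.1).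
  exact: measurableT_comp mX measurable_fst.
have mX2 : measurable_fun [set: Y * Y] (fun q => X q.2).
  exact: measurableT_comp mX measurable_snd.
have mc : measurable_fun [set: Y * Y] c.
  apply: (measurableT_comp (@measurable_expR R)).
  by apply: measurable_funM => //; exact: measurable_funM.
have bc : bounded_measurable c.
  split => //; exists (expR (beta ^+ 2)) => q.
  rewrite ger0_norm ?expR_ge0// ler_expR.
  exact: le_trans (ler_norm _) (X_le _ _).
have bX1 : bounded_measurable (fun q : Y * Y => X q.1) by split => //; exists b.
have bX2 : bounded_measurable (fun q : Y * Y => X q.2) by split => //; exists b.
rewrite (@integral_mixture _ _ Q c (fun q => t + X q.1 + X q.2) w)//; last 3 first.
- by move=> q; exact: expR_ge0.
- by apply: measurable_funD => //; exact: measurable_funD.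
- move=> z.
  have bq : bounded_measurable (fun q : Y * Y =>
      normal_pdf (t + X q.1) w z * normal_pdf (t + X q.2) w z / g0 z).
    apply: bounded_measurableM; last exact: bounded_measurable_cst.
    apply: bounded_measurableM.
      have [mgz [M gM]] := bg z; split; last by exists M.
      exact: measurableT_comp mgz measurable_fst.
    have [mgz [M gM]] := bg z; split; last by exists M.
    exact: measurableT_comp mgz measurable_snd.
  transitivity (\int[Q]_q (normal_pdf (t + X q.1) w z * normal_pdf (t + X q.2) w z / g0 z)); last first.
    by apply: eq_Rintegral => q _; rewrite normal_pdf_prod.
  rewrite Rintegral_prod; last 2 first.
    exact: bounded_integrable.
    by move=> y; apply: bounded_integrable; exact: (bounded_measurable_pair y bq).
  rewrite /=.
  have bi := bounded_integrable P (bg z).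
  transitivity (\int[P]_y (A z / g0 z * normal_pdf (t + X y) w z)).
    by rewrite RintegralZl// -/(A z); ring.
  apply: eq_Rintegral => y _; rewrite -mulrA mulrC -mulrA -/(A z).
  rewrite [RHS](_ : _ = \int[P]_y' ((normal_pdf (t + X y) w z / g0 z) * normal_pdf (t + X y') w z)).
    by rewrite RintegralZl//; rewrite /A; ring.
  by apply: eq_Rintegral => y' _; ring.
rewrite lee_fin.
pose e (q : Y * Y) := 1 + (X q.1 * X q.2 / w ^+ 2) + (X q.1 * X q.2 / w ^+ 2) ^+ 2 / 2 + beta ^+ 6.
have b1 : bounded_measurable (fun q : Y * Y => X q.1 * X q.2 / w ^+ 2).
  apply: bounded_measurableM; last exact: bounded_measurable_cst.
  exact: bounded_measurableM.
have be : bounded_measurable e.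
  apply: bounded_measurableD; last exact: bounded_measurable_cst.
  apply: bounded_measurableD.
    by apply: bounded_measurableD => //; exact: bounded_measurable_cst.
  apply: bounded_measurableM; last exact: bounded_measurable_cst.
  exact: bounded_measurable_sqr.
apply: (@le_trans _ _ (\int[Q]_q e q)).
  apply: le_Rintegral => //; [exact: bounded_integrable|exact: bounded_integrable|].
  move=> q _; rewrite /c /e; have := X_le q.1 q.2; set u := X q.1 * X q.2 / w ^+ 2 => ub.
  have u2 : `|u| <= 2^-1 by apply: le_trans ub _; apply: le_trans beta24 _; lra.
  apply: le_trans (expR_le_taylor2 u2) _; rewrite lerD2l.
  by rewrite (exprM beta 2 3) lerXn2r// nnegrE sqr_ge0.
rewrite Rintegral_prod; last 2 first.
- exact: bounded_integrable.
- by move=> y; apply: bounded_integrable; exact: (bounded_measurable_pair y be).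
have bX2' := bounded_integrable P (bounded_measurable_sqr bX).
have bX1' := bounded_integrable P bX.
have cst a : P.-integrable [set: Y] (EFin \o (fun=> a : R)).
  exact: (bounded_integrable P (bounded_measurable_cst _ a)).
have [k kE] : exists k, k = 1 + beta ^+ 6 by exists (1 + beta ^+ 6).
have inner y : \int[P]_y' e (y, y') = k + s2 / (2 * w ^+ 4) * X y ^+ 2.
  transitivity (\int[P]_y' (k +
      (X y / w ^+ 2 * X y' + X y ^+ 2 / (2 * w ^+ 4) * X y' ^+ 2))).
    by apply: eq_Rintegral => y' _; rewrite /e /= kE; field; rewrite gt_eqF.
  have j1 := integrable_scale (X y / w ^+ 2) bX1'.
  have j2 := integrable_scale (X y ^+ 2 / (2 * w ^+ 4)) bX2'.
  have j3 := integrable_add j1 j2; have j0 := cst k.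
  rewrite RintegralD// RintegralD// RintegralZl// RintegralZl// X0 X2 Rintegral_cst1.
  by field; rewrite gt_eqF.
under eq_Rintegral do rewrite inner.
have j2 := integrable_scale (s2 / (2 * w ^+ 4)) bX2'.
have j0 := cst k.
rewrite RintegralD// RintegralZl// X2 Rintegral_cst1 /kappa kE.
by rewrite le_eqVlt; apply/orP; left; apply/eqP; field; rewrite gt_eqF.
Qed.

(** The integral is the mean of [expR (a * X ^+ 2)] with [a = s2 / (2 * w ^+ 4)], at least
    [1 + a * s2 = 1 + kappa]. *)
Let intAB : ((1 + kappa)%:E <= \int[mu]_z (A z * B z / g0 z)%:E)%E.
Proof.
pose c y := expR (X y ^+ 2 * (r ^+ 2 - w ^+ 2) / (2 * w ^+ 4)).
have bX2 := bounded_measurable_sqr bX.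
pose a := (r ^+ 2 - w ^+ 2) / (2 * w ^+ 4).
have a0 : 0 <= a.
  by rewrite /a rE (addrC (w ^+ 2)) addrK divr_ge0// mulr_ge0// exprn_ge0// ltW.
have mc : measurable_fun [set: Y] c.
  apply: (measurableT_comp (@measurable_expR R)).
  apply: measurable_funM => //; apply: measurable_funM => //.
  by case: bX2.
have bc : bounded_measurable c.
  split => //; exists (expR (b ^+ 2 * a)) => y.
  rewrite ger0_norm ?expR_ge0// ler_expR -mulrA ler_wpM2r//.
  by rewrite -[X y ^+ 2]real_normK ?num_real// lerXn2r// nnegrE ltW.
rewrite (@integral_mixture _ _ P c (fun y => t + X y * r ^+ 2 / w ^+ 2) r)//; last 3 first.
- by move=> y; exact: expR_ge0.
- apply: measurable_funD => //; apply: measurable_funM => //.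
  exact: measurable_funM.
- move=> z.
  transitivity (\int[P]_y (B z / g0 z * normal_pdf (t + X y) w z)).
    rewrite RintegralZl//; last exact: (bounded_integrable P (bg z)).
    by rewrite -/(A z); ring.
  by apply: eq_Rintegral => y _; rewrite /c -normal_pdf_prod_wide//; rewrite /B /g0; ring.
rewrite lee_fin.
have i2 := integrable_scale a (bounded_integrable P bX2).
have i0 := bounded_integrable P (bounded_measurable_cst Y 1).
apply: (@le_trans _ _ (\int[P]_y (1 + a * X y ^+ 2))).
  rewrite RintegralD// RintegralZl//; last exact: bounded_integrable.
  rewrite Rintegral_cst1 X2 /a rE /kappa.
  by rewrite le_eqVlt; apply/orP; left; apply/eqP; field; rewrite gt_eqF.
apply: le_Rintegral => //; [exact: integrable_add|exact: bounded_integrable|].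
move=> y _; rewrite /c -mulrA -/a [a * _]mulrC; exact: expR_ge1Dx.
Qed.

(** With [rho = s2 / w ^+ 2] the integral is exactly the inverse square root of [1 - rho ^+ 2], and
    [kappa = rho ^+ 2 / 2]. *)
Let intBB : (\int[mu]_z (B z ^+ 2 / g0 z)%:E <= (1 + kappa + beta ^+ 6)%:E)%E.
Proof.
have s2w : 4 * s2 <= w ^+ 2.
  apply: (@le_trans _ _ ((2 * b) ^+ 2)).
    by rewrite exprMn -natrX ler_wpM2l.
  by rewrite lerXn2r// nnegrE ltW// mulr_gt0.
pose q := Num.sqrt (w ^+ 2 - s2).
have wp : 0 < w ^+ 2 by rewrite exprn_gt0.
have q0 : 0 < q by rewrite sqrtr_gt0; lra.
have qE : q ^+ 2 = 2 * w ^+ 2 - r ^+ 2.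
  by rewrite sqr_sqrtr ?rE; lra.
under eq_integral do rewrite (normal_pdf_sqr_wide t _ w0 r0 q0 qE).
have rq0 : 0 < r * q by rewrite mulr_gt0.
rewrite integral_scale_normal_pdf; last by rewrite divr_ge0 ?ltW.
rewrite lee_fin ler_pdivrMr//.
set rho := s2 / w ^+ 2.
have rho0 : 0 <= rho by rewrite divr_ge0// ltW.
have rhob : rho <= beta ^+ 2.
  by rewrite /rho /beta expr_div_n ler_wpM2r// invr_ge0 ltW.
have kE : kappa = rho ^+ 2 / 2 by rewrite /kappa /rho; field; rewrite gt_eqF.
have rho3 : rho ^+ 4 <= beta ^+ 6.
  rewrite (exprM beta 2 3) exprS.
  apply: (@le_trans _ _ (1 * rho ^+ 3)); first by rewrite ler_wpM2r ?exprn_ge0//; move: rhob beta24; lra.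
  by rewrite mul1r lerXn2r// nnegrE sqr_ge0.
apply: (@le_trans _ _ ((1 + rho ^+ 2 / 2 + rho ^+ 4) * (r * q))); last first.
  by rewrite ler_wpM2r ?(ltW rq0)// kE lerD2l.
have pos : 0 <= 1 + rho ^+ 2 / 2 + rho ^+ 4 by rewrite !addr_ge0 ?divr_ge0 ?exprn_ge0.
rewrite -(ler_pXn2r (n := 2))// ?nnegrE ?mulr_ge0 ?(ltW w0) ?(ltW r0) ?(ltW q0)//.
rewrite [(_ * (r * q)) ^+ 2]exprMn [(r * q) ^+ 2]exprMn qE rE.
have sE : s2 = rho * w ^+ 2 by rewrite /rho mulfVK// gt_eqF.
rewrite sE.
have a16 : rho ^+ 2 <= 4^-1.
  apply: (@le_trans _ _ (rho * 1)); first by rewrite expr2 ler_wpM2l//; move: rhob beta24; lra.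
  by move: rhob beta24; lra.
have a0 : 0 <= rho ^+ 2 by exact: sqr_ge0.
have -> : rho ^+ 4 = rho ^+ 2 * rho ^+ 2 by ring.
have -> : (w ^+ 2 + rho * w ^+ 2) * (2 * w ^+ 2 - (w ^+ 2 + rho * w ^+ 2)) =
    (w ^+ 2) ^+ 2 * (1 - rho ^+ 2) by ring.
rewrite mulrCA -[leLHS]mulr1 ler_wpM2l ?sqr_ge0//.
move: (rho ^+ 2) a0 a16 => a a0 a16.
have -> : (1 + a / 2 + a * a) ^+ 2 * (1 - a) =
  1 + a ^+ 2 * (5 / 4 - 5 / 4 * a - a ^+ 3) by field.
rewrite lerDl mulr_ge0 ?sqr_ge0//.
have : a ^+ 3 <= 4^-1.
  apply: (@le_trans _ _ (1 * a)); last by lra.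
  rewrite exprSr ler_wpM2r// exprn_ile1//; lra.
lra.
Qed.

(* AM-GM bounds the L1 distance by the chi-square distance relative to
   [normal_pdf t w], for which all cross terms are explicit exponential moments. *)
Lemma gaussian_replacement :
  (\int[mu]_z (`|A z - B z|)%:E <= (2 * (b / w) ^+ 3)%:E)%E.
Proof.
rewrite -/beta.
have mAB : measurable_fun [set: measurableTypeR R] (fun z => (A z - B z) ^+ 2 / g0 z).
  by apply: measurable_funM => //; apply: measurable_funX; exact: measurable_funB.
have mAB' : measurable_fun [set: measurableTypeR R] (fun z => A z * B z / g0 z).
  by apply: measurable_funM => //; exact: measurable_funM.
have mAA : measurable_fun [set: measurableTypeR R] (fun z => A z ^+ 2 / g0 z).
  by apply: measurable_funM => //; exact: measurable_funX.
have mBB : measurable_fun [set: measurableTypeR R] (fun z => B z ^+ 2 / g0 z).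
  by apply: measurable_funM => //; exact: measurable_funX.
have B0 z : 0 <= B z by exact: normal_pdf_ge0.
have g0i z : 0 <= (g0 z)^-1 by rewrite invr_ge0 ltW.
have AA0 z : 0 <= A z ^+ 2 / g0 z by rewrite mulr_ge0 ?sqr_ge0.
have BB0 z : 0 <= B z ^+ 2 / g0 z by rewrite mulr_ge0 ?sqr_ge0.
have AB0 z : 0 <= A z * B z / g0 z by rewrite !mulr_ge0.
have V0 z : 0 <= (A z - B z) ^+ 2 / g0 z by rewrite mulr_ge0 ?sqr_ge0.
have sq : (\int[mu]_z ((A z - B z) ^+ 2 / g0 z)%:E + \int[mu]_z (2 * (A z * B z / g0 z))%:E =
    \int[mu]_z (A z ^+ 2 / g0 z)%:E + \int[mu]_z (B z ^+ 2 / g0 z)%:E)%E.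
  have mE (h : measurableTypeR R -> R) : measurable_fun [set: measurableTypeR R] h ->
      measurable_fun [set: measurableTypeR R] (fun z => (h z)%:E).
    by move=> mh; exact/measurable_EFinP.
  have m2AB : measurable_fun [set: measurableTypeR R] (fun z => 2 * (A z * B z / g0 z)).
    exact: measurable_funM.
  rewrite -ge0_integralD//; [|by move=> z _; rewrite lee_fin|exact: mE|
    by move=> z _; rewrite lee_fin mulr_ge0|exact: mE].
  rewrite -ge0_integralD//; [|by move=> z _; rewrite lee_fin|exact: mE|
    by move=> z _; rewrite lee_fin|exact: mE].
  apply: eq_integral => z _; rewrite -!EFinD; congr EFin.
  by field; rewrite gt_eqF// g00.
have V6 : (\int[mu]_z ((A z - B z) ^+ 2 / g0 z)%:E <= (2 * beta ^+ 6)%:E)%E.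
  have AB2 : ((2 * (1 + kappa))%:E <= \int[mu]_z (2 * (A z * B z / g0 z))%:E)%E.
    under eq_integral do rewrite EFinM.
    rewrite ge0_integralZl//; last 2 first.
    - exact/measurable_EFinP.
    - by move=> z _; rewrite lee_fin.
    by rewrite EFinM lee_wpmul2l// lee_fin.
  have := leeD intAA intBB; rewrite -sq => h.
  have {}h := le_trans (leeD (lexx _) AB2) h.
  have Vge : (0 <= \int[mu]_z ((A z - B z) ^+ 2 / g0 z)%:E)%E.
    by apply: integral_ge0 => z _; rewrite lee_fin.
  move: h Vge; case: (\int[mu]_z ((A z - B z) ^+ 2 / g0 z)%:E)%E => [v| |]//.
  by rewrite -!EFinD !lee_fin => h _; lra.
have b3 : 0 < beta ^+ 3 by rewrite exprn_gt0.
(* The weight [beta ^+ 3] is the order of the square root of the chi-square bound [2 * beta ^+ 6],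
   so both summands have order [beta ^+ 3]. *)
apply: (@le_trans _ _ (\int[mu]_z ((beta ^+ 3 / 2)%:E * (g0 z)%:E +
    (2 * beta ^+ 3)^-1%:E * ((A z - B z) ^+ 2 / g0 z)%:E))%E).
  apply: ge0_le_integral => //.
  - apply/measurable_EFinP; apply: measurableT_comp => //; exact: measurable_funB.
  - by apply: emeasurable_funD; apply: measurable_funeM; exact/measurable_EFinP.
  - move=> z _; rewrite -!EFinM -EFinD lee_fin -subr_ge0.
    rewrite -[(A z - B z) ^+ 2]real_normK ?num_real//; move: `|A z - B z| => a.
    have -> : beta ^+ 3 / 2 * g0 z + (2 * beta ^+ 3)^-1 * (a ^+ 2 / g0 z) - a =
        (beta ^+ 3 * g0 z - a) ^+ 2 / (2 * beta ^+ 3 * g0 z).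
      by field; rewrite !gt_eqF.
    apply: divr_ge0; first exact: sqr_ge0.
    apply: mulr_ge0; last exact: ltW.
    by apply: mulr_ge0 => //; exact: ltW.
rewrite ge0_integralD//; last 4 first.
- by move=> z _; rewrite mule_ge0// lee_fin ?divr_ge0// ltW.
- by apply: measurable_funeM; exact/measurable_EFinP.
- by move=> z _; rewrite mule_ge0// lee_fin// invr_ge0 mulr_ge0// ltW.
- by apply: measurable_funeM; exact/measurable_EFinP.
rewrite !ge0_integralZl//; last 6 first.
- exact/measurable_EFinP.
- by move=> z _; rewrite lee_fin.
- by rewrite lee_fin invr_ge0 mulr_ge0// ltW.
- exact/measurable_EFinP.
- by move=> z _; rewrite lee_fin ltW.
- by rewrite lee_fin divr_ge0// ltW.
rewrite integral_normal_pdf mule1.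
apply: (@le_trans _ _ ((beta ^+ 3 / 2)%:E + (2 * beta ^+ 3)^-1%:E * (2 * beta ^+ 6)%:E)%E).
  by rewrite leeD2l// lee_wpmul2l// lee_fin invr_ge0 mulr_ge0// ltW.
rewrite -EFinM -EFinD lee_fin.
have -> : beta ^+ 3 / 2 + (2 * beta ^+ 3)^-1 * (2 * beta ^+ 6) = 3 / 2 * beta ^+ 3.
  by field; rewrite gt_eqF.
by rewrite ler_wpM2r ?(ltW b3)//; lra.
Qed.

End gaussian_replacement.

(** * Summation of the replacement steps *)

Section telescoping.
Variable R : realType.
Local Notation mu := (@lebesgue_measure R).

Lemma measurable_Rintegral_param (Z Y : kspace R) (P : probability Y R) (f : Z * Y -> R) :
  measurable_fun [set: Z * Y] f ->
  measurable_fun [set: Z] (fun z => \int[P]_y f (z, y)).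
Proof. exact: (measurable_Rintegral_kernel (const_channel Z P)). Qed.

Lemma bounded_normal_pdf d (T : measurableType d) (m : T -> R) (w z : R) : 0 < w ->
  measurable_fun [set: T] m -> bounded_measurable (fun y => normal_pdf (m y) w z).
Proof.
move=> w0 mm; split; first exact: measurable_normal_pdf3.
exists (sqrt2pi R * w)^-1 => y.
by rewrite ger0_norm ?normal_pdf_ge0// normal_pdf_le.
Qed.

Lemma sqrt_add_gt0 (w c : R) : 0 < w -> 0 <= c -> 0 < Num.sqrt (w ^+ 2 + c).
Proof. by move=> w0 c0; rewrite sqrtr_gt0 ltr_pwDl// exprn_gt0. Qed.

Lemma sqrt_add_ge (w c : R) : 0 < w -> 0 <= c -> w <= Num.sqrt (w ^+ 2 + c).
Proof.
move=> w0 c0; rewrite -[leLHS](ger0_norm (ltW w0)) -sqrtr_sqr.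
by rewrite ler_wsqrtr// lerDl.
Qed.

Variables (X Y : kspace R) (Phi : channel X Y) (l : X * Y -> R) (s : X -> R).
Variables (a e eta : R).
Hypotheses (ml : measurable_fun [set: X * Y] l) (e0 : 0 < e) (s0 : forall x, 0 <= s x).
Hypothesis step : forall x t w, e <= w ->
  (\int[mu]_z (`|\int[Phi x]_y normal_pdf (t + a * l (x, y)) w z
     - normal_pdf t (Num.sqrt (w ^+ 2 + a ^+ 2 * s x)) z|)%:E <= eta%:E)%E.

(* The score of the last factor is replaced by a Gaussian, which is absorbed into
   the smoothing width of the remaining factors. *)
Lemma telescoping n (x : space_pow X n) w : e <= w ->
  (\int[mu]_z (`|\int[channel_pow Phi n x]_y normal_pdf (a * score_pow l n (x, y)) w z
     - normal_pdf 0 (Num.sqrt (w ^+ 2 + a ^+ 2 * variance_pow s n x)) z|)%:E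
   <= (n.+1%:R * eta)%:E)%E.
Proof.
elim: n x w => [x w ew|n IH x w ew].
  rewrite mul1r; have := step x 0 ew.
  by under eq_integral do under eq_Rintegral do rewrite add0r.
have w0 : 0 < w by exact: lt_le_trans ew.
have as0 : 0 <= a ^+ 2 * s x.2 by rewrite mulr_ge0// sqr_ge0.
pose r := Num.sqrt (w ^+ 2 + a ^+ 2 * s x.2).
have r0 : 0 < r by exact: sqrt_add_gt0.
have er : e <= r by apply: le_trans ew _; exact: sqrt_add_ge.
have rE : r ^+ 2 = w ^+ 2 + a ^+ 2 * s x.2 by rewrite sqr_sqrtr// addr_ge0// sqr_ge0.
pose k := output (channel_pow Phi n) x.1; pose Q := output Phi x.2.
pose L y := score_pow l n (x.1, y).
have mL : measurable_fun [set: space_pow Y n] L.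
  apply: (measurableT_comp (f := score_pow l n)); first exact: measurable_score_pow.
  exact: pair1_measurable.
have mL1 : measurable_fun [set: space_pow Y n.+1] (fun y => score_pow l n.+1 (x, y)).
  apply: (measurableT_comp (f := score_pow l n.+1)); first exact: measurable_score_pow.
  exact: pair1_measurable.
have mlx : measurable_fun [set: Y] (fun y => l (x.2, y)).
  exact: (measurableT_comp ml (pair1_measurable x.2)).
pose G y z := \int[Q]_y' normal_pdf (a * L y + a * l (x.2, y')) w z.
pose H y z := normal_pdf (a * L y) r z.
have mH : measurable_fun [set: prod_space (space_pow Y n) (real_space R)] (fun q => H q.1 q.2).
  apply: measurable_normal_pdf3 => //; apply: measurable_funM => //.
  exact: measurableT_comp mL measurable_fst.
have mG : measurable_fun [set: prod_space (space_pow Y n) (real_space R)] (fun q => G q.1 q.2).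
  apply: (@measurable_Rintegral_param (prod_space (space_pow Y n) (real_space R)) Y Q
    (fun p => normal_pdf (a * L p.1.1 + a * l (x.2, p.2)) w p.1.2)).
  apply: measurable_normal_pdf3 => //; last exact: measurableT_comp measurable_snd measurable_fst.
  apply: measurable_funD; apply: measurable_funM => //.
    by apply: (measurableT_comp mL); exact: measurableT_comp measurable_fst measurable_fst.
  exact: measurableT_comp mlx measurable_snd.
have bH z : bounded_measurable (fun y => H y z).
  by apply: bounded_normal_pdf => //; exact: measurable_funM.
have bQ y z : bounded_measurable (fun y' => normal_pdf (a * L y + a * l (x.2, y')) w z).
  by apply: bounded_normal_pdf => //; apply: measurable_funD => //; exact: measurable_funM.
have bG z : bounded_measurable (fun y => G y z).
  split; first exact: measurableT_comp mG (pair2_measurable z).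
  exists (sqrt2pi R * w)^-1 => y; apply: Rintegral_bound; first by case: (bQ y z).
  by move=> y'; rewrite ger0_norm ?normal_pdf_ge0// normal_pdf_le.
pose A z := \int[k]_y G y z; pose B z := \int[k]_y H y z.
have mA : measurable_fun [set: real_space R] A.
  apply: (@measurable_Rintegral_param (real_space R) (space_pow Y n) k (fun q => G q.2 q.1)).
  apply: (measurableT_comp (f := fun q => G q.1 q.2) (g := fun q => (q.2, q.1))) => //.
  exact: measurable_fun_pair.
have mB : measurable_fun [set: real_space R] B.
  apply: (@measurable_Rintegral_param (real_space R) (space_pow Y n) k (fun q => H q.2 q.1)).
  apply: (measurableT_comp (f := fun q => H q.1 q.2) (g := fun q => (q.2, q.1))) => //.
  exact: measurable_fun_pair.
have mGHn : measurable_fun [set: space_pow Y n * measurableTypeR R]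
    (fun q => (`|G q.1 q.2 - H q.1 q.2|)%:E).
  apply/measurable_EFinP; apply: measurableT_comp => //.
  exact: measurable_funB.
pose C z := normal_pdf 0 (Num.sqrt (w ^+ 2 + a ^+ 2 * variance_pow s n.+1 x)) z.
have mC : measurable_fun [set: measurableTypeR R] C by exact: measurable_normal_pdf.
(* [A] is the exact density, in [B] the last score is Gaussian, in [C] all are. The distance of [A]
   and [B] is one step averaged over the other factors; that of [B] and [C] is the induction
   hypothesis at width [r]. *)
apply: (@le_trans _ _ (\int[mu]_z ((`|A z - B z|)%:E + (`|B z - C z|)%:E))%E).
  apply: ge0_le_integral => //.
  - apply/measurable_EFinP; apply: measurableT_comp => //; apply: measurable_funB => //.
    apply: (@measurable_Rintegral_param (real_space R) (space_pow Y n.+1)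
      (output (channel_pow Phi n.+1) x)
      (fun q => normal_pdf (a * score_pow l n.+1 (x, q.2)) w q.1)).
    apply: measurable_normal_pdf3 => //; apply: measurable_funM => //.
    exact: measurableT_comp mL1 measurable_snd.
  - apply: emeasurable_funD; apply/measurable_EFinP; apply: measurableT_comp => //; exact: measurable_funB.
  - move=> z _; rewrite -EFinD lee_fin.
    have -> : \int[channel_pow Phi n.+1 x]_y normal_pdf (a * score_pow l n.+1 (x, y)) w z = A z.
      rewrite /= Rintegral_tensor_bounded.
        apply: eq_Rintegral => y _; rewrite /G; apply: eq_Rintegral => y' _ /=.
        by rewrite mulrDr.
      by apply: bounded_normal_pdf => //; exact: measurable_funM.
    by rewrite -[A z - C z](subrKA (B z)) ler_normD.
rewrite ge0_integralD//; last 2 first.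
- by apply/measurable_EFinP; apply: measurableT_comp => //; exact: measurable_funB.
- by apply/measurable_EFinP; apply: measurableT_comp => //; exact: measurable_funB.
have -> : n.+2%:R * eta = eta + n.+1%:R * eta by rewrite -[n.+2]addn1 natrD; ring.
rewrite EFinD; apply: leeD; last first.
  apply: le_trans (IH x.1 r er); rewrite le_eqVlt; apply/orP; left; apply/eqP.
  apply: eq_integral => z _.
  by rewrite /C /= rE mulrDr (addrC (a ^+ 2 * _) (a ^+ 2 * s x.2)) addrA.
apply: (@le_trans _ _ (\int[mu]_z \int[k]_y (`|G y z - H y z|)%:E)%E).
  apply: ge0_le_integral => //.
  - by apply/measurable_EFinP; apply: measurableT_comp => //; exact: measurable_funB.
  - exact: (@measurable_fun_fubini_tonelli_G _ _ _ _ _ k (fun q => (`|G q.1 q.2 - H q.1 q.2|)%:E)).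
  - move=> z _; rewrite /A /B -RintegralB//; try exact: bounded_integrable.
    have bGH : bounded_measurable (fun y => G y z - H y z) by exact: bounded_measurableB.
    rewrite -(Rintegral_fineK (P := k)); last first.
      by apply: integrable_norm; exact: bounded_integrable.
    by rewrite lee_fin le_normr_Rintegral//; exact: bounded_integrable.
rewrite -(@fubini_tonelli _ _ _ _ _ k mu (fun q => (`|G q.1 q.2 - H q.1 q.2|)%:E))//=.
rewrite -[leRHS]mule1 -(probability_setT k) -integral_cst//.
apply: ge0_le_integral => //.
- by move=> y _; apply: integral_ge0 => z _; rewrite lee_fin.
- exact: (@measurable_fun_fubini_tonelli_F _ _ _ _ _ mu (fun q => (`|G q.1 q.2 - H q.1 q.2|)%:E)).
- by move=> y _; apply: step.
Qed.

End telescoping.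

(** * Simulation by posterior sampling *)

Section smoothing.
Variable R : realType.
Local Notation mu := (@lebesgue_measure R).

(** Makes smoothed densities positive, so that posteriors are genuine quotients. *)
Lemma Rintegral_gt0 d (T : measurableType d) (P : probability T R) (f : T -> R) :
  bounded_measurable f -> (forall x, 0 < f x) -> 0 < \int[P]_x f x.
Proof.
move=> bf f0; have [mf _] := bf.
have I0 : 0 <= \int[P]_x f x by apply: Rintegral_ge0 => x _; exact: ltW.
rewrite lt_neqAle I0 andbT eq_sym; apply/eqP => If0.
have : (\int[P]_x `|(f x)%:E| = 0)%E.
  rewrite -[RHS]/(0%:E) -If0 Rintegral_fineK; last exact: bounded_integrable.
  by apply: eq_integral => x _; rewrite gee0_abs// lee_fin ltW.
move/ae_eq_integral_abs => /(_ measurableT) h.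
have mE : measurable_fun [set: T] (fun x => (f x)%:E) by exact/measurable_EFinP.
have [N [mN N0 subN]] := h mE.
have NT : N = setT.
  rewrite -subTset => x _; apply: subN => /= /(_ Logic.I) [] fx0.
  by have := f0 x; rewrite fx0 ltxx.
have : P setT = 0%E by rewrite -[in LHS]NT; exact: N0.
by rewrite probability_setT => /eqP; rewrite onee_eq0.
Qed.

(** From [z ^+ 2 <= 2 * m ^+ 2 + 2 * (z - m) ^+ 2]; the bound only serves to control tails. *)
Lemma ge0_integral_normal_sqr_le (m s : R) : 0 < s ->
  (\int[mu]_z (normal_pdf m s z * z ^+ 2)%:E <= (2 * (m ^+ 2 + s ^+ 2))%:E)%E.
Proof.
move=> s0; have mg := measurable_normal_pdf m s.
have mz : measurable_fun [set: measurableTypeR R] (fun z => (z - m) ^+ 2).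
  by apply: measurable_funX; exact: measurable_funB.
have mh : measurable_fun [set: measurableTypeR R] (fun z => normal_pdf m s z * (z - m) ^+ 2).
  exact: measurable_funM.
apply: (@le_trans _ _ (\int[mu]_z ((2 * m ^+ 2)%:E * (normal_pdf m s z)%:E +
    2%:E * (normal_pdf m s z * (z - m) ^+ 2)%:E))%E).
  apply: ge0_le_integral => //.
  - by move=> z _; rewrite lee_fin mulr_ge0 ?normal_pdf_ge0 ?sqr_ge0.
  - by apply/measurable_EFinP; apply: measurable_funM => //; exact: measurable_funX.
  - by apply: emeasurable_funD; apply: measurable_funeM; exact/measurable_EFinP.
  - move=> z _; rewrite -!EFinM -EFinD lee_fin -subr_ge0.
    have -> : 2 * m ^+ 2 * normal_pdf m s z + 2 * (normal_pdf m s z * (z - m) ^+ 2) -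
        normal_pdf m s z * z ^+ 2 = normal_pdf m s z * (z - 2 * m) ^+ 2 by ring.
    by rewrite mulr_ge0 ?normal_pdf_ge0 ?sqr_ge0.
have e1 z : (0 <= (normal_pdf m s z)%:E)%E by rewrite lee_fin normal_pdf_ge0.
have e2 z : (0 <= (normal_pdf m s z * (z - m) ^+ 2)%:E)%E.
  by rewrite lee_fin mulr_ge0 ?normal_pdf_ge0 ?sqr_ge0.
have m2 : 0 <= 2 * m ^+ 2 by rewrite mulr_ge0 ?sqr_ge0.
rewrite ge0_integralD//; last 4 first.
- by move=> z _; rewrite mule_ge0.
- by apply: measurable_funeM; exact/measurable_EFinP.
- by move=> z _; rewrite mule_ge0// lee_fin.
- by apply: measurable_funeM; exact/measurable_EFinP.
rewrite !ge0_integralZl//; try exact/measurable_EFinP; try by rewrite lee_fin.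
rewrite integral_normal_pdf ge0_integral_normal_sqr// mule1 -EFinM -EFinD lee_fin.
by rewrite mulrDr.
Qed.

Section swap.
Variables (d : measure_display) (T : measurableType d) (P : probability T R).
Variables (a m b : T -> R) (s : R) (h : measurableTypeR R -> R).
Hypotheses (s0 : 0 < s) (ai : P.-integrable [set: T] (EFin \o a)).
Hypotheses (mm : measurable_fun [set: T] m) (mh : measurable_fun [set: measurableTypeR R] h).
Hypothesis hb : forall w, (\int[mu]_z (normal_pdf (m w) s z * `|h z|)%:E <= (b w)%:E)%E.
Hypothesis abi : P.-integrable [set: T] (EFin \o (fun w => a w * b w)).

Let ma : measurable_fun [set: T] a.
Proof. by apply/measurable_EFinP; case/integrableP: ai. Qed.

Let mab : measurable_fun [set: T] (fun w => a w * b w).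
Proof. by apply/measurable_EFinP; case/integrableP: abi. Qed.

Let F (q : T * measurableTypeR R) := (a q.1 * (normal_pdf (m q.1) s q.2 * h q.2))%:E.

Let mgh : measurable_fun [set: T * measurableTypeR R]
  (fun q => normal_pdf (m q.1) s q.2 * h q.2).
Proof.
apply: measurable_funM; last exact: measurableT_comp mh measurable_snd.
by apply: measurable_normal_pdf3 => //; exact: measurableT_comp mm measurable_fst.
Qed.

Let mF : measurable_fun [set: T * measurableTypeR R] F.
Proof.
apply/measurable_EFinP; apply: measurable_funM => //.
exact: measurableT_comp ma measurable_fst.
Qed.

Let inner w : mu.-integrable [set: measurableTypeR R]
  (EFin \o (fun z => normal_pdf (m w) s z * h z)).
Proof.
have mgw : measurable_fun [set: measurableTypeR R] (fun z => normal_pdf (m w) s z * h z).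
  by apply: measurable_funM => //; exact: measurable_normal_pdf.
apply/integrableP; split; first exact/measurable_EFinP.
apply: le_lt_trans (ltry (b w)); apply: le_trans (hb w).
rewrite le_eqVlt; apply/orP; left; apply/eqP; apply: eq_integral => z _ /=.
by rewrite normrM ger0_norm// normal_pdf_ge0.
Qed.

Let Fi : (P \x mu)%E.-integrable [set: T * measurableTypeR R] F.
Proof.
apply/integrable12ltyP => //; case/integrableP: abi => _.
apply: le_lt_trans; apply: ge0_le_integral => //.
- by move=> w _; exact: integral_ge0.
- apply: (@measurable_fun_fubini_tonelli_F _ _ _ _ _ mu (fun q => `|F q|)%E) => //.
  exact: measurableT_comp.
- by apply/measurable_EFinP; apply: measurableT_comp => //.
- move=> w _; rewrite /F /=.
  have -> : (\int[mu]_y `|a w * (normal_pdf (m w) s y * h y)|%:E)%E =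
      (`|a w|%:E * \int[mu]_y (normal_pdf (m w) s y * `|h y|)%:E)%E.
    rewrite -ge0_integralZl//; last first.
    - by move=> z _; rewrite lee_fin mulr_ge0// normal_pdf_ge0.
    - apply/measurable_EFinP; apply: measurable_funM; first exact: measurable_normal_pdf.
      exact: measurableT_comp.
    apply: eq_integral => z _; rewrite -EFinM !normrM.
    by rewrite (ger0_norm (normal_pdf_ge0 _ _ _)).
  have b0 : 0 <= b w.
    rewrite -lee_fin; apply: le_trans (hb w); apply: integral_ge0 => z _.
    by rewrite lee_fin mulr_ge0// normal_pdf_ge0.
  by rewrite normrM (ger0_norm b0) EFinM lee_wpmul2l// lee_fin.
Qed.

Let bgz z : bounded_measurable (fun w => normal_pdf (m w) s z).
Proof. exact: bounded_normal_pdf. Qed.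

Let GE z : fubini_G P F z = ((\int[P]_w (a w * normal_pdf (m w) s z)) * h z)%:E.
Proof.
have i1 := integrableM_bounded ai (bgz z).
rewrite -RintegralZr// Rintegral_fineK; last first.
  by have := integrableM_bounded i1 (bounded_measurable_cst T (h z)).
by apply: eq_integral => w _; rewrite /F /= mulrA.
Qed.

(** Fubini for weights [a] of either sign and possibly unbounded [h]: [b] dominates the inner
    absolute integrals, and [a * b] is integrable. *)
Lemma integrable_mixture : mu.-integrable [set: measurableTypeR R]
  (EFin \o (fun z => (\int[P]_w (a w * normal_pdf (m w) s z)) * h z)).
Proof.
apply/integrableP; split.
  apply: (eq_measurable_fun (fubini_G P F)) => [z _|]; first by rewrite GE.
  exact: (measurable_fubini_G Fi).
have := (integrable21ltyP P mu mF).1 Fi; apply: le_lt_trans.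
apply: ge0_le_integral => //.
- apply: measurableT_comp => //.
  apply: (eq_measurable_fun (fubini_G P F)) => [z _|]; first by rewrite GE.
  exact: (measurable_fubini_G Fi).
- apply: (@measurable_fun_fubini_tonelli_G _ _ _ _ _ P (fun q => `|F q|)%E) => //.
  exact: measurableT_comp.
- move=> z _ /=; rewrite -[leLHS]abse_EFin -GE; apply: le_abse_integral => //.
  exact: measurableT_comp mF (pair2_measurable z).
Qed.

Lemma Rintegral_mixture :
  \int[P]_w (a w * \int[mu]_z (normal_pdf (m w) s z * h z)) =
  \int[mu]_z ((\int[P]_w (a w * normal_pdf (m w) s z)) * h z).
Proof.
rewrite /Rintegral; congr fine.
transitivity (\int[P]_w fubini_F mu F w)%E.
  apply: eq_integral => w _; rewrite /fubini_F /F /=.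
  under [in RHS]eq_integral do rewrite EFinM.
  rewrite integralZl//; last exact: inner.
  by rewrite EFinM fineK//; exact: integrable_fin_num (inner w).
rewrite integral12_prod_meas1// -integral21_prod_meas1//.
by apply: eq_integral => z _; rewrite GE.
Qed.

End swap.

End smoothing.

(** * The error of posterior sampling *)

Section simulation_error.
Variable R : realType.
Local Notation mu := (@lebesgue_measure R).
Variables (W Y : kspace R) (P1 : probability W R) (P2 : probability Y R).
Variables (T1 : W -> R) (T2 : Y -> R) (e v J1 J2 : R).
Hypotheses (e0 : 0 < e) (v0 : 0 < v).
Hypotheses (mT1 : measurable_fun [set: W] T1) (mT2 : measurable_fun [set: Y] T2).
Hypothesis T1i : P1.-integrable [set: W] (EFin \o (fun w => T1 w ^+ 2)).
Hypothesis T2i : P2.-integrable [set: Y] (EFin \o (fun y => T2 y ^+ 2)).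
Hypothesis T1J : \int[P1]_w T1 w ^+ 2 + e ^+ 2 <= J1.
Hypothesis T2J : \int[P2]_y T2 y ^+ 2 + v ^+ 2 <= J2.

(** The density of [m y] plus Gaussian noise of deviation [s], for [y] of law [P]. *)
Definition smoothed_density d (T : measurableType d) (P : probability T R)
  (m : T -> R) (s z : R) : R := \int[P]_y normal_pdf (m y) s z.

(** Bayes' formula for the conditional mean of [f y], given that the noisy value of [m y] is [z]. *)
Definition posterior d (T : measurableType d) (P : probability T R)
    (m : T -> R) (s : R) (f : T -> R) (z : R) : R :=
  (\int[P]_y (f y * normal_pdf (m y) s z)) / smoothed_density P m s z.

Local Notation q1 := (smoothed_density P1 T1 e).
Local Notation q2 := (smoothed_density P2 T2 v).

Lemma smoothed_density_gt0 d (T : measurableType d) (P : probability T R)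
  (m : T -> R) (s z : R) : 0 < s -> measurable_fun [set: T] m -> 0 < smoothed_density P m s z.
Proof.
move=> s0 mm; apply: Rintegral_gt0; first exact: bounded_normal_pdf.
by move=> y; exact: normal_pdf_gt0.
Qed.

Lemma measurable_smoothed_density (T : kspace R) (P : probability T R) (m : T -> R) (s : R) :
  0 < s -> measurable_fun [set: T] m ->
  measurable_fun [set: measurableTypeR R] (smoothed_density P m s).
Proof.
move=> s0 mm; apply: (@measurable_Rintegral_param R (real_space R) T P
  (fun q => normal_pdf (m q.2) s q.1)).
by apply: measurable_normal_pdf3 => //; exact: measurableT_comp mm measurable_snd.
Qed.

Lemma posterior_mul d (T : measurableType d) (P : probability T R)
    (m : T -> R) (s : R) (f : T -> R) (z : R) : 0 < s -> measurable_fun [set: T] m ->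
  posterior P m s f z * smoothed_density P m s z =
  \int[P]_y (f y * normal_pdf (m y) s z).
Proof. by move=> s0 mm; rewrite divfK// gt_eqF// smoothed_density_gt0. Qed.

Lemma measurable_posterior (T : kspace R) (P : probability T R) (m : T -> R) (s : R) (f : T -> R) :
  0 < s -> measurable_fun [set: T] m -> measurable_fun [set: T] f ->
  measurable_fun [set: measurableTypeR R] (posterior P m s f).
Proof.
move=> s0 mm mf; apply: measurable_funM; last first.
  apply: measurable_invr_ge0; first exact: measurable_smoothed_density.
  by move=> z; exact/ltW/smoothed_density_gt0.
apply: (@measurable_Rintegral_param R (real_space R) T P
  (fun q => f q.2 * normal_pdf (m q.2) s q.1)).
apply: measurable_funM; first exact: measurableT_comp mf measurable_snd.
by apply: measurable_normal_pdf3 => //; exact: measurableT_comp mm measurable_snd.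
Qed.

Lemma posterior01 d (T : measurableType d) (P : probability T R) (m : T -> R) (s : R) (f : T -> R) (z : R) :
  0 < s -> measurable_fun [set: T] m -> measurable_fun [set: T] f ->
  (forall y, 0 <= f y <= 1) -> 0 <= posterior P m s f z <= 1.
Proof.
move=> s0 mm mf f01; have q0 := smoothed_density_gt0 P z s0 mm.
have bf := bounded_measurable01 mf f01.
have bg := bounded_normal_pdf z s0 mm.
rewrite /posterior; apply/andP; split.
  apply: divr_ge0; last exact: ltW.
  by apply: Rintegral_ge0 => y _; rewrite mulr_ge0 ?normal_pdf_ge0//; case/andP: (f01 y).
rewrite ler_pdivrMr// mul1r; apply: le_Rintegral => //.
- by apply: bounded_integrable; exact: bounded_measurableM.
- exact: bounded_integrable.
- by move=> y _; rewrite ler_piMl ?normal_pdf_ge0//; case/andP: (f01 y).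
Qed.

Let T1i1 := integrable_sqr mT1 T1i.
Let cst1 d (T : measurableType d) (P : probability T R) :
  P.-integrable [set: T] (EFin \o (fun=> 1 : R)).
Proof. exact: (bounded_integrable P (bounded_measurable_cst T 1)). Qed.

Variable f : Y -> R.
Hypotheses (mf : measurable_fun [set: Y] f) (f01 : forall y, 0 <= f y <= 1).
Let h := posterior P2 T2 v f.
Let K w := \int[mu]_z (normal_pdf (T1 w) e z * h z).

Let bf : bounded_measurable f. Proof. exact: bounded_measurable01. Qed.

Let h01 z : 0 <= h z <= 1. Proof. exact: posterior01. Qed.

Let mh : measurable_fun [set: measurableTypeR R] h.
Proof. exact: measurable_posterior. Qed.

Let h_le m s : (\int[mu]_z (normal_pdf m s z * `|h z|)%:E <= 1%:E)%E.
Proof.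
rewrite -[leRHS](integral_normal_pdf m s); apply: ge0_le_integral => //.
- by move=> z _; rewrite lee_fin mulr_ge0// normal_pdf_ge0.
- apply/measurable_EFinP; apply: measurable_funM; first exact: measurable_normal_pdf.
  exact: measurableT_comp.
- exact: measurable_normal_pdfE.
- move=> z _; rewrite lee_fin ler_piMr ?normal_pdf_ge0//.
  by have /andP[h0 h1] := h01 z; rewrite ger0_norm.
Qed.

Let scalar1 d (T : measurableType d) (P : probability T R) (a : T -> R) :
  P.-integrable [set: T] (EFin \o a) ->
  P.-integrable [set: T] (EFin \o (fun w => a w * 1)).
Proof. by apply: eq_integrable => // w _ /=; rewrite mulr1. Qed.

(* Against the posterior kernel the law of the second observation, weighted by
   [1] or by the score, is the smoothed density weighted by [1] or by [z]. *)
Let mix1 (a : W -> R) : P1.-integrable [set: W] (EFin \o a) ->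
  mu.-integrable [set: measurableTypeR R]
    (EFin \o (fun z => (\int[P1]_w (a w * normal_pdf (T1 w) e z)) * h z)) /\
  \int[P1]_w (a w * K w) =
  \int[mu]_z ((\int[P1]_w (a w * normal_pdf (T1 w) e z)) * h z).
Proof.
move=> ai; have ab := scalar1 ai.
have hb w := h_le (T1 w) e.
split; first exact: (integrable_mixture e0 ai mT1 mh hb ab).
exact: (Rintegral_mixture e0 ai mT1 mh hb ab).
Qed.

Let fi : P2.-integrable [set: Y] (EFin \o f).
Proof. exact: bounded_integrable. Qed.

Let mix2 : mu.-integrable [set: measurableTypeR R] (EFin \o (fun z => q2 z * h z)) /\
  \int[P2]_y f y = \int[mu]_z (q2 z * h z).
Proof.
have hb w : (\int[mu]_z (normal_pdf (T2 w) v z * `|1|)%:E <= 1%:E)%E.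
  by under eq_integral do rewrite normr1 mulr1; rewrite integral_normal_pdf.
have m1 : measurable_fun [set: measurableTypeR R] (fun=> 1 : R) by exact: measurable_cst.
have E z : (\int[P2]_w (f w * normal_pdf (T2 w) v z)) * 1 = q2 z * h z.
  by rewrite mulr1 mulrC -posterior_mul.
have I := integrable_mixture v0 fi mT2 m1 hb (scalar1 fi).
have S := Rintegral_mixture v0 fi mT2 m1 hb (scalar1 fi).
split; first by apply: eq_integrable I => // z _ /=; rewrite E.
under [RHS]eq_Rintegral do rewrite -E.
rewrite -S; apply: eq_Rintegral => y _.
by under eq_Rintegral do rewrite mulr1; rewrite Rintegral_normal_pdf mulr1.
Qed.

(** Exact because the noise is centred: for fixed [y] the observed value has mean [T2 y]. *)
Let mix2z : mu.-integrable [set: measurableTypeR R] (EFin \o (fun z => z * q2 z * h z)) /\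
  \int[P2]_y (T2 y * f y) = \int[mu]_z (z * q2 z * h z).
Proof.
have hb w : (\int[mu]_z (normal_pdf (T2 w) v z * `|z|)%:E <= (1 + 2 * (T2 w ^+ 2 + v ^+ 2))%:E)%E.
  have mg := measurable_normal_pdf (T2 w) v.
  apply: (@le_trans _ _ (\int[mu]_z ((normal_pdf (T2 w) v z)%:E + (normal_pdf (T2 w) v z * z ^+ 2)%:E))%E).
    apply: ge0_le_integral => //.
    - by move=> z _; rewrite lee_fin mulr_ge0// normal_pdf_ge0.
    - by apply/measurable_EFinP; apply: measurable_funM => //; exact: measurableT_comp.
    - apply: emeasurable_funD; apply/measurable_EFinP => //.
      by apply: measurable_funM => //; exact: measurable_funX.
    - move=> z _; rewrite -EFinD lee_fin -[X in _ <= X + _]mulr1 -mulrDr.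
      rewrite ler_wpM2l ?normal_pdf_ge0// -[z ^+ 2]real_normK ?num_real//.
      move: `|z| => a; have : 0 <= (a - 1) ^+ 2 by exact: sqr_ge0.
      have : 0 <= a ^+ 2 by exact: sqr_ge0.
      lra.
  rewrite ge0_integralD//; last 4 first.
  - by move=> z _; rewrite lee_fin normal_pdf_ge0.
  - exact/measurable_EFinP.
  - by move=> z _; rewrite lee_fin mulr_ge0 ?normal_pdf_ge0 ?sqr_ge0.
  - by apply/measurable_EFinP; apply: measurable_funM => //; exact: measurable_funX.
  by rewrite integral_normal_pdf EFinD leeD2l// ge0_integral_normal_sqr_le.
have fb : P2.-integrable [set: Y] (EFin \o (fun w => f w * (1 + 2 * (T2 w ^+ 2 + v ^+ 2)))).
  have j := integrable_add (bounded_integrable P2 (bounded_measurable_cst Y (1 + 2 * v ^+ 2)))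
    (integrable_scale 2 T2i).
  have := integrableM_bounded j bf.
  by apply: eq_integrable => // y _ /=; congr EFin; ring.
have mid : measurable_fun [set: measurableTypeR R] (fun z : R => z) by exact: measurable_id.
have E z : (\int[P2]_w (f w * normal_pdf (T2 w) v z)) * z = z * q2 z * h z.
  by rewrite -posterior_mul// -/h; ring.
have I := integrable_mixture v0 fi mT2 mid hb fb.
have S := Rintegral_mixture v0 fi mT2 mid hb fb.
split; first by apply: eq_integrable I => // z _ /=; rewrite E.
under [RHS]eq_Rintegral do rewrite -E.
rewrite -S; apply: eq_Rintegral => y _.
by rewrite Rintegral_normal_id// mulrC.
Qed.

Variable delta : R.
Hypothesis q12 : (\int[mu]_z (`|q1 z - q2 z|)%:E <= delta%:E)%E.

Let mq1 : measurable_fun [set: measurableTypeR R] q1.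
Proof. exact: measurable_smoothed_density. Qed.

Let mq2 : measurable_fun [set: measurableTypeR R] q2.
Proof. exact: measurable_smoothed_density. Qed.

Let abs_Rintegral_h (g : measurableTypeR R -> R) c :
  measurable_fun [set: measurableTypeR R] g ->
  mu.-integrable [set: measurableTypeR R] (EFin \o (fun z => g z * h z)) ->
  (\int[mu]_z (`|g z|)%:E <= c%:E)%E -> `|\int[mu]_z (g z * h z)| <= c.
Proof.
move=> mg gi gc; rewrite -lee_fin EFin_normr_Rintegral//.
apply: le_trans (le_abse_integral _ _ _) _ => //; first by case/integrableP: gi.
apply: le_trans gc; apply: ge0_le_integral => //.
- by apply: measurableT_comp => //; case/integrableP: gi.
- by apply/measurable_EFinP; exact: measurableT_comp.
- move=> z _ /=; rewrite lee_fin normrM ler_piMr//.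
  by have /andP[h0 h1] := h01 z; rewrite ger0_norm.
Qed.

(** Both means are integrals of the same [h], with values in [[0, 1]], against [q1] and [q2]. *)
Lemma simulation_error0 : `|\int[P1]_w K w - \int[P2]_y f y| <= delta.
Proof.
have [I1 S1] := mix1 (cst1 P1); have [I2 S2] := mix2.
have q1E z : \int[P1]_w (1 * normal_pdf (T1 w) e z) = q1 z.
  by apply: eq_Rintegral => w _; rewrite mul1r.
have I1' : mu.-integrable [set: measurableTypeR R] (EFin \o (fun z => q1 z * h z)).
  by apply: eq_integrable I1 => // z _ /=; rewrite q1E.
have -> : \int[P1]_w K w = \int[mu]_z (q1 z * h z).
  transitivity (\int[P1]_w (1 * K w)); first by apply: eq_Rintegral => w _; rewrite mul1r.
  by rewrite S1; apply: eq_Rintegral => z _; rewrite q1E.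
rewrite S2 -RintegralB//.
under eq_Rintegral do rewrite -mulrBl.
apply: abs_Rintegral_h => //; first exact: measurable_funB.
by apply: eq_integrable (integrable_sub I1' I2) => // z _ /=; rewrite mulrBl.
Qed.

Let second_moment (T : kspace R) (P : probability T R) (m : T -> R) (s J : R) :
  0 < s -> measurable_fun [set: T] m ->
  P.-integrable [set: T] (EFin \o (fun w => m w ^+ 2)) ->
  \int[P]_w m w ^+ 2 + s ^+ 2 <= J ->
  (\int[mu]_z (smoothed_density P m s z * z ^+ 2)%:E <= (2 * J)%:E)%E.
Proof.
move=> s0 mm m2 mJ.
have mF : measurable_fun [set: T * measurableTypeR R]
    (fun q => (normal_pdf (m q.1) s q.2 * q.2 ^+ 2)%:E).
  apply/measurable_EFinP; apply: measurable_funM.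
    by apply: measurable_normal_pdf3 => //; exact: measurableT_comp mm measurable_fst.
  exact: measurable_funX.
have F0 q : (0 <= (normal_pdf (m q.1) s q.2 * q.2 ^+ 2)%:E)%E.
  by rewrite lee_fin mulr_ge0 ?normal_pdf_ge0 ?sqr_ge0.
have bz z : bounded_measurable (fun w => normal_pdf (m w) s z * z ^+ 2).
  by apply: bounded_measurableM; [exact: bounded_normal_pdf|exact: bounded_measurable_cst].
apply: (@le_trans _ _ (\int[mu]_z \int[P]_w (normal_pdf (m w) s z * z ^+ 2)%:E)%E); last first.
  rewrite -(@fubini_tonelli _ _ _ _ _ P mu (fun q => (normal_pdf (m q.1) s q.2 * q.2 ^+ 2)%:E))//=.
  have j := integrable_add m2 (bounded_integrable P (bounded_measurable_cst T (s ^+ 2))).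
  have j2 := integrable_scale 2 j.
  apply: (@le_trans _ _ (\int[P]_w (2 * (m w ^+ 2 + s ^+ 2))%:E)%E).
    apply: ge0_le_integral => //.
    - by move=> w _; apply: integral_ge0 => z _; rewrite lee_fin mulr_ge0 ?normal_pdf_ge0 ?sqr_ge0.
    - exact: (@measurable_fun_fubini_tonelli_F _ _ _ _ _ mu
        (fun q => (normal_pdf (m q.1) s q.2 * q.2 ^+ 2)%:E)).
    - by case/integrableP: j2.
    - by move=> w _; exact: ge0_integral_normal_sqr_le.
  rewrite -Rintegral_fineK// lee_fin RintegralZl// RintegralD//; last first.
    exact: (bounded_integrable P (bounded_measurable_cst T (s ^+ 2))).
  by rewrite Rintegral_cst1 ler_wpM2l.
rewrite le_eqVlt; apply/orP; left; apply/eqP; apply: eq_integral => z _.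
rewrite -RintegralZr//; last by apply: bounded_integrable; exact: bounded_normal_pdf.
by rewrite Rintegral_fineK//; exact: bounded_integrable.
Qed.

(** Replacing the weight [T1 w] by the observed value costs the mean size of the noise, at most [e].
    The weighted densities [z * q1] and [z * q2] then differ by at most [M * delta] on [|z| <= M],
    and beyond [M] the second moments bound both. *)
Lemma simulation_error1 M : 0 < M ->
  `|\int[P1]_w (T1 w * K w) - \int[P2]_y (T2 y * f y)|
    <= e + M * delta + 2 * (J1 + J2) / M.
Proof.
move=> M0; have [I1 S1] := mix1 T1i1; have [I2 S2] := mix2z.
pose t z := \int[P1]_w (T1 w * normal_pdf (T1 w) e z).
have mt : measurable_fun [set: measurableTypeR R] t.
  apply: (@measurable_Rintegral_param R (real_space R) W P1
    (fun q => T1 q.2 * normal_pdf (T1 q.2) e q.1)).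
  apply: measurable_funM; first exact: measurableT_comp mT1 measurable_snd.
  by apply: measurable_normal_pdf3 => //; exact: measurableT_comp mT1 measurable_snd.
have mzq : measurable_fun [set: measurableTypeR R] (fun z => z * q2 z).
  exact: measurable_funM.
have mzq1 : measurable_fun [set: measurableTypeR R] (fun z => z * q1 z).
  exact: measurable_funM.
rewrite S1 S2 -RintegralB//.
under eq_Rintegral do rewrite -mulrBl.
apply: abs_Rintegral_h; first exact: measurable_funB.
  by apply: eq_integrable (integrable_sub I1 I2) => // z _ /=; rewrite mulrBl.
rewrite -/t.
have part1 : (\int[mu]_z (`|t z - z * q1 z|)%:E <= e%:E)%E.
  pose F (q : W * measurableTypeR R) := (normal_pdf (T1 q.1) e q.2 * `|q.2 - T1 q.1|)%:E.
  have mF : measurable_fun [set: W * measurableTypeR R] F.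
    apply/measurable_EFinP; apply: measurable_funM.
      by apply: measurable_normal_pdf3 => //; exact: measurableT_comp mT1 measurable_fst.
    apply: measurableT_comp => //; apply: measurable_funB => //.
    exact: measurableT_comp mT1 measurable_fst.
  have F0 q : (0 <= F q)%E by rewrite lee_fin mulr_ge0// normal_pdf_ge0.
  apply: (@le_trans _ _ (\int[mu]_z \int[P1]_w F (w, z))%E).
    apply: ge0_le_integral => //.
    - by apply/measurable_EFinP; apply: measurableT_comp => //; exact: measurable_funB.
    - exact: (@measurable_fun_fubini_tonelli_G _ _ _ _ _ P1 F).
    - move=> z _.
      have bz := bounded_normal_pdf z e0 mT1.
      have i1 := integrableM_bounded T1i1 bz.
      have i2 := integrable_scale z (bounded_integrable P1 bz).
      have i12 := integrable_sub i1 i2.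
      have -> : t z - z * q1 z =
          \int[P1]_w (T1 w * normal_pdf (T1 w) e z - z * normal_pdf (T1 w) e z).
        by rewrite RintegralB// RintegralZl//; exact: bounded_integrable.
      apply: (@le_trans _ _ (\int[P1]_w `|T1 w * normal_pdf (T1 w) e z - z * normal_pdf (T1 w) e z|)%:E).
        by rewrite lee_fin le_normr_Rintegral.
      rewrite Rintegral_fineK; last exact: integrable_norm.
      rewrite le_eqVlt; apply/orP; left; apply/eqP; apply: eq_integral => w _.
      rewrite /F /= -mulrBl normrM distrC mulrC.
      by rewrite (ger0_norm (normal_pdf_ge0 _ _ _)).
  rewrite -(@fubini_tonelli _ _ _ _ _ P1 mu F)//=.
  rewrite -[leRHS]mule1 -(probability_setT P1) -integral_cst//.
  apply: ge0_le_integral => //.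
  - by move=> w _; exact: integral_ge0.
  - exact: (@measurable_fun_fubini_tonelli_F _ _ _ _ _ mu F).
  - by move=> w _; rewrite /F /=; exact: ge0_integral_normal_dist.
have q1p z : 0 <= q1 z by exact/ltW/smoothed_density_gt0.
have q2p z : 0 <= q2 z by exact/ltW/smoothed_density_gt0.
have mq1z : measurable_fun [set: measurableTypeR R] (fun z => q1 z * z ^+ 2).
  by apply: measurable_funM => //; exact: measurable_funX.
have mq2z : measurable_fun [set: measurableTypeR R] (fun z => q2 z * z ^+ 2).
  by apply: measurable_funM => //; exact: measurable_funX.
have q1z0 z : (0 <= (q1 z * z ^+ 2)%:E)%E by rewrite lee_fin mulr_ge0 ?sqr_ge0.
have q2z0 z : (0 <= (q2 z * z ^+ 2)%:E)%E by rewrite lee_fin mulr_ge0 ?sqr_ge0.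
have mq : measurable_fun [set: measurableTypeR R] (fun z => `|q1 z - q2 z|).
  by apply: measurableT_comp => //; exact: measurable_funB.
have M0E : (0 <= M%:E)%E by rewrite lee_fin ltW.
have M1E : (0 <= (M^-1)%:E)%E by rewrite lee_fin invr_ge0 ltW.
have part2 : (\int[mu]_z (`|z * q1 z - z * q2 z|)%:E <=
    (M * delta + 2 * (J1 + J2) / M)%:E)%E.
  apply: (@le_trans _ _ (\int[mu]_z (M%:E * (`|q1 z - q2 z|)%:E +
      (M^-1)%:E * ((q1 z * z ^+ 2)%:E + (q2 z * z ^+ 2)%:E)))%E).
    apply: ge0_le_integral => //.
    - by apply/measurable_EFinP; apply: measurableT_comp => //; exact: measurable_funB.
    - apply: emeasurable_funD; apply: measurable_funeM; first exact/measurable_EFinP.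
      by apply: emeasurable_funD; exact/measurable_EFinP.
    - move=> z _; rewrite -?(EFinD, EFinM) lee_fin -mulrBr normrM.
      have q12z : `|q1 z - q2 z| <= q1 z + q2 z.
        by rewrite ler_norml; have := q1p z; have := q2p z; move=> *; apply/andP; split; lra.
      rewrite -mulrDl mulrA.
      have [zM|Mz] := leP `|z| M.
        apply: ler_wpDr; last by rewrite ler_wpM2r.
        by rewrite mulr_ge0 ?sqr_ge0// mulr_ge0 ?invr_ge0 ?addr_ge0// ltW.
      apply: ler_wpDl; first by rewrite mulr_ge0// ltW.
      apply: (@le_trans _ _ (`|z| * (q1 z + q2 z))); first by rewrite ler_wpM2l.
      rewrite mulrC -mulrA mulrCA ler_wpM2l ?addr_ge0//.
      rewrite -[z ^+ 2]real_normK ?num_real// mulrC ler_pdivlMr// expr2 ler_wpM2l//.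
      exact: ltW.
  rewrite ge0_integralD//; last 4 first.
  - by move=> z _; rewrite mule_ge0// lee_fin.
  - by apply: measurable_funeM; exact/measurable_EFinP.
  - by move=> z _; rewrite mule_ge0// adde_ge0.
  - by apply: measurable_funeM; apply: emeasurable_funD; exact/measurable_EFinP.
  rewrite ge0_integralZl//; last exact/measurable_EFinP.
  rewrite ge0_integralZl//; last 2 first.
  - by apply: emeasurable_funD; exact/measurable_EFinP.
  - by move=> z _; rewrite adde_ge0.
  rewrite (ge0_integralD mu measurableT (f1 := fun z => (q1 z * z ^+ 2)%:E))//; last 2 first.
  - exact/measurable_EFinP.
  - exact/measurable_EFinP.
  rewrite EFinD EFinM leeD//; first by rewrite lee_wpmul2l.
  have -> : 2 * (J1 + J2) / M = M^-1 * (2 * J1 + 2 * J2) by ring.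
  by rewrite EFinM EFinD lee_wpmul2l// leeD// second_moment.
rewrite -addrA EFinD; apply: le_trans (leeD part1 part2).
rewrite -ge0_integralD//.
- apply: ge0_le_integral => //.
  + by apply/measurable_EFinP; apply: measurableT_comp => //; exact: measurable_funB.
  + apply: emeasurable_funD; apply/measurable_EFinP; apply: measurableT_comp => //; exact: measurable_funB.
  + by move=> z _; rewrite -EFinD lee_fin -[t z - z * q2 z](subrKA (z * q1 z)) ler_normD.
- by apply/measurable_EFinP; apply: measurableT_comp => //; exact: measurable_funB.
- by apply/measurable_EFinP; apply: measurableT_comp => //; exact: measurable_funB.
Qed.

End simulation_error.

(** * Posterior sampling as a channel *)

Section simulation_channel.
Variable R : realType.
Local Notation mu := (@lebesgue_measure R).
Variables (W X Y : kspace R) (k : channel X Y) (g : W -> X) (T1 : W -> R).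
Variables (T2 : X * Y -> R) (e : R) (V : X -> R).
Hypotheses (mg : measurable_fun [set: W] g) (mT1 : measurable_fun [set: W] T1).
Hypotheses (mT2 : measurable_fun [set: X * Y] T2) (mV : measurable_fun [set: X] V).
Hypotheses (e0 : 0 < e) (V0 : forall x, 0 < V x).

Let q x z := smoothed_density (output k x) (fun y => T2 (x, y)) (V x) z.

Let mT2x x : measurable_fun [set: Y] (fun y => T2 (x, y)).
Proof. exact: measurableT_comp mT2 (pair1_measurable x). Qed.

Let q0 x z : 0 < q x z. Proof. exact: smoothed_density_gt0. Qed.

Let mq : measurable_fun [set: prod_space X (real_space R)] (fun p => q p.1 p.2).
Proof.
apply: (measurable_Rintegral_kernel (kpull (@measurable_fst _ _ X (real_space R)) k)
  (f := fun p => normal_pdf (T2 (p.1.1, p.2)) (V p.1.1) p.1.2)).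
apply: measurable_normal_pdf3 => //.
- apply: (measurableT_comp mT2); apply: measurable_fun_pair => //.
  exact: measurableT_comp measurable_fst measurable_fst.
- apply: (measurableT_comp mV); exact: measurableT_comp measurable_fst measurable_fst.
- exact: measurableT_comp measurable_snd measurable_fst.
Qed.

(** The density, relative to [k (g w)], of the posterior law of [y], averaged over the noisy value
    [z] of [T1 w]. The map [g] extracts from [w] the input on which the posterior depends. *)
Definition simulation_density (p : W * Y) : \bar R :=
  (\int[mu]_z (normal_pdf (T1 p.1) e z *
     (normal_pdf (T2 (g p.1, p.2)) (V (g p.1)) z / q (g p.1) z))%:E)%E.

Let F (r : (W * Y) * measurableTypeR R) :=
  (normal_pdf (T1 r.1.1) e r.2 *
     (normal_pdf (T2 (g r.1.1, r.1.2)) (V (g r.1.1)) r.2 / q (g r.1.1) r.2)).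

Let mF : measurable_fun [set: (W * Y) * measurableTypeR R] F.
Proof.
have m11 : measurable_fun [set: (W * Y) * measurableTypeR R] (fun r => r.1.1).
  exact: measurableT_comp measurable_fst measurable_fst.
have m12 : measurable_fun [set: (W * Y) * measurableTypeR R] (fun r => r.1.2).
  exact: measurableT_comp measurable_snd measurable_fst.
have mg1 : measurable_fun [set: (W * Y) * measurableTypeR R] (fun r => g r.1.1).
  exact: measurableT_comp mg m11.
apply: measurable_funM.
  by apply: measurable_normal_pdf3 => //; exact: measurableT_comp mT1 m11.
apply: measurable_funM.
  apply: measurable_normal_pdf3 => //.
    by apply: (measurableT_comp mT2); exact: measurable_fun_pair.
  exact: measurableT_comp mV mg1.
apply: measurable_invr_ge0; last by move=> r; exact: ltW.
apply: (measurableT_comp (f := fun p => q p.1 p.2) (g := fun r => (g r.1.1, r.2))) => //.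
exact: measurable_fun_pair.
Qed.

Let F0 r : 0 <= F r.
Proof. by rewrite mulr_ge0 ?normal_pdf_ge0// divr_ge0 ?normal_pdf_ge0// ltW. Qed.

Lemma measurable_simulation_density :
  measurable_fun [set: W * Y] simulation_density.
Proof.
apply: (@measurable_fun_fubini_tonelli_F _ _ _ _ _ mu (fun r => (F r)%:E)) => //.
exact/measurable_EFinP.
Qed.

Lemma simulation_density_ge0 p : (0 <= simulation_density p)%E.
Proof. by apply: integral_ge0 => z _; rewrite lee_fin (F0 (p, z)). Qed.

Let integral_simulation_density w (f : Y -> R) :
  measurable_fun [set: Y] f -> (forall y, 0 <= f y <= 1) ->
  (\int[output k (g w)]_y ((f y)%:E * simulation_density (w, y)) =
   \int[mu]_z (normal_pdf (T1 w) e z *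
     posterior (output k (g w)) (fun y => T2 (g w, y)) (V (g w)) f z)%:E)%E.
Proof.
move=> mf f01; have bf := bounded_measurable01 mf f01.
have f0 y : 0 <= f y by case/andP: (f01 y).
pose H (p : Y * measurableTypeR R) := f p.1 * F ((w, p.1), p.2).
have mH : measurable_fun [set: Y * measurableTypeR R] (fun p => (H p)%:E).
  apply/measurable_EFinP; apply: measurable_funM; first exact: measurableT_comp mf measurable_fst.
  apply: (measurableT_comp mF); apply: measurable_fun_pair => //.
  exact: measurable_fun_pair.
have mFz y : measurable_fun [set: measurableTypeR R] (fun z => F ((w, y), z)).
  exact: measurableT_comp mF (pair1_measurable (w, y)).
transitivity (\int[output k (g w)]_y \int[mu]_z (H (y, z))%:E)%E.
  apply: eq_integral => y _; rewrite -ge0_integralZl//.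
  - by apply/measurable_EFinP; exact: (mFz y).
  - by move=> z _; rewrite lee_fin (F0 ((w, y), z)).
  - by rewrite lee_fin.
have H0 p : (0 <= (H p)%:E)%E by rewrite lee_fin mulr_ge0.
transitivity (\int[mu]_z \int[output k (g w)]_y (H (y, z))%:E)%E.
  exact: (@fubini_tonelli _ _ _ _ _ (output k (g w)) mu _ mH H0).
apply: eq_integral => z _.
have bk : bounded_measurable (fun y => f y * normal_pdf (T2 (g w, y)) (V (g w)) z).
  by apply: bounded_measurableM => //; exact: bounded_normal_pdf.
have bi := bounded_integrable (output k (g w)) bk.
have -> : normal_pdf (T1 w) e z *
     posterior (output k (g w)) (fun y => T2 (g w, y)) (V (g w)) f z =
    \int[output k (g w)]_y ((normal_pdf (T1 w) e z / q (g w) z) *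
      (f y * normal_pdf (T2 (g w, y)) (V (g w)) z)).
  by rewrite RintegralZl// /posterior -/(q (g w) z); ring.
rewrite Rintegral_fineK; last exact: integrable_scale.
by apply: eq_integral => y _; congr EFin; rewrite /H /F /=; ring.
Qed.

Lemma integral_simulation_density1 w :
  (\int[kpull mg k w]_y simulation_density (w, y) = 1)%E.
Proof.
have m1 : measurable_fun [set: Y] (fun=> 1 : R) by exact: measurable_cst.
have f01 (y : Y) : 0 <= (1 : R) <= 1 by rewrite ler01 lexx.
transitivity (\int[output k (g w)]_y (1%:E * simulation_density (w, y)))%E.
  by apply: eq_integral => y _; rewrite mul1e.
rewrite (integral_simulation_density w m1 f01) -(integral_normal_pdf (T1 w) e).
apply: eq_integral => z _; congr EFin; rewrite -[RHS]mulr1; congr (_ * _).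
rewrite /posterior; under eq_Rintegral do rewrite mul1r.
by rewrite divff// gt_eqF// q0.
Qed.

(* [w] is sent to [T1 w] plus Gaussian noise of deviation [e], then to the
   posterior of [y] under [k (g w)] given that value for [T2 (g w, y)] plus
   Gaussian noise of deviation [V (g w)]. *)
Definition simulation_channel : channel W Y :=
  density_channel measurable_simulation_density simulation_density_ge0
    integral_simulation_density1.

Lemma simulation_channelE w (f : Y -> R) :
  measurable_fun [set: Y] f -> (forall y, 0 <= f y <= 1) ->
  \int[simulation_channel w]_y f y =
  \int[mu]_z (normal_pdf (T1 w) e z *
     posterior (output k (g w)) (fun y => T2 (g w, y)) (V (g w)) f z).
Proof.
move=> mf f01; rewrite {1 2}/Rintegral integral_density_channel//.
- by congr fine; exact: integral_simulation_density.
- by move=> y; rewrite lee_fin; case/andP: (f01 y).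
- exact/measurable_EFinP.
Qed.

End simulation_channel.

(** * The Gaussian shift as local channel data *)

Section gaussian_tangent.
Variable R : realType.
Local Notation mu := (@lebesgue_measure R).
Local Notation gauss := (output (gaussian R) tt).

Lemma integral_gaussian (F : real_space R -> \bar R) : (forall u, (0 <= F u)%E) ->
  measurable_fun [set: real_space R] F ->
  (\int[gaussian R tt]_u F u = \int[mu]_u (F u * (normal_pdf 0 1 u)%:E))%E.
Proof.
move=> F0 mF; have g0 u : (0 <= (normal_pdf 0 1 u : R)%:E)%E by rewrite lee_fin normal_pdf_ge0.
have mg : measurable_fun [set: measurableTypeR R] (fun u => (normal_pdf 0 1 u)%:E).
  exact: measurable_normal_pdfE.
by rewrite -(integral_density mu mg g0).
Qed.

(* The density of a law whose difference with its mirror image is [2 * x]. *)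
Definition tilt (s : R) (p : point_space R * real_space R) : R := (p.2 + s) ^+ 2 / 2.

Let measurable_tilt s : measurable_fun [set: point_space R * real_space R] (fun p => (tilt s p)%:E).
Proof.
apply/measurable_EFinP; apply: measurable_funM => //; apply: measurable_funX.
by apply: measurable_funD => //; exact: measurable_snd.
Qed.

Let tilt_ge0 s p : (0 <= (tilt s p)%:E)%E.
Proof. by rewrite lee_fin divr_ge0// sqr_ge0. Qed.

Let measurable_tilt1 s : measurable_fun [set: real_space R] (fun u => (tilt s (tt, u))%:E).
Proof. exact: measurableT_comp (measurable_tilt s) (pair1_measurable tt). Qed.

Let tilt_pdfE (s u : R) : normal_pdf 0 1 u * tilt s (tt, u) =
  2^-1 * (normal_pdf 0 1 u * (u - 0) ^+ 2 + ((2 * s) * (normal_pdf 0 1 u * u) + s ^+ 2 * normal_pdf 0 1 u)).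
Proof. by rewrite /tilt /=; field. Qed.

Let integrable_tilt_pdf s : mu.-integrable [set: measurableTypeR R]
  (EFin \o (fun u => normal_pdf 0 1 u * tilt s (tt, u))).
Proof.
have i1 := integrable_normal_sqr (0 : R) (@ltr01 R).
have i2 := integrable_normal_id (0 : R) (@ltr01 R).
have i3 := integrable_normal_pdf (0 : R) 1.
have := integrable_scale 2^-1 (integrable_add i1
  (integrable_add (integrable_scale (2 * s) i2) (integrable_scale (s ^+ 2) i3))).
by apply: eq_integrable => // u _; rewrite [in RHS]/comp tilt_pdfE.
Qed.

(** Under the standard Gaussian [(u + s) ^+ 2 / 2] has mean [(1 + s ^+ 2) / 2], so [s = 1] and
    [s = -1] give probability laws. *)
Let Rintegral_tilt_pdf s : s ^+ 2 = 1 -> \int[mu]_u (normal_pdf 0 1 u * tilt s (tt, u)) = 1.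
Proof.
move=> s1.
have i1 := integrable_normal_sqr (0 : R) (@ltr01 R).
have i2 := integrable_normal_id (0 : R) (@ltr01 R).
have i3 := integrable_normal_pdf (0 : R) 1.
have j2 := integrable_scale (2 * s) i2; have j3 := integrable_scale (s ^+ 2) i3.
have j := integrable_add j2 j3.
under eq_Rintegral do rewrite tilt_pdfE.
rewrite RintegralZl//; last exact: integrable_add i1 j.
rewrite RintegralD// RintegralD// RintegralZl// RintegralZl//.
rewrite Rintegral_normal_id// Rintegral_normal_pdf.
have -> : \int[mu]_z (normal_pdf 0 1 z * (z - 0) ^+ 2) = 1 :> R.
  by apply: ge0_Rintegral_fineK; rewrite ge0_integral_normal_sqr// expr1n.
by rewrite s1; field.
Qed.

Let integral_tilt s x : s ^+ 2 = 1 -> (\int[gaussian R x]_u (tilt s (x, u))%:E = 1)%E.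
Proof.
case: x => s1; rewrite integral_gaussian//; apply/esym.
transitivity (\int[mu]_u (normal_pdf 0 1 u * tilt s (tt, u)))%:E; first by rewrite Rintegral_tilt_pdf.
rewrite /Rintegral fineK; last exact: (integrable_fin_num _ (integrable_tilt_pdf s)).
by apply: eq_integral => u _; rewrite EFinM muleC.
Qed.

Let tilt_channel s (s1 : s ^+ 2 = 1) : channel (point_space R) (real_space R) :=
  density_channel (measurable_tilt s) (tilt_ge0 s) (fun x => integral_tilt x s1).

Let sqr1 : (1 : R) ^+ 2 = 1. Proof. exact: expr1n. Qed.
Let sqrN1 : (-1 : R) ^+ 2 = 1. Proof. by rewrite sqrrN expr1n. Qed.

(** A tangent vector has to be a multiple of a difference of channels; half the difference of the
    two tilted laws has density [u] relative to the Gaussian. *)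
Definition gaussian_shift : tangent (point_space R) (real_space R) :=
  Tangent 2^-1 (tilt_channel sqr1) (tilt_channel sqrN1).

Let integrable_tilt s : s ^+ 2 = 1 ->
  gauss.-integrable [set: real_space R] (EFin \o (fun u => tilt s (tt, u))).
Proof.
move=> s1; apply: (integrable_ge0_fin (c := 1)).
- by have h := measurable_tilt1 s; exact/measurable_EFinP.
- by move=> u; have := tilt_ge0 s (tt, u); rewrite lee_fin.
- by have := integral_tilt tt s1 => ->.
Qed.

Let tilt_sub u : 2^-1 * (tilt 1 (tt, u) - tilt (-1) (tt, u)) = u.
Proof. by rewrite /tilt /=; field. Qed.

Lemma integrable_gaussian_id : gauss.-integrable [set: real_space R] (EFin \o (fun u : R => u)).
Proof.
have := integrable_scale 2^-1 (integrable_sub (integrable_tilt sqr1) (integrable_tilt sqrN1)).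
by apply: eq_integrable => // u _; congr EFin; exact: tilt_sub.
Qed.

Lemma integral_gaussian_sqr : (\int[gauss]_u (u ^+ 2)%:E = 1)%E.
Proof.
transitivity (\int[gaussian R tt]_u (u ^+ 2)%:E)%E; first by [].
rewrite integral_gaussian//; last 2 first.
- by move=> u; rewrite lee_fin sqr_ge0.
- by apply/measurable_EFinP; exact: measurable_funX.
transitivity ((1 ^+ 2)%:E : \bar R); last by rewrite expr1n.
rewrite -(ge0_integral_normal_sqr (0 : R) ltr01).
by apply: eq_integral => u _; rewrite subr0 EFinM muleC.
Qed.

Let shiftE (A : set (real_space R)) : measurable A ->
  (gaussian_shift tt A = \int[gauss]_(u in A) u%:E)%E.
Proof.
move=> mA; rewrite tangentE.
have i1 := integrableS measurableT mA (@subsetT _ A) (integrable_tilt sqr1).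
have i2 := integrableS measurableT mA (@subsetT _ A) (integrable_tilt sqrN1).
transitivity (2^-1%:E * (\int[gauss]_(u in A) (tilt 1 (tt, u))%:E - \int[gauss]_(u in A) (tilt (-1) (tt, u))%:E))%E => //.
rewrite -integralB_EFin// -integralZl//; last exact: integrableB.
by apply: eq_integral => u _; rewrite -EFinB -EFinM tilt_sub.
Qed.

Lemma is_gaussian_shift_gaussian_shift : is_gaussian_shift gaussian_shift.
Proof.
move=> A mA; rewrite tangentE.
have h s (s1 : s ^+ 2 = 1) : (tilt_channel s1 tt A =
    \int[mu]_(u in A) (normal_pdf 0 1 u * tilt s (tt, u))%:E)%E.
  transitivity (\int[gaussian R tt]_(u in A) (tilt s (tt, u))%:E)%E => //.
  rewrite integral_mkcond epatch_indic integral_gaussian.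
  - rewrite [RHS]integral_mkcond epatch_indic.
    by apply: eq_integral => u _; rewrite EFinM muleAC (muleC (_%:E) (normal_pdf _ _ _)%:E).
  - by move=> u; rewrite mule_ge0// lee_fin.
  - apply: emeasurable_funM => //; apply/measurable_EFinP; exact: measurable_indic.
have i s := integrableS measurableT mA (@subsetT _ A) (integrable_tilt_pdf s).
rewrite !h.
transitivity (2^-1%:E * (\int[mu]_(u in A) (normal_pdf 0 1 u * tilt 1 (tt, u))%:E
  - \int[mu]_(u in A) (normal_pdf 0 1 u * tilt (-1) (tt, u))%:E))%E => //.
have i1 := i 1; have i2 := i (-1).
rewrite -integralB_EFin// -integralZl//; last exact: integrableB.
apply: eq_integral => u _; rewrite -EFinB -EFinM; congr EFin.
by rewrite -mulrBr mulrCA tilt_sub mulrC.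
Qed.

Lemma score_gaussian_shift c :
  is_score (gaussian R) (scale_tangent c gaussian_shift) (fun p => c * p.2).
Proof.
have m2 : measurable_fun [set: real_space R] (fun u : R => u ^+ 2) by exact: measurable_funX.
split => [|[]|[] f bf].
- by apply: measurable_funM => //; exact: measurable_snd.
- have i : gauss.-integrable [set: real_space R] (EFin \o (fun u : R => u ^+ 2)).
    apply: (integrable_ge0_fin (c := 1)) => //; first by move=> u; exact: sqr_ge0.
    by rewrite integral_gaussian_sqr.
  have := integrable_scale (c ^+ 2) i.
  by apply: eq_integrable => // u _ /=; rewrite exprMn.
- rewrite texp_scale (@texp_charge _ _ _ gaussian_shift tt gauss (fun u => u))//.
  + rewrite -RintegralZl//; last exact: integrableM_bounded integrable_gaussian_id bf.
    by apply: eq_Rintegral => u _; rewrite mulrA.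
  + exact: integrable_gaussian_id.
Qed.

Lemma Rintegral_score_gaussian_shift c x : \int[gaussian R x]_u (c * u) ^+ 2 = c ^+ 2.
Proof.
case: x; apply: ge0_Rintegral_fineK.
under eq_integral do rewrite exprMn EFinM.
rewrite ge0_integralZl//.
- by rewrite (_ : \int[_]_x _ = 1)%E ?mule1//; exact: integral_gaussian_sqr.
- by apply/measurable_EFinP; exact: measurable_funX.
- by move=> u _; rewrite lee_fin sqr_ge0.
- by rewrite lee_fin sqr_ge0.
Qed.

Lemma local_data_gaussian_shift c : local_data (gaussian R) (scale_tangent c gaussian_shift).
Proof.
apply: (fisher_bound_local_data (c := c ^+ 2)).
apply: (score_fisher_bound (score_gaussian_shift c)) => x.
by rewrite (Rintegral_score_gaussian_shift c x).
Qed.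

(** (N0) fixes the value at [c = 1], and homogeneity of the norm gives the others. *)
Lemma metric_gaussian_shift (G : channel_functional R) c :
  is_metric G -> axiom_N0 G ->
  G _ _ (gaussian R) (scale_tangent c gaussian_shift) = c ^+ 2.
Proof.
move=> Gm N0; have ld := local_data_gaussian_shift c.
have ld1 : local_data (gaussian R) gaussian_shift.
  apply: (fisher_bound_local_data (c := 1)) => x f bf.
  have := score_fisher_bound (c := 1) (score_gaussian_shift 1) _ x bf; rewrite texp_scale mul1r; apply.
  by move=> z; rewrite (Rintegral_score_gaussian_shift 1 z) expr1n.
have := metric_scale Gm c ld1; rewrite (N0 _ is_gaussian_shift_gaussian_shift) sqrtr1 mulr1.
move=> /(congr1 (fun r => r ^+ 2)); rewrite sqr_sqrtr ?real_normK ?num_real//.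
exact: (metric_ge0 Gm ld).
Qed.

End gaussian_tangent.

(** * The two asymptotic bounds *)

Section sixteenth_root.
Variable R : realType.

(* With noise of width [root16 n ^- 2] and steps of order [root16 n ^- 8], all
   error terms are [O(1 / root16 n)]. *)
Definition root16 n : R := Num.sqrt (Num.sqrt (Num.sqrt (Num.sqrt n.+1%:R))).

Lemma root16_ge1 n : 1 <= root16 n.
Proof.
have s1 (x : R) : 1 <= x -> 1 <= Num.sqrt x.
  by move=> x1; rewrite -[leLHS]sqrtr1 ler_wsqrtr.
by do 4 apply: (s1); rewrite ler1n.
Qed.

Lemma root16_gt0 n : 0 < root16 n.
Proof. exact: lt_le_trans (root16_ge1 n). Qed.

Lemma root16X8 n : root16 n ^+ 8 = Num.sqrt n.+1%:R.
Proof. by rewrite (exprM _ 2 4) (exprM _ 2 2) !sqr_sqrtr// ?sqrtr_ge0. Qed.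

Lemma root16X16 n : root16 n ^+ 16 = n.+1%:R.
Proof. by rewrite (exprM _ 8 2) root16X8 sqr_sqrtr. Qed.

Lemma cvg_root16V c : c / root16 n @[n --> \oo] --> 0.
Proof.
rewrite -(mulr0 c); apply: cvgM; first exact: cvg_cst.
apply/gtr0_cvgV0; first by apply: nearW => n; exact: root16_gt0.
apply/cvgryPge => A; near=> n.
rewrite leNgt; apply/negP => rA.
suff : (n.+1%:R : R) < n%:R by rewrite ltr_nat ltnNge leqnSn.
rewrite -root16X16; apply: (@lt_le_trans _ _ (A ^+ 16)).
  have r0 := root16_gt0 n; have A0 := lt_trans r0 rA.
  by rewrite ltrXn2r// ?nnegrE ltW.
by near: n; exact: nbhs_infty_ger.
Unshelve. all: by end_near. Qed.

End sixteenth_root.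

(** * Comparison through (A) and (C) *)

Section asymptotic_bound.
Variables (R : realType) (G : channel_functional R).

Lemma limn_einf_le (u v : nat -> R) (l : R) : (forall n, u n <= v n) ->
  v n @[n --> \oo] --> l -> (limn_einf (fun n => (u n)%:E) <= l%:E)%E.
Proof.
move=> uv vl; rewrite limn_einf_lim.
have vlE : (v n)%:E @[n --> \oo] --> l%:E by apply: cvg_EFin => //; exact: nearW.
rewrite -(cvg_lim _ vlE)//; apply: lee_lim; first exact: is_cvg_einfs.
  by apply/cvg_ex; exists l%:E.
apply: nearW => n; apply: (@le_trans _ _ (u n)%:E); last by rewrite lee_fin.
by apply: ereal_inf_lbound; exists n => //=.
Qed.

(** (C) makes the lower limit of [b_ n - G (channel_pow Phi n) (tangent_pow Phi D n) / n.+1]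
    nonnegative, and by (A) that limit is [b - G Phi D]. Both bounds are obtained in this way. *)
Lemma metric_le_approx (X Y : kspace R) (Phi : channel X Y) (D : tangent X Y)
    (Phi_ : forall n, channel (space_pow X n) (space_pow Y n))
    (D_ : forall n, tangent (space_pow X n) (space_pow Y n)) (c b : R) (b_ : nat -> R) :
  axiom_A G -> axiom_C G -> local_data Phi D ->
  (forall n, local_data (Phi_ n) (D_ n)) ->
  (\forall n \near \oo, forall x (f : space_pow Y n -> R),
    measurable_fun [set: space_pow Y n] f -> (forall y, 0 <= f y <= 1) ->
    `|\int[Phi_ n x]_y f y - \int[channel_pow Phi n x]_y f y| <= c / root16 R n /\
    `|texp (D_ n) x f - texp (tangent_pow Phi D n) x f| <=
      Num.sqrt n.+1%:R * (c / root16 R n)) ->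
  b_ n @[n --> \oo] --> b -> (forall n, n.+1%:R^-1 * G (Phi_ n) (D_ n) <= b_ n) ->
  G Phi D <= b.
Proof.
move=> A C ld ld_ H bb Gb; rewrite -subr_ge0 -lee_fin.
have s0 n : 0 < Num.sqrt n.+1%:R :> R by rewrite sqrtr_gt0.
apply: le_trans (C _ _ Phi D Phi_ D_ ld ld_ _ _) _.
- apply: (cvg_cb_norm (cvg_root16V c)); apply: filterS H => n H x f mf f01.
  by rewrite texp_diff_channel; have [] := H x f mf f01.
- apply: (@squeeze_cvge _ _ _ _ (fun=> 0%E) _ (fun n => (2 * (c / root16 R n))%:E)).
  + apply: filterS H => n H; apply/andP; split.
      by rewrite mule_ge0 ?cb_norm_ge0// lee_fin invr_ge0 ltW.
    apply: (@le_trans _ _ (((Num.sqrt n.+1%:R)^-1)%:E * (2 * (Num.sqrt n.+1%:R * (c / root16 R n)))%:E)%E).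
      rewrite lee_wpmul2l ?lee_fin ?invr_ge0 ?sqrtr_ge0//; apply: cb_norm_le => x f mf f01.
      rewrite texp_sub; last exact: bounded_measurable01.
      by have [] := H x f mf f01.
    by rewrite -EFinM lee_fin mulrCA mulKf// gt_eqF.
  + exact: cvg_cst.
  + apply: cvg_EFin; first exact: nearW.
    by rewrite -(mulr0 2); apply: cvgM; [exact: cvg_cst|exact: cvg_root16V].
apply: (limn_einf_le (v := fun n => b_ n -
  n.+1%:R^-1 * G (channel_pow Phi n) (tangent_pow Phi D n))) => [n|]; first by rewrite mulrBr lerB.
by apply: cvgB => //; exact: A.
Qed.
End asymptotic_bound.

(** * Rates *)

Section rates.
Variable R : realType.
Local Notation mu := (@lebesgue_measure R).

Definition noise n : R := (root16 R n ^+ 2)^-1.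

Lemma noise_gt0 n : 0 < noise n.
Proof. by rewrite invr_gt0 exprn_gt0// root16_gt0. Qed.

Lemma noise_le n : noise n <= (root16 R n)^-1.
Proof.
rewrite lef_pV2 ?posrE ?exprn_gt0 ?root16_gt0//.
by rewrite expr2 ler_peMr ?root16_ge1// ltW// root16_gt0.
Qed.

Lemma noise_sqr_le1 n : noise n ^+ 2 <= 1.
Proof.
rewrite expr_le1 ?(ltW (noise_gt0 n))//; apply: le_trans (noise_le n) _.
by rewrite invf_le1 ?root16_gt0// root16_ge1.
Qed.

(** The three summands of [c] come from the noise, from the distance of the smoothed densities and
    from the tails, in this order. *)
Lemma simulation_bounds n (W Y : kspace R) (P1 : probability W R) (P2 : probability Y R)
    (T1 : W -> R) (T2 : Y -> R) (v B J : R) (f : Y -> R) :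
  0 < v -> 0 <= B -> 0 <= J ->
  measurable_fun [set: W] T1 -> measurable_fun [set: Y] T2 ->
  P1.-integrable [set: W] (EFin \o (fun w => T1 w ^+ 2)) ->
  P2.-integrable [set: Y] (EFin \o (fun y => T2 y ^+ 2)) ->
  \int[P1]_w T1 w ^+ 2 + noise n ^+ 2 <= J + 1 ->
  \int[P2]_y T2 y ^+ 2 + v ^+ 2 <= J + 1 ->
  (\int[mu]_z (`|smoothed_density P1 T1 (noise n) z - smoothed_density P2 T2 v z|)%:E
     <= (2 * B ^+ 3 * noise n)%:E)%E ->
  measurable_fun [set: Y] f -> (forall y, 0 <= f y <= 1) ->
  let K w := \int[mu]_z (normal_pdf (T1 w) (noise n) z * posterior P2 T2 v f z) in
  let c := 1 + 2 * B ^+ 3 + 4 * (J + 1) in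
  `|\int[P1]_w K w - \int[P2]_y f y| <= c / root16 R n /\
  `|\int[P1]_w (T1 w * K w) - \int[P2]_y (T2 y * f y)| <= c / root16 R n.
Proof.
move=> v0 B0 J0 mT1 mT2 i1 i2 h1 h2 q mf f01 K c.
have e0 := noise_gt0 n; have r0 := root16_gt0 R n; have r1 := root16_ge1 R n.
have e1 := noise_le n; have B3 : 0 <= 2 * B ^+ 3 by rewrite mulr_ge0// exprn_ge0.
have ri0 : 0 <= (root16 R n)^-1 by rewrite invr_ge0 ltW.
have Bn : 2 * B ^+ 3 * noise n <= 2 * B ^+ 3 / root16 R n by rewrite ler_wpM2l.
split.
  apply: le_trans (simulation_error0 e0 v0 mT1 mT2 mf f01 q) _.
  apply: le_trans Bn _; rewrite ler_wpM2r//; rewrite /c; lra.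
(* The truncation level is [root16 R n]: it loses one of the two powers in [noise] and leaves a tail
   of order [1 / root16 R n]. *)
apply: le_trans (simulation_error1 e0 v0 mT1 mT2 i1 i2 h1 h2 mf f01 q r0) _.
have -> : root16 R n * (2 * B ^+ 3 * noise n) = 2 * B ^+ 3 / root16 R n.
  by rewrite /noise; field; rewrite gt_eqF.
have -> : 2 * (J + 1 + (J + 1)) / root16 R n = 4 * (J + 1) / root16 R n.
  by congr (_ / _); ring.
rewrite /c !mulrDl mul1r; lra.
Qed.

(** With [r = root16 R n] there are [r ^+ 16] replacement steps, each on a summand bounded by
    [B / r ^+ 8] at width at least [1 / r ^+ 2]. Their total cost [r ^+ 16 * 2 * (B / r ^+ 6) ^+ 3]
    is [2 * B ^+ 3 * noise]. *)
Lemma smoothed_score_pow (X Y : kspace R) (Phi : channel X Y) (D : tangent X Y) l B :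
  is_score Phi D l -> 0 < B -> (forall p, `|l p| <= B) ->
  \forall n \near \oo, forall (x : space_pow X n) v, noise n <= v ->
  (\int[mu]_z (`|smoothed_density (output (channel_pow Phi n) x)
       (fun y => (Num.sqrt n.+1%:R)^-1 * score_pow l n (x, y)) v z
     - normal_pdf 0 (Num.sqrt (v ^+ 2 + n.+1%:R^-1 *
         variance_pow (fun x => \int[Phi x]_y l (x, y) ^+ 2) n x)) z|)%:E
   <= (2 * B ^+ 3 * noise n)%:E)%E.
Proof.
move=> Dl B0 lB; near=> n => x v nv.
set a := (Num.sqrt n.+1%:R)^-1.
have s0 : 0 < Num.sqrt n.+1%:R :> R by rewrite sqrtr_gt0.
have a0 : 0 < a by rewrite invr_gt0.
have aE : a ^+ 2 = n.+1%:R^-1 by rewrite /a exprVn sqr_sqrtr.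
have r0 := root16_gt0 R n; have r1 := root16_ge1 R n.
have -> : 2 * B ^+ 3 * noise n = n.+1%:R * (2 * (a * B / noise n) ^+ 3).
  by rewrite /a -root16X8 -(root16X16 R n) /noise; field; rewrite gt_eqF.
rewrite -aE; apply: telescoping nv => //.
- exact: score_measurable Dl.
- exact: noise_gt0.
- by move=> x'; apply: Rintegral_ge0 => y _; exact: sqr_ge0.
move=> x' t w nw.
have w0 : 0 < w by exact: lt_le_trans (noise_gt0 n) nw.
have mlx := score_measurable1 Dl x'.
have mX : measurable_fun [set: Y] (fun y => a * l (x', y)) by exact: measurable_funM.
have bX y : `|a * l (x', y)| <= a * B.
  by rewrite normrM gtr0_norm// ler_wpM2l// ltW.
have aB0 : 0 < a * B by rewrite mulr_gt0.
(* The summand is small against the width only for large [n]: this amounts to [2 * B <= r ^+ 6]. *)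
have bw : 2 * (a * B) <= w.
  apply: le_trans nw; rewrite /a /noise -root16X8.
  rewrite -[leRHS]mul1r ler_pdivlMr ?exprn_gt0//.
  have -> : 2 * ((root16 R n ^+ 8)^-1 * B) * root16 R n ^+ 2 = 2 * B / root16 R n ^+ 6.
    by field; rewrite gt_eqF.
  rewrite ler_pdivrMr ?exprn_gt0// mul1r.
  apply: (@le_trans _ _ (root16 R n)); last first.
    by rewrite exprS ler_peMr ?exprn_ege1// ltW.
  rewrite -[leRHS]mul1r -ler_pdivrMr//.
  by near: n; exact: cvgr_le (cvg_root16V (2 * B)) _ ltr01.
have m0 : \int[output Phi x']_y (a * l (x', y)) = 0.
  rewrite RintegralZl//; last exact: score_integrable Dl x'.
  have -> : \int[output Phi x']_y l (x', y) = 0 by exact: score_mean0 Dl x'.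
  by rewrite mulr0.
have m2 : \int[output Phi x']_y (a * l (x', y)) ^+ 2 = a ^+ 2 * \int[Phi x']_y l (x', y) ^+ 2.
  under eq_Rintegral do rewrite exprMn.
  by rewrite RintegralZl//; exact: score_sqr_integrable Dl x'.
apply: le_trans (gaussian_replacement t mX aB0 bX bw m0 m2) _.
have n0 := noise_gt0 n; have d0 : 0 < a * B / w by rewrite divr_gt0.
have d1 : 0 < a * B / noise n by rewrite divr_gt0.
rewrite lee_fin ler_wpM2l// lerXn2r ?nnegrE ?(ltW d0) ?(ltW d1)//.
by rewrite ler_wpM2l ?(ltW aB0)// lef_pV2 ?posrE ?noise_gt0.
Unshelve. all: by end_near. Qed.

End rates.

(** * The Gaussian source *)

Section gaussian_source.
Variables (R : realType) (X : kspace R).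

Let embed (x : X) : prod_space (point_space R) X := (tt, x).

Let measurable_embed : measurable_fun [set: X] embed.
Proof. exact: measurable_fun_pair. Qed.

Let embed_channel : channel X (prod_space (point_space R) X) := kdirac measurable_embed.

(* [x] is kept and paired with an independent standard Gaussian. *)
Definition gaussian_source : channel X (prod_space (real_space R) X) :=
  comp_channel (tensor_channel (gaussian R) (id_channel X)) embed_channel.

Definition gaussian_source_tangent c : tangent X (prod_space (real_space R) X) :=
  comp_tc (tensor_tc (scale_tangent c (gaussian_shift R)) (id_channel X)) embed_channel.

Let Rintegral_embed x (h : prod_space (point_space R) X -> R) :
  measurable_fun [set: point_space R * X] h -> \int[embed_channel x]_y h y = h (tt, x).
Proof. exact: Rintegral_dirac. Qed.

Let Rintegral_id x (h : X -> R) :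
  measurable_fun [set: X] h -> \int[id_channel X x]_y h y = h x.
Proof. exact: Rintegral_dirac. Qed.

Lemma Rintegral_gaussian_source x h : bounded_measurable h ->
  \int[gaussian_source x]_w h w = \int[gaussian R tt]_u h (u, x).
Proof.
move=> bh; rewrite Rintegral_comp_channel// Rintegral_embed; last first.
  by have [] := bounded_measurable_kernel1 (tensor_channel (gaussian R) (id_channel X)) bh.
rewrite Rintegral_tensor_bounded//; apply: eq_Rintegral => u _.
by rewrite Rintegral_id//; have [] := bounded_measurable_pair u bh.
Qed.

Lemma texp_gaussian_source c x h : bounded_measurable h ->
  texp (gaussian_source_tangent c) x h = \int[gaussian R tt]_u (c * u * h (u, x)).
Proof.
move=> bh; rewrite texp_comp_tc// Rintegral_embed; last first.
  by have [] := bounded_measurable_texp1 (tensor_tc (scale_tangent c (gaussian_shift R)) (id_channel X)) bh.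
rewrite texp_tensor_tc//.
transitivity (texp (scale_tangent c (gaussian_shift R)) tt (fun u => h (u, x))).
  apply: eq_texp => u; rewrite Rintegral_id//.
  by have [] := bounded_measurable_pair u bh.
apply: (score_texp (score_gaussian_shift c)); case: bh => mh [M hM].
split; first exact: measurableT_comp mh (pair2_measurable x).
by exists M => u; exact: hM.
Qed.

Lemma fisher_bound_gaussian_shift c :
  fisher_bound (gaussian R) (scale_tangent c (gaussian_shift R)) (c ^+ 2).
Proof.
apply: (score_fisher_bound (score_gaussian_shift c)) => x.
by rewrite (Rintegral_score_gaussian_shift c x).
Qed.

Lemma fisher_bound_gaussian_source c :
  fisher_bound gaussian_source (gaussian_source_tangent c) (c ^+ 2).
Proof.
exact/fisher_bound_comp_tc/fisher_bound_tensor_id/fisher_bound_gaussian_shift.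
Qed.

(** (E) attaches the identity on [X] to the Gaussian shift, and (M1) absorbs the passage from [X] to
    its product with the one-point space. *)
Lemma metric_gaussian_source (G : channel_functional R) c :
  is_metric G -> axiom_M1 G -> axiom_E G -> axiom_N0 G ->
  G _ _ gaussian_source (gaussian_source_tangent c) <= c ^+ 2.
Proof.
move=> Gm M1 E N0; rewrite -(metric_gaussian_shift c Gm N0).
rewrite -(E _ _ X _ _ (local_data_gaussian_shift c)).
apply: M1; apply: fisher_bound_local_data.
exact/fisher_bound_tensor_id/fisher_bound_gaussian_shift.
Qed.

End gaussian_source.

(** * Upper bound for bounded scores *)

Section upper_bound.
Variable R : realType.
Local Notation mu := (@lebesgue_measure R).
Local Notation gauss := (output (gaussian R) tt).

Lemma Rintegral_gaussian_normal_pdf t c e z : 0 < e ->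
  \int[gauss]_u normal_pdf (t + c * u) e z = normal_pdf t (Num.sqrt (e ^+ 2 + c ^+ 2)) z.
Proof.
move=> e0; apply: ge0_Rintegral_fineK.
have m : measurable_fun [set: real_space R] (fun u => (normal_pdf (t + c * u) e z)%:E).
  apply/measurable_EFinP; apply: measurable_normal_pdf3 => //.
  by apply: measurable_funD => //; exact: measurable_funM.
transitivity (\int[gaussian R tt]_u (normal_pdf (t + c * u) e z)%:E)%E; first by [].
rewrite integral_gaussian//; last by move=> u; rewrite lee_fin normal_pdf_ge0.
have r0 : 0 < Num.sqrt (e ^+ 2 + c ^+ 2) by apply: sqrt_add_gt0 => //; exact: sqr_ge0.
have rE : Num.sqrt (e ^+ 2 + c ^+ 2) ^+ 2 = e ^+ 2 + c ^+ 2.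
  by rewrite sqr_sqrtr// addr_ge0// sqr_ge0.
have <- := integral_normal_conv t z e0 r0 rE.
by apply: eq_integral => u _; rewrite -EFinM mulrC.
Qed.

Variable G : channel_functional R.
Hypotheses (Gmetric : is_metric G) (M1 : axiom_M1 G) (M2 : axiom_M2 G)
  (E : axiom_E G) (A : axiom_A G) (C : axiom_C G) (N0 : axiom_N0 G).

Variables (X Y : kspace R) (Phi : channel X Y) (D : tangent X Y) (l : X * Y -> R) (B J : R).
Hypotheses (Dl : is_score Phi D l) (B0 : 0 < B) (lB : forall p, `|l p| <= B).
Hypothesis lJ : forall x, \int[Phi x]_y l (x, y) ^+ 2 <= J.

Let s x := \int[Phi x]_y l (x, y) ^+ 2.

Let s0 x : 0 <= s x. Proof. by apply: Rintegral_ge0 => y _; exact: sqr_ge0. Qed.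

Let J0 : 0 <= J. Proof. exact: le_trans (s0 point) (lJ point). Qed.

Let S n (x : space_pow X n) := n.+1%:R^-1 * variance_pow s n x.

Let S_le n (x : space_pow X n) : 0 <= S x <= J.
Proof.
have sJ x' : 0 <= s x' <= J by rewrite s0 lJ.
have /andP[v0 vJ] := variance_pow_bound x sJ.
by rewrite /S mulr_ge0 ?invr_ge0//= mulrC ler_pdivrMr// mulrC.
Qed.

Let rate n : R := (Num.sqrt n.+1%:R)^-1.

(** Both noisy observations have, exactly or nearly, the centred Gaussian law of variance
    [J + noise R n ^+ 2]: [T1] contributes [J], [T2] contributes [S x], and the width [V x] supplies
    the rest. So the source need not depend on [x]. *)
Let T1 n (w : prod_space (real_space R) (space_pow X n)) := Num.sqrt J * w.1.
Let T2 n (p : space_pow X n * space_pow Y n) := rate n * score_pow l n p.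
Let V n (x : space_pow X n) := Num.sqrt (noise R n ^+ 2 + (J - S x)).

Let mT1 n : measurable_fun [set: prod_space (real_space R) (space_pow X n)] (@T1 n).
Proof. by apply: measurable_funM => //; exact: measurable_fst. Qed.

Let mg n : measurable_fun [set: prod_space (real_space R) (space_pow X n)]
  (snd : prod_space (real_space R) (space_pow X n) -> space_pow X n).
Proof. exact: measurable_snd. Qed.

Let mT2 n : measurable_fun [set: space_pow X n * space_pow Y n] (@T2 n).
Proof. by apply: measurable_funM => //; apply: measurable_score_pow; case: Dl. Qed.

Let msqrt d (T : measurableType d) (h : T -> R) : measurable_fun [set: T] h ->
  measurable_fun [set: T] (fun x => Num.sqrt (h x)).
Proof.
move=> mh; apply: (measurableT_comp (f := @Num.sqrt R)) => //.
by apply: continuous_measurable_fun; exact: sqrt_continuous.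
Qed.

Let ms : measurable_fun [set: X] s.
Proof.
apply: (measurable_Rintegral_kernel Phi (f := fun p => l p ^+ 2)).
by apply: measurable_funX; case: Dl.
Qed.

Let mvariance n : measurable_fun [set: space_pow X n] (variance_pow s n).
Proof.
elim: n => [|n IH] //=; apply: measurable_funD.
  exact: measurableT_comp IH measurable_fst.
exact: measurableT_comp ms measurable_snd.
Qed.

Let mV n : measurable_fun [set: space_pow X n] (@V n).
Proof.
apply: msqrt; apply: measurable_funD => //; apply: measurable_funB => //.
exact: measurable_funM.
Qed.

Let V_ge n (x : space_pow X n) : noise R n <= V x.
Proof.
apply: sqrt_add_ge; first exact: noise_gt0.
by rewrite subr_ge0; case/andP: (S_le x).
Qed.

Let V0 n (x : space_pow X n) : 0 < V x.
Proof. exact: lt_le_trans (noise_gt0 R n) (V_ge x). Qed.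

Let K n : channel (prod_space (real_space R) (space_pow X n)) (space_pow Y n) :=
  simulation_channel (channel_pow Phi n) (@mg n) (@mT1 n) (@mT2 n) (@mV n) (noise_gt0 R n) (@V0 n).

Let Phi_ n := comp_channel (K n) (gaussian_source (space_pow X n)).
Let D_ n := comp_ct (K n)
  (gaussian_source_tangent (space_pow X n) (Num.sqrt n.+1%:R * Num.sqrt J)).

Let T1i : gauss.-integrable [set: real_space R] (EFin \o (fun u => (Num.sqrt J * u) ^+ 2)).
Proof. by have := score_sqr_integrable (score_gaussian_shift (Num.sqrt J)) tt. Qed.

Lemma metric_le_variance : G Phi D <= J.
Proof.
have cE (n : nat) : (Num.sqrt n.+1%:R * Num.sqrt J) ^+ 2 = n.+1%:R * J.
  by rewrite exprMn !sqr_sqrtr.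
apply: (metric_le_approx (Phi_ := Phi_) (D_ := D_) (b_ := fun=> J)
  (c := 1 + 2 * B ^+ 3 + 4 * (J + 1)) A C).
- exact: fisher_bound_local_data (score_fisher_bound Dl lJ).
- by move=> n; exact/fisher_bound_local_data/fisher_bound_comp_ct/fisher_bound_gaussian_source.
- apply: filterS (smoothed_score_pow Dl B0 lB) => n H x f mf f01.
  have bf := bounded_measurable01 mf f01.
  have bK := bounded_measurable_kernel1 (K n) bf.
  have [Ds DV] := score_powP n Dl.
  pose P2 := output (channel_pow Phi n) x.
  pose Kf u := \int[mu]_z (normal_pdf (Num.sqrt J * u) (noise R n) z *
     posterior P2 (fun y => T2 (x, y)) (V x) f z).
  have KE u : \int[K n (u, x)]_y f y = Kf u by exact: simulation_channelE.
  have -> : \int[Phi_ n x]_y f y = \int[gauss]_u Kf u.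
    rewrite Rintegral_comp_channel// Rintegral_gaussian_source//.
    by apply: eq_Rintegral => u _; rewrite KE.
  have mT1u : measurable_fun [set: real_space R] (fun u => Num.sqrt J * u) by exact: measurable_funM.
  have mT2x : measurable_fun [set: space_pow Y n] (fun y => T2 (x, y)).
    exact: measurableT_comp (@mT2 n) (pair1_measurable x).
  have T2i : P2.-integrable [set: space_pow Y n] (EFin \o (fun y => T2 (x, y) ^+ 2)).
    have := integrable_scale (rate n ^+ 2) (score_sqr_integrable Ds x).
    by apply: eq_integrable => // y _ /=; rewrite exprMn.
  have bKf : bounded_measurable Kf.
    have [mK [M KM]] := bK; rewrite -(funext KE); split; last by exists M => u; exact: KM.
    exact: measurableT_comp mK (pair2_measurable x).
  have rN : Num.sqrt n.+1%:R * rate n = 1 by rewrite divff// sqrtr_eq0 -ltNge.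
  (* A factor [sqrt N] is split off both tangent vectors, which leaves the normalised scores [T1]
     and [T2]. *)
  have -> : texp (D_ n) x f = Num.sqrt n.+1%:R * \int[gauss]_u (Num.sqrt J * u * Kf u).
    rewrite texp_comp_ct// texp_gaussian_source// -RintegralZl//.
      by apply: eq_Rintegral => u _; rewrite KE !mulrA.
    exact: integrableM_bounded (integrable_sqr mT1u T1i) bKf.
  have -> : texp (tangent_pow Phi D n) x f = Num.sqrt n.+1%:R * \int[P2]_y (T2 (x, y) * f y).
    rewrite (score_texp Ds)// -RintegralZl//; last first.
      exact: integrableM_bounded (integrable_sqr mT2x T2i) bf.
    by apply: eq_Rintegral => y _; rewrite /T2 !mulrA rN mul1r.
  have h1 : \int[gauss]_u (Num.sqrt J * u) ^+ 2 + noise R n ^+ 2 <= J + 1.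
    rewrite (Rintegral_score_gaussian_shift (Num.sqrt J) tt) sqr_sqrtr//.
    by rewrite lerD2l noise_sqr_le1.
  have VE : V x ^+ 2 = noise R n ^+ 2 + (J - S x).
    by rewrite sqr_sqrtr// addr_ge0 ?sqr_ge0// subr_ge0; case/andP: (S_le x).
  have h2 : \int[P2]_y T2 (x, y) ^+ 2 + V x ^+ 2 <= J + 1.
    have -> : \int[P2]_y T2 (x, y) ^+ 2 = S x.
      under eq_Rintegral do rewrite exprMn.
      rewrite RintegralZl//; last exact: score_sqr_integrable Ds x.
      by rewrite /rate exprVn sqr_sqrtr//; congr (_ * _); exact: DV.
    by rewrite VE addrCA subrKC addrC lerD2l noise_sqr_le1.
  have q : (\int[mu]_z (`|smoothed_density gauss (fun u => Num.sqrt J * u) (noise R n) z -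
      smoothed_density P2 (fun y => T2 (x, y)) (V x) z|)%:E <= (2 * B ^+ 3 * noise R n)%:E)%E.
    apply: le_trans (H x (V x) (V_ge x)); rewrite le_eqVlt; apply/orP; left; apply/eqP.
    apply: eq_integral => z _; rewrite distrC; congr (`|_ - _|%:E).
    (* [V x ^+ 2 + S x = noise R n ^+ 2 + J], whatever [x]. *)
    rewrite VE addrA subrK.
    transitivity (\int[gauss]_u normal_pdf (0 + Num.sqrt J * u) (noise R n) z).
      by apply: eq_Rintegral => u _; rewrite add0r.
    by rewrite Rintegral_gaussian_normal_pdf ?noise_gt0// sqr_sqrtr.
  have [e1 e2] := simulation_bounds (V0 x) (ltW B0) J0 mT1u mT2x T1i T2i h1 h2 q mf f01.
  split; first exact: e1.
  by rewrite -mulrBr normrM ger0_norm ?sqrtr_ge0// ler_wpM2l ?sqrtr_ge0.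
- exact: cvg_cst.
- move=> n; rewrite mulrC ler_pdivrMr// mulrC -cE.
  apply: le_trans (metric_gaussian_source _ _ Gmetric M1 E N0).
  exact/M2/fisher_bound_local_data/fisher_bound_gaussian_source.
Qed.

End upper_bound.

(** * Lower bound for a single input *)

Section lower_bound.
Variable R : realType.
Local Notation mu := (@lebesgue_measure R).
Local Notation gauss := (output (gaussian R) tt).

Lemma space_pow_point n (x y : space_pow (point_space R) n) : x = y.
Proof.
elim: n x y => [[] []//|n IH [x1 []] [y1 []]].
by rewrite (IH x1 y1).
Qed.

Lemma variance_pow_cst (X : kspace R) (s : X -> R) J n x :
  (forall x, s x = J) -> variance_pow s n x = n.+1%:R * J.
Proof.
move=> sJ; elim: n x => [x|n IH x] /=; first by rewrite sJ mul1r.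
by rewrite IH sJ -(natr1 n.+1) mulrDl mul1r.
Qed.

(** Telescoping with step error 0, since Gaussian scores convolve exactly with Gaussian noise. *)
Lemma smoothed_gaussian_pow (c a e : R) n (x : space_pow (point_space R) n) : 0 < e ->
  (\int[mu]_z (`|smoothed_density (output (channel_pow (gaussian R) n) x)
       (fun y => a * score_pow (fun p : point_space R * real_space R => c * p.2) n (x, y)) e z
     - normal_pdf 0 (Num.sqrt (e ^+ 2 + a ^+ 2 * (n.+1%:R * c ^+ 2))) z|)%:E <= 0)%E.
Proof.
move=> e0.
have sc := score_gaussian_shift (R := R) c.
pose s (x : point_space R) := c ^+ 2.
rewrite -[leRHS](mule0 n.+1%:R%:E) -EFinM -(@variance_pow_cst _ s (c ^+ 2) n x)//.
apply: telescoping (lexx e) => //; first by case: sc.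
  by move=> x1; exact: sqr_ge0.
move=> [] t w ew; rewrite integral0_eq// => z _; rewrite -[RHS]/(0%:E); congr EFin.
have -> : \int[gaussian R tt]_y normal_pdf (t + a * (c * (tt, y).2)) w z =
    \int[gauss]_u normal_pdf (t + a * c * u) w z.
  by apply: eq_Rintegral => u _; rewrite mulrA.
rewrite Rintegral_gaussian_normal_pdf; last exact: lt_le_trans ew.
by rewrite exprMn subrr normr0.
Qed.

Variable G : channel_functional R.
Hypotheses (Gmetric : is_metric G) (M2 : axiom_M2 G) (A : axiom_A G) (C : axiom_C G)
  (N0 : axiom_N0 G).

Variables (Y : kspace R) (p : channel (point_space R) Y) (D : tangent (point_space R) Y).
Variables (l : point_space R * Y -> R) (B : R).
Hypotheses (Dl : is_score p D l) (B0 : 0 < B) (lB : forall q, `|l q| <= B).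

Let J := \int[p tt]_y l (tt, y) ^+ 2.

Let J0 : 0 <= J. Proof. by apply: Rintegral_ge0 => y _; exact: sqr_ge0. Qed.

Let lJ x : \int[p x]_y l (x, y) ^+ 2 = J. Proof. by case: x. Qed.

Let c := Num.sqrt J.

Let cE : c ^+ 2 = J. Proof. by rewrite sqr_sqrtr. Qed.

Let gl (q : point_space R * real_space R) := c * q.2.

Let gc x : \int[gaussian R x]_u gl (x, u) ^+ 2 = J.
Proof. by rewrite -cE; exact: Rintegral_score_gaussian_shift. Qed.

Let sc : is_score (gaussian R) (scale_tangent c (gaussian_shift R)) gl.
Proof. exact: score_gaussian_shift. Qed.

Let rate n : R := (Num.sqrt n.+1%:R)^-1.
Let o n : space_pow (point_space R) n := point.

Let T1 n (y : space_pow Y n) := rate n * score_pow l n (o n, y).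
Let T2 n (q : space_pow (point_space R) n * space_pow (real_space R) n) := rate n * score_pow gl n q.

Let mT1 n : measurable_fun [set: space_pow Y n] (@T1 n).
Proof.
apply: measurable_funM => //; apply: (measurableT_comp (f := score_pow l n)) => //.
by apply: measurable_score_pow; case: Dl.
Qed.

Let mT2 n : measurable_fun [set: space_pow (point_space R) n * space_pow (real_space R) n] (@T2 n).
Proof. by apply: measurable_funM => //; apply: measurable_score_pow; case: sc. Qed.

Let mo n : measurable_fun [set: space_pow Y n] (fun=> o n). Proof. exact: measurable_cst. Qed.

Let mV n : measurable_fun [set: space_pow (point_space R) n] (fun=> noise R n).
Proof. exact: measurable_cst. Qed.

Let K n : channel (space_pow Y n) (space_pow (real_space R) n) :=
  simulation_channel (channel_pow (gaussian R) n) (@mo n) (@mT1 n) (@mT2 n) (@mV n)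
    (noise_gt0 R n) (fun=> noise_gt0 R n).

Let Phi_ n := comp_channel (K n) (channel_pow p n).
Let D_ n := comp_ct (K n) (tangent_pow p D n).

Let rN n : Num.sqrt n.+1%:R * rate n = 1.
Proof. by rewrite divff// sqrtr_eq0 -ltNge. Qed.

Let rate_sqr n : rate n ^+ 2 = n.+1%:R^-1.
Proof. by rewrite /rate exprVn sqr_sqrtr. Qed.

Let fb n : fisher_bound (channel_pow p n) (tangent_pow p D n) (n.+1%:R * J).
Proof.
have [Ds DV] := score_powP n Dl; apply: (score_fisher_bound Ds) => x.
by rewrite DV (variance_pow_cst _ lJ).
Qed.

Lemma metric_ge_variance : J <= G p D.
Proof.
rewrite -cE -(metric_gaussian_shift c Gmetric N0).
(* The approximated data are the Gaussian ones. By (M2) the simulation has at most the metric of the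
   powers of [p], and by (A) the resulting bound [b_] converges to [G p D]. *)
apply: (metric_le_approx (Phi_ := Phi_) (D_ := D_)
  (b_ := fun n => n.+1%:R^-1 * G (channel_pow p n) (tangent_pow p D n))
  (c := 1 + 2 * B ^+ 3 + 4 * (J + 1)) A C).
- exact: local_data_gaussian_shift.
- by move=> n; exact/fisher_bound_local_data/fisher_bound_comp_ct/fb.
- apply: filterS (smoothed_score_pow Dl B0 lB) => n H x f mf f01.
  have bf := bounded_measurable01 mf f01.
  rewrite (space_pow_point x (o n)).
  have [Ps PV] := score_powP n Dl.
  have [Gs GV] := score_powP n sc.
  pose P1 := output (channel_pow p n) (o n).
  pose P2 := output (channel_pow (gaussian R) n) (o n).
  pose Kf (y : space_pow Y n) := \int[mu]_z (normal_pdf (T1 y) (noise R n) z *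
     posterior P2 (fun y => T2 (o n, y)) (noise R n) f z).
  have KE y : \int[K n y]_u f u = Kf y by exact: simulation_channelE.
  have mT2x : measurable_fun [set: space_pow (real_space R) n] (fun y => T2 (o n, y)).
    exact: measurableT_comp (@mT2 n) (pair1_measurable (o n)).
  have T1i : P1.-integrable [set: space_pow Y n] (EFin \o (fun y => T1 y ^+ 2)).
    have := integrable_scale (rate n ^+ 2) (score_sqr_integrable Ps (o n)).
    by apply: eq_integrable => // y _ /=; rewrite exprMn.
  have T2i : P2.-integrable [set: space_pow (real_space R) n] (EFin \o (fun y => T2 (o n, y) ^+ 2)).
    have := integrable_scale (rate n ^+ 2) (score_sqr_integrable Gs (o n)).
    by apply: eq_integrable => // y _ /=; rewrite exprMn.
  have bKf : bounded_measurable Kf.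
    by rewrite -(funext KE); exact: bounded_measurable_kernel1.
  have -> : \int[Phi_ n (o n)]_y f y = \int[P1]_y Kf y.
    by rewrite Rintegral_comp_channel//; apply: eq_Rintegral => y _; rewrite KE.
  have -> : texp (D_ n) (o n) f = Num.sqrt n.+1%:R * \int[P1]_y (T1 y * Kf y).
    rewrite texp_comp_ct// (eq_texp _ _ KE) (score_texp Ps)// -RintegralZl//; last first.
      exact: integrableM_bounded (integrable_sqr (@mT1 n) T1i) bKf.
    by apply: eq_Rintegral => y _; rewrite /T1 !mulrA rN mul1r.
  have -> : texp (tangent_pow (gaussian R) (scale_tangent c (gaussian_shift R)) n) (o n) f =
      Num.sqrt n.+1%:R * \int[P2]_y (T2 (o n, y) * f y).
    rewrite (score_texp Gs)// -RintegralZl//; last first.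
      exact: integrableM_bounded (integrable_sqr mT2x T2i) bf.
    by apply: eq_Rintegral => y _; rewrite /T2 !mulrA rN mul1r.
  have NJ : n.+1%:R^-1 * (n.+1%:R * J) = J by rewrite mulKf.
  have h1 : \int[P1]_y T1 y ^+ 2 + noise R n ^+ 2 <= J + 1.
    have -> : \int[P1]_y T1 y ^+ 2 = J.
      under eq_Rintegral do rewrite exprMn.
      rewrite RintegralZl//; last exact: score_sqr_integrable Ps (o n).
      rewrite rate_sqr -[RHS]NJ; congr (_ * _).
      by have := PV (o n); rewrite (variance_pow_cst _ lJ).
    by rewrite lerD2l noise_sqr_le1.
  have h2 : \int[P2]_y T2 (o n, y) ^+ 2 + noise R n ^+ 2 <= J + 1.
    have -> : \int[P2]_y T2 (o n, y) ^+ 2 = J.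
      under eq_Rintegral do rewrite exprMn.
      rewrite RintegralZl//; last exact: score_sqr_integrable Gs (o n).
      rewrite rate_sqr -[RHS]NJ; congr (_ * _).
      by have := GV (o n); rewrite (variance_pow_cst _ gc).
    by rewrite lerD2l noise_sqr_le1.
  have q : (\int[mu]_z (`|smoothed_density P1 (@T1 n) (noise R n) z -
      smoothed_density P2 (fun y => T2 (o n, y)) (noise R n) z|)%:E <= (2 * B ^+ 3 * noise R n)%:E)%E.
    have q1 := H (o n) (noise R n) (lexx _).
    have q2 := smoothed_gaussian_pow c (rate n) (o n) (noise_gt0 R n).
    rewrite (variance_pow_cst _ lJ) in q1; rewrite rate_sqr cE in q2.
    (* Both smoothed densities are compared with the same Gaussian density [m]. *)
    move: q1 q2; set m := normal_pdf 0 _ => q1 q2.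
    have mm : measurable_fun [set: measurableTypeR R] m by exact: measurable_normal_pdf.
    have ms1 := measurable_smoothed_density P1 (noise_gt0 R n) (@mT1 n).
    have ms2 := measurable_smoothed_density P2 (noise_gt0 R n) mT2x.
    rewrite -[leRHS]adde0; apply: le_trans (leeD q1 q2).
    rewrite -ge0_integralD//; last 2 first.
    + by apply/measurable_EFinP; apply: measurableT_comp => //; exact: measurable_funB.
    + by apply/measurable_EFinP; apply: measurableT_comp => //; exact: measurable_funB.
    apply: ge0_le_integral => //.
    + by apply/measurable_EFinP; apply: measurableT_comp => //; exact: measurable_funB.
    + by apply: emeasurable_funD; apply/measurable_EFinP; apply: measurableT_comp => //; exact: measurable_funB.
    + by move=> z _; rewrite -EFinD lee_fin [X in _ <= _ + X]distrC -[X in `|X|](subrKA (m z)) ler_normD.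
  have [e1 e2] := simulation_bounds (noise_gt0 R n) (ltW B0) J0 (@mT1 n) mT2x T1i T2i h1 h2 q mf f01.
  split; first exact: e1.
  by rewrite -mulrBr normrM ger0_norm ?sqrtr_ge0// ler_wpM2l ?sqrtr_ge0.
- by apply: A; exact: fisher_bound_local_data (@fb 0%N).
- move=> n; rewrite ler_wpM2l ?invr_ge0//.
  exact/M2/fisher_bound_local_data/fb.
Qed.

End lower_bound.

(** * Finite output spaces *)

Section deterministic_input.
Variables (R : realType) (X Y Z : kspace R) (Phi : channel X Y) (D : tangent X Y).
Variables (q : Z -> X) (mq : measurable_fun [set: Z] q).

Lemma comp_kdiracE z A : measurable A -> comp_channel Phi (kdirac mq : channel Z X) z A = Phi (q z) A.
Proof.
move=> mA; rewrite comp_channelE; apply: (etrans (integral_dirac _ _ _)) => //.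
- exact: measurable_kernel.
- by rewrite diracT mul1e.
Qed.

Lemma integral_comp_kdirac z (f : Y -> \bar R) :
  (\int[comp_channel Phi (kdirac mq : channel Z X) z]_y f y = \int[Phi (q z)]_y f y)%E.
Proof. by apply: eq_measure_integral => A mA _; exact: comp_kdiracE. Qed.

Lemma Rintegral_comp_kdirac z (f : Y -> R) :
  \int[comp_channel Phi (kdirac mq : channel Z X) z]_y f y = \int[Phi (q z)]_y f y.
Proof. by rewrite /Rintegral integral_comp_kdirac. Qed.

Lemma texp_comp_kdirac z (f : Y -> R) : bounded_measurable f ->
  texp (comp_tc D (kdirac mq : channel Z X)) z f = texp D (q z) f.
Proof.
move=> bf; rewrite texp_comp_tc//; apply: Rintegral_dirac.
by have [] := bounded_measurable_texp1 D bf.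
Qed.

Lemma score_comp_kdirac l : is_score Phi D l ->
  is_score (comp_channel Phi (kdirac mq : channel Z X)) (comp_tc D (kdirac mq : channel Z X))
    (fun p => l (q p.1, p.2)).
Proof.
move=> Dl; split => [|z|z f bf].
- apply: (measurableT_comp (score_measurable Dl)); apply: measurable_fun_pair => //.
  exact: measurableT_comp mq measurable_fst.
- have /integrableP[m i] := score_sqr_integrable Dl (q z).
  by apply/integrableP; split => //; rewrite integral_comp_kdirac.
- by rewrite texp_comp_kdirac// (score_texp Dl)// Rintegral_comp_kdirac.
Qed.

End deterministic_input.

(** * Scores for a finite output space *)

Section finite_output.
Local Open Scope charge_scope.
Variables (R : realType) (X Y : kspace R) (Phi : channel X Y) (D : tangent X Y).
Hypothesis Yfin : finite_discrete Y.

(* [D x {y} / Phi x {y}], which is [0] where the denominator vanishes. *)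
Definition likelihood_ratio (p : X * Y) : R :=
  texp D p.1 (\1_[set p.2]) / \int[Phi p.1]_y \1_[set p.2] y.

Let mY (A : set Y) : measurable A. Proof. by case: Yfin => _; apply. Qed.

Let finY (A : set Y) : finite_set A.
Proof. by apply: sub_finite_set (proj1 Yfin). Qed.

Lemma finite_image_bounded (I : choiceType) (A : set I) (f : I -> R) : finite_set A ->
  exists M, forall i, A i -> `|f i| <= M.
Proof.
move=> /finite_seqP[s ->]; exists (\sum_(i <- s) `|f i|) => i /= si.
by rewrite (big_rem i)//= lerDl sumr_ge0.
Qed.

Lemma finite_bounded_measurable (f : Y -> R) : bounded_measurable f.
Proof.
split; first by move=> _ B _; exact: mY.
by have [M HM] := finite_image_bounded f (proj1 Yfin); exists M => y; exact: HM.
Qed.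

Lemma measurable_finite_output (f : X * Y -> R) :
  (forall y, measurable_fun [set: X] (fun x => f (x, y))) ->
  measurable_fun [set: X * Y] f.
Proof.
move=> mf _ B mB; rewrite setTI.
have -> : f @^-1` B = \bigcup_y (((fun x => f (x, y)) @^-1` B) `*` [set y]).
  apply/seteqP; split => [[x y] Bf|[x y] [y' _ [/= Bf ->]]] //.
  by exists y.
apply: fin_bigcup_measurable => [|y _]; first exact: (proj1 Yfin).
apply: measurableX => //; rewrite -[_ @^-1` _]setTI; exact: mf.
Qed.

Lemma measurable_likelihood_ratio : measurable_fun [set: X * Y] likelihood_ratio.
Proof.
apply: measurable_finite_output => y.
have b := bounded_measurable_indic R (mY [set y]).
apply: measurable_funM; first by case: (bounded_measurable_texp1 D b).
apply: measurable_invr_ge0; first by case: (bounded_measurable_kernel1 Phi b).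
by move=> x; apply: Rintegral_ge0.
Qed.

Let null_atoms x : output Phi x [set y | output Phi x [set y] = 0%E] = 0%E.
Proof.
set N := [set y | _].
have -> : N = \bigcup_(y in N) [set y] by apply/seteqP; split => [y Ny|_ [y Ny ->]] //; exists y.
rewrite measure_fin_bigcup//.
- by rewrite fsbig1.
- by move=> y y' _ _ [z [-> ->]].
Qed.

(** The Radon-Nikodym derivative is chosen separately for each [x], which says nothing on joint
    measurability. The explicit ratio is jointly measurable and equals it at each [y] of positive
    mass; the remaining points form a null set. *)
Lemma score_likelihood_ratio : (forall x, D x `<< output Phi x) ->
  is_score Phi D likelihood_ratio.
Proof.
move=> DP; split; first exact: measurable_likelihood_ratio.
  by move=> x; apply: channel_integrable; exact: finite_bounded_measurable.
move=> x f bf.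
have [mh hi hE hf] := Radon_Nikodym_fine (DP x).
set h := fun y => fine _ in mh hi hE hf.
have hl y : output Phi x [set y] <> 0%E -> h y = likelihood_ratio (x, y).
  move=> Py; have b := bounded_measurable_indic R (mY [set y]).
  have PE := Rintegral_indic (output Phi x) (mY [set y]).
  rewrite /likelihood_ratio /= hf//.
  transitivity ((h y * \int[output Phi x]_z \1_[set y] z) / \int[output Phi x]_z \1_[set y] z).
    rewrite mulfK//; apply/eqP => P0; apply: Py; by rewrite -PE P0.
  rewrite -RintegralZl//; last exact: bounded_integrable.
  congr (_ / _); apply: eq_Rintegral => z _; rewrite indicE.
  by have [/set_mem ->|_] := boolP (z \in [set y]); rewrite ?mulr0.
rewrite hf// /Rintegral; congr fine; apply: ae_eq_integral => //.
exists [set y | output Phi x [set y] = 0%E]; split => //.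
- exact: null_atoms.
- move=> y /= H; apply: contrapT => Py; apply: H => _.
  by have := hl y Py; rewrite /h => ->.
Qed.

End finite_output.

(** * Rounding the input to finitely many points *)

Section finite_range.
Variable R : realType.

(** Rounds [x] to the first listed centre whose cell contains it; the default [point] is reached
    only outside all cells. *)
Fixpoint select d (T : measurableType d) (U : T -> set T) (s : seq T) (x : T) : T :=
  if s is c :: s' then if x \in U c then c else select U s' x else point.

Lemma measurable_select d (T : measurableType d) (U : T -> set T) s :
  (forall c, measurable (U c)) -> measurable_fun [set: T] (select U s).
Proof.
move=> mU; elim: s => [|c s IH] /=; first exact: measurable_cst.
apply: measurable_fun_ifT => //; apply: (measurable_fun_bool true).
by rewrite setTI preimage_mem_true.
Qed.

Lemma select_in d (T : measurableType d) (U : T -> set T) (s : seq T) x c :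
  c \in s -> U c x -> U (select U s x) x.
Proof.
elim: s => [//|a s IH] /=; rewrite inE => /orP[/eqP -> Uax|cs Ucx].
  by rewrite mem_set.
by case: ifPn => [/set_mem//|_]; exact: IH.
Qed.

Lemma finite_range_select d (T : measurableType d) (U : T -> set T) s :
  finite_set (range (select U s)).
Proof.
apply: (@sub_finite_set _ _ [set` point :: s]); last exact: finite_seq.
move=> _ [x _ <-]; elim: s => [|c s IH] /=; first by rewrite inE.
case: ifP => _; first by rewrite !inE eqxx orbT.
by move: IH; rewrite /= !inE => /orP[->//|->]; rewrite !orbT.
Qed.

(** Balls of ['rV[R]_n] are those of the sup norm, hence the factor [Num.sqrt n%:R]. *)
Lemma enorm_le n (v : 'rV[R]_n) r : 0 <= r -> (forall i, `|v ord0 i| <= r) ->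
  enorm v <= Num.sqrt n%:R * r.
Proof.
move=> r0 vr; rewrite -[r in leRHS](ger0_norm r0) -sqrtr_sqr -sqrtrM// ler_wsqrtr//.
apply: (@le_trans _ _ (\sum_(i < n) r ^+ 2)); last first.
  by rewrite sumr_const card_ord mulr_natl.
by apply: ler_sum => i _; rewrite -[_ ^+ 2]real_normK ?num_real// lerXn2r ?nnegrE.
Qed.

Variables (n : nat) (K : set 'rV[R]_n) (cK : compact K) (K0 : K !=set0).
Local Notation X := (compact_space cK K0).

Lemma compact_val_inj : injective (@compact_val R n K cK K0).
Proof. by move=> x y; exact: val_inj. Qed.

Lemma enorm_eq0 (v : 'rV[R]_n) : enorm v = 0 -> v = 0.
Proof.
move=> /eqP; rewrite sqrtr_eq0 => v0; apply/rowP => i; rewrite mxE.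
have : v ord0 i ^+ 2 <= 0.
  apply: le_trans v0; rewrite (bigD1 i)//= lerDl sumr_ge0// => j _; exact: sqr_ge0.
by move=> h; apply/eqP; rewrite -sqrf_eq0 eq_le h sqr_ge0.
Qed.

(** Compactness gives a finite cover by small balls with centres in [K], and [select] rounds to a
    centre, so [q] stays inside [K]. *)
Lemma compact_finite_range e : 0 < e -> exists q : X -> X,
  [/\ measurable_fun [set: X] q, finite_set (range q) &
      forall x, enorm (compact_val (q x) - compact_val x) <= e].
Proof.
(* The summand 1 keeps the denominator positive in dimension 0. *)
move=> e0; pose r := e / (Num.sqrt n%:R + 1).
have s0 : 0 < Num.sqrt n%:R + 1 :> R by rewrite ltr_wpDl ?sqrtr_ge0.
have r0 : 0 < r by rewrite divr_gt0.
pose O (c : X) : set 'rV[R]_n := (ball (compact_val c) r)°.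
have oO c : open (O c) by exact: open_interior.
have := cK; rewrite compact_cover => /(_ X setT O (fun c _ => oO c)) [].
  move=> v Kv; exists (SigSub (mem_set Kv) : X) => //.
  by apply: nbhsx_ballx.
move=> s _ Ks.
pose U (c : X) : set X := (fun x => compact_val x) @^-1` O c.
have mU c : measurable (U c).
  exists (O c); last by rewrite setTI.
  by apply: sub_sigma_algebra.
exists (select U (finmap.enum_fset s)); split.
- exact: measurable_select.
- exact: finite_range_select.
move=> x; have [c cs Ucx] := Ks (compact_val x) (set_mem (valP x)).
have /interior_subset := select_in (U := U) (s := finmap.enum_fset s) cs Ucx.
case=> _ H.
apply: (@le_trans _ _ (Num.sqrt n%:R * r)).
  apply: enorm_le => [|i]; first exact: ltW.
  by rewrite !mxE ltW//; exact: H.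
by rewrite /r mulrCA ler_piMr ?(ltW e0)// ler_pdivrMr// mul1r lerDl ler01.
Qed.

End finite_range.

(** * Both bounds for a finite output space *)

Section finite_output_bounds.
Variables (R : realType) (G : channel_functional R).
Hypotheses (Gmetric : is_metric G) (M1 : axiom_M1 G) (M2 : axiom_M2 G)
  (E : axiom_E G) (A : axiom_A G) (C : axiom_C G) (N0 : axiom_N0 G).
Variables (X Y : kspace R) (Phi : channel X Y) (D : tangent X Y) (l : X * Y -> R).
Hypotheses (Yfin : finite_discrete Y) (PhiD : local_data Phi D) (Dl : is_score Phi D l).

(** [l] takes finitely many values on [range q] times the finite [Y]; this stands in for a lower
    bound on the positive output probabilities. *)
Let bounded_on_finite_range (Z : kspace R) (q : Z -> X) : finite_set (range q) ->
  exists2 B, 0 < B & forall p : Z * Y, `|l (q p.1, p.2)| <= B.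
Proof.
move=> fq; have [M HM] := finite_image_bounded l (finite_setX fq (proj1 Yfin)).
exists (`|M| + 1) => [|[z y]]; first by rewrite ltr_wpDl.
apply: le_trans (HM (q z, y) _) _; first by split => //; exists z.
by rewrite (le_trans (ler_norm M))// lerDl.
Qed.

Section finite_range.
Variables (J : R) (lJ : forall x, \int[Phi x]_y l (x, y) ^+ 2 <= J).
Variables (q : X -> X) (mq : measurable_fun [set: X] q).

Let Psi : channel X X := kdirac mq.

Let lqJ z : \int[comp_channel Phi Psi z]_y l (q z, y) ^+ 2 <= J.
Proof. by rewrite Rintegral_comp_kdirac. Qed.

Lemma local_data_comp_kdirac : local_data (comp_channel Phi Psi) (comp_tc D Psi).
Proof.
apply: (fisher_bound_local_data (c := J)).
exact: (score_fisher_bound (score_comp_kdirac mq Dl) lqJ).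
Qed.

Lemma metric_finite_range_le : finite_set (range q) ->
  G (comp_channel Phi Psi) (comp_tc D Psi) <= J.
Proof.
move=> /bounded_on_finite_range[B B0 lB].
exact: (metric_le_variance Gmetric M1 M2 E A C N0 (score_comp_kdirac mq Dl) B0 lB lqJ).
Qed.

End finite_range.

(** (M1) restricts the channel to the single input [x], to which the lower bound applies. *)
Lemma variance_le_metric x : \int[Phi x]_y l (x, y) ^+ 2 <= G Phi D.
Proof.
pose q (_ : point_space R) := x.
have mq : measurable_fun [set: point_space R] q by exact: measurable_cst.
have fq : finite_set (range q).
  by apply: (sub_finite_set _ (finite_set1 x)) => _ [u _ <-].
have [B B0 lB] := bounded_on_finite_range fq.
pose Psi : channel (point_space R) X := kdirac mq.
apply: le_trans (M1 Psi PhiD).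
have := metric_ge_variance Gmetric M2 A C N0 (score_comp_kdirac mq Dl) B0 lB.
by rewrite Rintegral_comp_kdirac.
Qed.

End finite_output_bounds.

(** * Continuity in the input and the conclusion *)

Section close_input.
Variables (R : realType) (X Y : kspace R) (Phi : channel X Y) (D : tangent X Y).
Variables (q : X -> X) (mq : measurable_fun [set: X] q) (e : R).
Hypothesis e0 : 0 <= e.
(** The case [q x = x] is kept apart because the modulus is controlled only at small positive
    distances. *)
Hypothesis qe : forall x, q x = x \/
  (Order.max
     (tv_norm (cdiff (charge_of_prob (output Phi (q x))) (charge_of_prob (output Phi x))))
     (tv_norm (cdiff (D (q x)) (D x))) <= e%:E)%E.

Let Psi : channel X X := kdirac mq.

Lemma texp_diff_comp_kdirac x (f : Y -> R) :
  measurable_fun [set: Y] f -> (forall y, 0 <= f y <= 1) ->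
  `|texp (diff_channel (comp_channel Phi Psi) Phi) x f| <= e.
Proof.
move=> mf f01; apply: texp_le_tv => // A mA.
rewrite tangentE mul1e /=.
rewrite comp_kdiracE//; case: (qe x) => [->|].
  by rewrite subee ?channel_fin// abse0 lee_fin.
rewrite ge_max => /andP[H _]; apply: le_trans H.
set nu := cdiff _ _; have -> : (Phi (q x) A - Phi x A = nu A)%E by [].
exact: abs_le_tv_norm.
Qed.

Lemma texp_sub_comp_kdirac x (f : Y -> R) :
  measurable_fun [set: Y] f -> (forall y, 0 <= f y <= 1) ->
  `|texp (sub_tangent (comp_tc D Psi) D) x f| <= e.
Proof.
move=> mf f01; apply: texp_le_tv => // A mA.
rewrite add_tangentE// scale_tangentE// EFinN mulN1e.
have -> : comp_tc D Psi x A = D (q x) A.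
  by rewrite !tangentE /= !comp_kdiracE.
case: (qe x) => [->|].
  rewrite subee ?abse0 ?lee_fin//.
  by rewrite -texp_indic.
rewrite ge_max => /andP[_ H]; apply: le_trans H.
set nu := cdiff _ _; have -> : (D (q x) A - D x A = nu A)%E by [].
exact: abs_le_tv_norm.
Qed.

End close_input.

Theorem theorem20 (R : realType) (G : channel_functional R)
    (Gmetric : is_metric G)
    (M1 : axiom_M1 G) (M2 : axiom_M2 G) (E : axiom_E G) (A : axiom_A G)
    (C : axiom_C G) (N0 : axiom_N0 G)
    (d : nat) (K : set 'rV[R]_d) (K_compact : compact K) (K_neq0 : K !=set0)
    (Y : kspace R) (Y_finite : finite_discrete Y)
    (Phi : channel (compact_space K_compact K_neq0) Y)
    (D : tangent (compact_space K_compact K_neq0) Y)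
    (PhiD : local_data Phi D)
    (f : R -> R) (f_cvg0 : f t @[t --> 0^'+] --> 0)
    (Phi_D_modulus : forall x x' : compact_space K_compact K_neq0,
      (Order.max
         (tv_norm (cdiff (charge_of_prob (output Phi x))
                         (charge_of_prob (output Phi x'))))
         (tv_norm (cdiff (D x) (D x')))
       <= (f (enorm (compact_val x - compact_val x')))%:E)%E)
    (C2 : axiom_C2 G Phi D) :
  (G _ _ Phi D)%:E = Gmin Phi D.
Proof.
have [DP Gfin] := PhiD.
pose l := likelihood_ratio Phi D.
have Dl : is_score Phi D l by exact: score_likelihood_ratio.
have fisherE x : fisher (output Phi x) (D x) = (\int[Phi x]_y l (x, y) ^+ 2)%:E.
  exact: score_fisher Dl _ (DP x).
have lG x : \int[Phi x]_y l (x, y) ^+ 2 <= G _ _ Phi D.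
  exact: (variance_le_metric Gmetric M1 M2 A C N0 Y_finite PhiD Dl).
have fisher_Gmin x : (fisher (output Phi x) (D x) <= Gmin Phi D)%E.
  by apply: ereal_sup_ubound; exists x.
have GminE : Gmin Phi D = (fine (Gmin Phi D))%:E.
  rewrite fineK// fin_numE -ltNye -ltey Gfin andbT.
  by apply: lt_le_trans (fisher_Gmin point); rewrite fisherE ltNyr.
have lJ x : \int[Phi x]_y l (x, y) ^+ 2 <= fine (Gmin Phi D).
  by rewrite -lee_fin -GminE -fisherE.
apply/eqP; rewrite eq_le; apply/andP; split; last first.
  by apply: ge_ereal_sup => _ [x _ <-]; rewrite fisherE lee_fin.
rewrite GminE lee_fin.
have Q (t : R) : exists q : compact_space K_compact K_neq0 -> compact_space K_compact K_neq0,
    [/\ measurable_fun [set: compact_space K_compact K_neq0] q, finite_set (range q) &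
    t != 0 -> forall x, q x = x \/
      f (enorm (compact_val (q x) - compact_val x)) <= `|t|].
  (* The family in (C2) is indexed by all [t], but its limit ignores [t = 0]; any map of finite
     range serves there. *)
  have [->|t0] := eqVneq t 0.
    have [q [mq fq _]] := compact_finite_range K_compact K_neq0 (@ltr01 R).
    by exists q; split => //; rewrite eqxx.
  have nt0 : 0 < `|t| by rewrite normr_gt0.
  have := cvgr_le _ f_cvg0 _ nt0; rewrite near_withinE => /(_ _)/nbhs_ballP[e /= e0 He].
  have [q [mq fq qe]] := compact_finite_range K_compact K_neq0 (divr_gt0 e0 (ltr0n R 2)).
  exists q; split => // _ x.
  have := qe x; set v := enorm _ => ve.
  have v0 : 0 <= v by exact: sqrtr_ge0.
  (* The value [f 0] is not controlled by the limit, but distance 0 forces [q x = x]. *)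
  have [/enorm_eq0/subr0_eq/compact_val_inj|vn0] := eqVneq v 0; first by left.
  have vp : 0 < v by rewrite lt_def vn0.
  right; apply: He => //; rewrite /ball /= sub0r normrN gtr0_norm//.
  by apply: le_lt_trans ve _; rewrite ltr_pdivrMr// ltr_pMr// ltr1n.
have [q Hq] := choice Q.
have mq t : measurable_fun [set: compact_space K_compact K_neq0] (q t) by case: (Hq t).
pose Psi t : channel (compact_space K_compact K_neq0) (compact_space K_compact K_neq0) :=
  kdirac (mq t).
have close t : t != 0 -> forall x, q t x = x \/
    (Order.max
       (tv_norm (cdiff (charge_of_prob (output Phi (q t x))) (charge_of_prob (output Phi x))))
       (tv_norm (cdiff (D (q t x)) (D x))) <= `|t|%:E)%E.
  move=> t0 x; have [_ _ /(_ t0 x)[->|ft]] := Hq t; first by left.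
  by right; apply: le_trans (Phi_D_modulus _ _) _; rewrite lee_fin.
have norm0 : `|t| @[t --> (0 : R)^'] --> (0 : R).
  by rewrite -[X in _ --> X](normr0 R); apply: cvg_within_filter; apply: norm_continuous.
(* By (C2) the metric of the rounded data converges to [G Phi D]; each of these values is at most
   the supremum, hence so is the limit. *)
have := @C2 (fun t => comp_channel Phi (Psi t)) (fun t => comp_tc D (Psi t)).
move=> /(_ _ _ _)/cvgr_to_le; apply.
- by move=> t; exact: (local_data_comp_kdirac Dl lJ).
- apply: (cvg_cb_norm norm0); near=> t => x g mg g01.
  apply: texp_diff_comp_kdirac => //; apply: close; near: t; exact: nbhs_dnbhs_neq.
- apply: (cvg_cb_norm norm0); near=> t => x g mg g01.
  apply: texp_sub_comp_kdirac => //; apply: close; near: t; exact: nbhs_dnbhs_neq.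
- apply: nearW => t.
  by apply: (metric_finite_range_le Gmetric M1 M2 E A C N0 Y_finite Dl lJ); case: (Hq t).
Unshelve. all: by end_near. Qed.
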